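(* Let $V$ be a vector superspace of dimension $n|m$, let $r\ge0$ and $0\le s\le m$, and let $\omega=\omega(dx)$ be a formal pseudoform. If the formal Baranov–Schwarz transform $$(\lambda_{r|s}\omega)(\dot x)=\fint D(dt)\,\omega(dt^F\dot x_F)$$ is defined, then it is a Voronov–Zorich $r|s$-form. (Here $\fint$, written below also as $\int^{\mathrm{formal}}$, denotes the formal integral.)
   Context: Indices: $A,B\in\{1,\dots,n,\hat1,\dots,\hat m\}$ with parity $\tilde A=0$ for unhatted, $1$ for hatted; $F,G\in\{1,\dots,r,\hat1,\dots,\hat s\}$, with parities likewise. Variables: $dx^A$ of parity $\tilde A+1$, written as odd $dx^1,\dots,dx^n$ and even $d\xi^1,\dots,d\xi^m$ ($d\xi^\mu=dx^{\hat\mu}$). Formal delta-functions: for an even variable $t$, $\delta(t)$ is a formal symbol, odd, with $t\,\delta(t)=0$ and $\delta(at)=a^{-1}\delta(t)$ for any even invertible $a$; its formal derivatives $\delta^{(j)}(t)$ are odd and obey the usual rules of differentiation. Products of such symbols in independent even variables are allowed; they are transformed under linear substitutions by Taylor expansion and these rules, so that for an invertible matrix $T$, $\delta(t_\mu T^\mu_1)\cdots\delta(t_\mu T^\mu_s)=(\det T)^{-1}\delta(t_1)\cdots\delta(t_s)$. A formal pseudoform (for given $s$) is a linear combination of products $$(dx^1)^{k_1}\cdots(dx^n)^{k_n}(d\xi^1)^{i_1}\cdots(d\xi^{m-s})^{i_{m-s}}\,\delta^{(j_1)}(d\xi^{m-s+1})\cdots\delta^{(j_s)}(d\xi^m),$$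 with $k_a\in\{0,1\}$, $i_\mu,j_\nu\in\mathbb Z_{\ge0}$. Formal integral: for a single even variable, $\int^{\mathrm{formal}}\delta(t)\,dt=1$ and $\int^{\mathrm{formal}}\delta^{(j)}(t)\,dt=0$ for $j\ge1$. It is extended to linear combinations of products of formal delta-functions and their derivatives in several even variables, and to odd variables by Berezin integration. For a non-degenerate linear change of even and odd variables $t=t(t')$ it satisfies $\int^{\mathrm{formal}}Dt\,f(t)=\int^{\mathrm{formal}}Dt'\,\operatorname{Ber}\frac{\partial t}{\partial t'}\,f(t(t'))$, where $\operatorname{Ber}$ is the Berezinian (no absolute values or extra signs). Formal Baranov–Schwarz transform: let $\dot x=(\dot x_F^A)$ be independent variables of parity $\tilde A+\tilde F$ (the components of $r$ even vectors $\dot x_1,\dots,\dot x_r$ and $s$ odd vectors $\dot x_{\hat1},\dots,\dot x_{\hat s}$) and $dt^F$ variables of parity $\tilde F+1$ ($r$ odd and $s$ even). Substitute $dx^A=dt^F\dot x_F^A$ into $\omega$ and take the formal integral over all $dt^F$. The transform is defined when this substitution is well defined by the rules above and gives a formal function of the $dt^F$ (a linear combination of products of odd $dt^F$ and of formal delta-functions and derivatives in the $s$ even $dt^F$) to which the formal integral applies; for this the odd-vector block $(\dot\xi^{m-s+\nu}_{\hat\kappa})_{\nu,\kappa=1..s}$ is taken invertible. Voronov–Zorich $r|s$-form on $V$: a function $L=L(\dot x)$ of $r$ even and $s$ odd vectors (possibly with singularities, i.e. not defined everywhere in $\dot x$) such that (BER) $L(g\cdot\dot x)=L(\dot x)\operatorname{Ber}g$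 for all $g\in GL(r|s)$, where $\dot x$ is the matrix with rows $\dot x_F$; (PDE) $\displaystyle\frac{\partial^2L}{\partial\dot x_F^A\,\partial\dot x_G^B}+(-1)^{\tilde F\tilde G+\tilde B(\tilde F+\tilde G)}\frac{\partial^2L}{\partial\dot x_G^A\,\partial\dot x_F^B}=0$ for all $A,B,F,G$. *)

(* Defs.v *)
From mathcomp Require Import all_boot all_algebra.
From mathcomp Require Export finmap.
From mathcomp Require Export monalg.

Set Implicit Arguments.
Unset Strict Implicit.
Unset Printing Implicit Defensive.

Import GRing.Theory.

Local Open Scope ring_scope.

(* Parities are booleans: false = even, true = odd.  A row or column index of
   an r|s- or n|m-supermatrix lives in 'I_(p + q): the first p values are the
   unhatted (even) indices, the last q values the hatted (odd) ones. *)
Definition parity (p q : nat) (i : 'I_(p + q)) : bool := (p <= i)%N.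

Record superalgebra (K : fieldType) := Superalgebra {
  salg_car :> unitAlgType K;
  homog : bool -> salg_car -> Prop;
  homog0 : forall b, homog b 0;
  homog_linear : forall b (c : K) x y,
    homog b x -> homog b y -> homog b (c *: x + y);
  homog1 : homog false 1;
  homogM : forall a b x y,
    homog a x -> homog b y -> homog (a (+) b) (x * y);
  homog_decomp : forall x, exists x0 x1,
    [/\ homog false x0, homog true x1 & x = x0 + x1];
  homog_disj : forall x, homog false x -> homog true x -> x = 0;
  supercommutative : forall a b x y,
    homog a x -> homog b y -> x * y = (-1) ^+ (a && b) * (y * x)
}.

Definition even_morphism (K : fieldType) (R R' : superalgebra K)
    (phi : {lrmorphism R -> R'}) : Prop :=
  forall b x, homog b x -> homog b (phi x).

(* An even p|q x p'|q'-supermatrix over R.  For p|q = r|s and p'|q' = n|m its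
   rows are r even and s odd vectors of the n|m-dimensional superspace. *)
Definition even_smx (K : fieldType) (R : superalgebra K) (p q p' q' : nat)
    (x : 'M[R]_(p + q, p' + q')) : Prop :=
  forall F A, homog (parity F (+) parity A) (x F A).

(* R is not a commutative ring, so the library's invmx does not apply; this is
   the same formula, used only for matrices whose entries are even. *)
Definition inv_evenmx (K : fieldType) (R : superalgebra K) (p : nat)
    (X : 'M[R]_p) : 'M[R]_p := (\det X)^-1 *: \adj X.

(* The R-points of GL(r|s). *)
Definition GLsuper (K : fieldType) (R : superalgebra K) (r s : nat)
    (g : 'M[R]_(r + s)) : Prop :=
  even_smx g /\
  exists h : 'M[R]_(r + s), [/\ even_smx h, g *m h = 1%:M & h *m g = 1%:M].

Definition Ber (K : fieldType) (R : superalgebra K) (r s : nat)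
    (g : 'M[R]_(r + s)) : R :=
  \det (ulsubmx g - ursubmx g *m inv_evenmx (drsubmx g) *m dlsubmx g)
  * (\det (drsubmx g))^-1.

(* Partially defined functions of r even and s odd vectors, given by their
   values on R-points for every commutative superalgebra R; val is irrelevant
   outside dom.  The generic point, whose entries are independent variables,
   is one such R-point. *)
Record pfunction (K : fieldType) (r s n m : nat) := PFunction {
  dom : forall R : superalgebra K, 'M[R]_(r + s, n + m) -> Prop;
  val : forall R : superalgebra K, 'M[R]_(r + s, n + m) -> R
}.

Definition superfunction (K : fieldType) (r s n m : nat)
    (L : pfunction K r s n m) : Prop :=
  forall (R R' : superalgebra K) (phi : {lrmorphism R -> R'}),
  even_morphism phi ->
  forall x : 'M[R]_(r + s, n + m), even_smx x -> dom L x ->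
  dom L (map_mx phi x) /\ val L (map_mx phi x) = phi (val L x).

(* D is the left partial derivative of L in the (F, A) entry:
   L(x + eps) = L(x) + eps * D(x) for increments eps of square zero and of the
   parity of that entry.  As R ranges over all superalgebras, including the
   extensions R[eps], this determines D on the domain of L. *)
Definition is_partial (K : fieldType) (r s n m : nat) (L : pfunction K r s n m)
    (F : 'I_(r + s)) (A : 'I_(n + m)) (D : pfunction K r s n m) : Prop :=
  superfunction D /\
  forall (R : superalgebra K) (x : 'M[R]_(r + s, n + m)),
  even_smx x -> dom L x ->
  dom D x /\
  forall eps : R, homog (parity F (+) parity A) eps -> eps * eps = 0 ->
  dom L (x + eps *: delta_mx F A) /\
  val L (x + eps *: delta_mx F A) = val L x + eps * val D x.

Definition BER (K : fieldType) (r s n m : nat) (L : pfunction K r s n m) : Prop :=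
  forall (R : superalgebra K) (g : 'M[R]_(r + s)) (x : 'M[R]_(r + s, n + m)),
  GLsuper g -> even_smx x ->
  (dom L (g *m x) <-> dom L x) /\
  (dom L x -> val L (g *m x) = val L x * Ber g).

(* D2 F A G B is the derivative in the (F, A) entry of the derivative in the
   (G, B) entry. *)
Definition PDE (K : fieldType) (r s n m : nat) (L : pfunction K r s n m) : Prop :=
  exists (D1 : 'I_(r + s) -> 'I_(n + m) -> pfunction K r s n m)
    (D2 : 'I_(r + s) -> 'I_(n + m) -> 'I_(r + s) -> 'I_(n + m) ->
          pfunction K r s n m),
  [/\ forall G B, is_partial L G B (D1 G B),
      forall F A G B, is_partial (D1 G B) F A (D2 F A G B) &
      forall F G A B (R : superalgebra K) (x : 'M[R]_(r + s, n + m)),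
      even_smx x -> dom L x ->
      val (D2 F A G B) x
      + (-1) ^+ ((parity F && parity G)
                 (+) (parity B && (parity F (+) parity G)))
        * val (D2 G A F B) x = 0].

Definition Voronov_Zorich_form (K : fieldType) (r s n m : nat)
    (L : pfunction K r s n m) : Prop :=
  [/\ superfunction L, BER L & PDE L].

(* The exponents (k, i, j) of the monomial
   (dx^1)^k_1 ... (dx^n)^k_n (dxi^1)^i_1 ... (dxi^(m-s))^i_(m-s)
   delta^(j_1)(dxi^(m-s+1)) ... delta^(j_s)(dxi^m),
   with k given as the set of the a such that k_a = 1. *)
Notation dxmonomial n m s :=
  (({set 'I_n} * {ffun 'I_(m - s) -> nat}) * {ffun 'I_s -> nat})%type.

Notation pseudoform K n m s := {malg K[dxmonomial n m s]}.

(* The columns of dxi^1, ..., dxi^(m-s) and of dxi^(m-s+1), ..., dxi^m. *)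
Definition poly_col (n m s : nat) (mu : 'I_(m - s)) : 'I_(n + m) :=
  rshift n (widen_ord (leq_subr s m) mu).

Definition delta_col (n m s : nat) (hs : (s <= m)%N) (nu : 'I_s) : 'I_(n + m) :=
  rshift n (cast_ord (subnK hs) (rshift (m - s) nu)).

(* The monomial (S, k) is the product, in increasing order, of the odd dt^i,
   i in S, followed by delta^(k_1)(t_1) ... delta^(k_s)(t_s), where
   t_1, ..., t_s are the even dt^F.  A formal function of dt is a combination
   of these monomials with coefficients in R, which are written on the right of
   the monomials: c *: << u >> denotes u c. *)
Notation dtmonomial r s := ({set 'I_r} * {ffun 'I_s -> nat})%type.

Notation formal_function R r s := {malg R[dtmonomial r s]}.

Section Transform.

Variables (K : fieldType) (R : superalgebra K) (r s : nat).

Local Notation formal := (formal_function R r s).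

Definition dtparity (u : dtmonomial r s) : bool := odd (#|u.1| + s).

Definition extend (h : dtmonomial r s -> formal) (f : formal) : formal :=
  \sum_(u <- msupp f) f@_u *: h u.

(* Left multiplication by an a of parity p; a u = (-1)^(p |u|) u a. *)
Definition mul_coef (p : bool) (a : R) (f : formal) : formal :=
  \sum_(u <- msupp f) << (-1) ^+ (p && dtparity u) * (a * f@_u) *g u >>.

(* Left multiplication by dt^F; in the even case t delta^(k)(t) =
   - k delta^(k-1)(t), obtained by differentiating t delta(t) = 0. *)
Definition mul_dt (F : 'I_(r + s)) : formal -> formal :=
  match split F with
  | inl i => extend (fun u =>
      if i \in u.1 then 0 else
      (-1) ^+ #|[set l in u.1 | (l < i)%N]| *: << (i |: u.1, u.2) >>)
  | inr kappa => extend (fun u =>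
      - (u.2 kappa)%:R *: << (u.1, [ffun l => (u.2 l - (l == kappa))%N]) >>)
  end.

Definition diff_t (kappa : 'I_s) : formal -> formal :=
  extend (fun u => << (u.1, [ffun l => (u.2 l + (l == kappa))%N]) >>).

(* Coefficient extraction is the Berezin integral in the odd dt^F combined with
   int delta(t) dt = 1 and int delta^(k)(t) dt = 0, k > 0, in the even ones,
   D(dt) being normalized so that
   int D(dt) dt^1 ... dt^r delta(t_1) ... delta(t_s) = 1. *)
Definition formal_integral (f : formal) : R := f@_(setT, [ffun=> 0%N]).

Variables (n m : nat) (hs : (s <= m)%N) (x : 'M[R]_(r + s, n + m)).

(* Left multiplication by dx^A = dt^F x_F^A. *)
Definition mul_dx (A : 'I_(n + m)) (f : formal) : formal :=
  \sum_(F < r + s) mul_dt F (mul_coef (parity F (+) parity A) (x F A) f).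

Definition odd_block : 'M[R]_s :=
  \matrix_(kappa, nu) x (rshift r kappa) (delta_col n hs nu).

(* dxi^(m-s+nu) = N_nu + y_nu with y_nu = t_kappa odd_block_(kappa, nu) and
   N_nu the nilpotent sum over the odd dt^F. *)
Definition mul_nilp (nu : 'I_s) (f : formal) : formal :=
  \sum_(i < r) mul_dt (lshift s i)
    (mul_coef true (x (lshift s i) (delta_col n hs nu)) f).

Definition diff_y (nu : 'I_s) (f : formal) : formal :=
  \sum_(kappa < s) inv_evenmx odd_block nu kappa *: diff_t kappa f.

(* f(y) is sent to f(y_nu + N_nu), expanded by Taylor's formula in N_nu; the
   expansion stops at order r, since N_nu is a sum of r terms of square 0. *)
Definition taylor (nu : 'I_s) (f : formal) : formal :=
  \sum_(l < r.+1)
    ((l`!)%:R^-1 : K)%:A *: iter l (mul_nilp nu) (iter l (diff_y nu) f).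

(* delta(y_1) ... delta(y_s). *)
Definition delta_y : formal :=
  (\det odd_block)^-1 *: << (set0, [ffun=> 0%N]) >>.

Definition subst_delta (j : {ffun 'I_s -> nat}) : formal :=
  foldr (fun nu f => taylor nu (iter (j nu) (diff_y nu) f))
    delta_y (enum 'I_s).

Definition subst_monomial (u : dxmonomial n m s) : formal :=
  let: (k, i, j) := u in
  foldr (fun a f => if a \in k then mul_dx (lshift m a) f else f)
    (foldr (fun mu f => iter (i mu) (mul_dx (poly_col n mu)) f)
      (subst_delta j) (enum 'I_(m - s)))
    (enum 'I_n).

(* omega(dt^F x_F). *)
Definition subst_form (omega : pseudoform K n m s) : formal :=
  \sum_(u <- msupp omega) (omega@_u)%:A *: subst_monomial u.

End Transform.

Definition transform (K : fieldType) (r s n m : nat) (hs : (s <= m)%N)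
    (omega : pseudoform K n m s) : pfunction K r s n m :=
  PFunction
    (fun R x => \det (odd_block hs x) \is a GRing.unit)
    (fun R x => formal_integral (subst_form hs x omega)).

(* Main.v *)
From HB Require Import structures.
From mathcomp Require boolp.
Require Import Defs.
From mathcomp Require Import all_boot all_algebra.

(** The transform integrates omega(dt x), which is omega with dt^F x_F^A in place
of dx^A, so both properties of a Voronov-Zorich form come from calculus in the
variables dt.

Formal functions of dt carry the left multiplications by the dt^F and by the
coefficients, and the left derivatives along the dt^F, with the canonical
commutation relations (diff_mul_dt). Write X_A for multiplication by
dx^A = dt^F x_F^A, and v_j for the substituted product of the
delta^(j_nu)(dxi^(m-s+nu)). The v_j involve the inverse of the odd block and a
Taylor expansion in the odd dt^F. They are handled through a characterization:
they are the only family such that X_nu v_j = - j_nu v_(j - e_nu) for the last s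
columns nu and such that the coefficients without derivatives of delta-functions
are those of delta(y_1) ... delta(y_s) (delta_family_subst,
delta_family_unique). A statement about omega(dt x) is then checked on these two
properties and extended to products of the dx^A by an induction.

Let d_A be the derivative of pseudoforms along dx^A (pdiff). If eps has square
zero, then the increment of x_F^A by eps changes omega(dt x) by
dt^F eps (d_A omega)(dt x) (subst_form_increment); and the derivative of
omega(dt x) along dt^G is the sum over A of x_G^A (d_A omega)(dt x)
(diff_subst_form).

By the first rule the derivative of the transform in x_F^A is, up to a sign, the
integral of dt^F (d_A omega)(dt x), and a second derivative is the integral of
dt^G dt^F (d_A d_B omega)(dt x). In the differential equation, interchanging F
and G keeps d_A d_B and only interchanges dt^G and dt^F, so the equation
expresses the supercommutativity of the dt^F (dts_symmetric).

For the behaviour under g in GL(r|s), the odd-odd block of g is invertible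
because it is so up to products of odd elements (GLsuper_drsubmx_unit). Hence g
is the product of an upper unitriangular, a block-diagonal and a lower
unitriangular supermatrix (super_LDU). The unitriangular ones are products of
transvections 1 + eps E_FG with eps odd and F, G of opposite parities. By the
two rules, such a transvection adds dt^F eps d/dt^G (omega(dt x)) to
omega(dt x), up to the order of the factors, and the integral of this vanishes
(transvection_form, coef_top_total_derivative). For g = diag(a, d), the
substitution dt -> dt g is an operator that intertwines the multiplications by
dx^A at x and at g x (change_dt_form). On the integral, the delta-functions
contribute det(d)^-1 by definition, and the odd variables contribute det(a), by
the Laplace expansion (pairing_oprod). The product of the two is Ber g. *)

Set Implicit Arguments.
Unset Strict Implicit.
Unset Printing Implicit Defensive.

Import GRing.Theory.
Local Open Scope ring_scope.

(** * Exponents of the delta-functions *)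

Section Exponents.

Variable s : nat.
Implicit Types (k : {ffun 'I_s -> nat}) (l mu nu : 'I_s).

Definition incr k nu : {ffun 'I_s -> nat} := [ffun l => (k l + (l == nu))%N].
Definition decr k nu : {ffun 'I_s -> nat} := [ffun l => (k l - (l == nu))%N].

Lemma incrE k nu l : incr k nu l = (k l + (l == nu))%N.
Proof. by rewrite ffunE. Qed.

Lemma decrE k nu l : decr k nu l = (k l - (l == nu))%N.
Proof. by rewrite ffunE. Qed.

Lemma incrK k nu : decr (incr k nu) nu = k.
Proof. by apply/ffunP => l; rewrite decrE incrE addnK. Qed.

Lemma decrK k nu : (0 < k nu)%N -> incr (decr k nu) nu = k.
Proof.
move=> k_gt0; apply/ffunP => l; rewrite incrE decrE.
by case: eqVneq => [->|_]; rewrite ?subnK // subn0 addn0.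
Qed.

Lemma incrC k mu nu : incr (incr k mu) nu = incr (incr k nu) mu.
Proof. by apply/ffunP => l; rewrite !incrE addnAC. Qed.

Lemma decr_incr k mu nu : (0 < k mu)%N -> decr (incr k nu) mu = incr (decr k mu) nu.
Proof.
move=> k_gt0; apply/ffunP => l; rewrite !(incrE, decrE).
by case: (eqVneq l mu) => [->|_]; [rewrite addnBAC | rewrite !subn0].
Qed.

Lemma decr_incr_neq k mu nu : mu != nu -> decr (incr k nu) mu = incr (decr k mu) nu.
Proof.
move=> mu_nu; apply/ffunP => l; rewrite !(incrE, decrE).
case: (eqVneq l mu) => [->|_]; last by rewrite !subn0.
by rewrite (negPf mu_nu) !addn0.
Qed.

Lemma incr_neq0 k nu : incr k nu != [ffun=> 0%N].
Proof.
by apply/eqP => /ffunP /(_ nu); rewrite incrE ffunE eqxx addn1.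
Qed.

Lemma eq_incr_decr k k' nu : (incr k nu == k') = (0 < k' nu)%N && (k == decr k' nu).
Proof.
apply/eqP/andP => [<-|[k_gt0 /eqP ->]]; last exact: decrK.
by rewrite incrE eqxx addn1 incrK.
Qed.

Lemma exponent_ind (P : {ffun 'I_s -> nat} -> Prop) :
  (forall k, (forall nu, (0 < k nu)%N -> P (decr k nu)) -> P k) ->
  forall k, P k.
Proof.
move=> IH k.
have [d] := ubnP (\sum_l k l)%N; elim: d k => // d IHd k lt_d.
apply: IH => nu k_gt0; apply: IHd; move: lt_d.
have -> : (\sum_l k l = (\sum_l decr k nu l).+1)%N.
  rewrite (bigD1 nu) //= [in RHS](bigD1 nu) //= decrE eqxx.
  rewrite [in RHS](eq_bigr (fun l => k l)); last first.
    by move=> l /negPf l_nu; rewrite decrE l_nu subn0.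
  by rewrite -addSn subn1 prednK.
by rewrite ltnS.
Qed.

End Exponents.

Section CountBelow.

Variable r : nat.
Implicit Types (S : {set 'I_r}) (i j : 'I_r).

(** The number of factors that dt^i passes on its way to its place in an
increasing product of odd dt's. *)
Definition below S i : nat := #|[set l in S | (l < i)%N]|.

Lemma below_setU1 S i j : j \notin S -> below (j |: S) i = ((j < i) + below S i)%N.
Proof.
move=> jS; rewrite /below; case: (ltnP j i) => ji.
  rewrite (_ : [set l in j |: S | _] = j |: [set l in S | (l < i)%N]).
    by rewrite cardsU1 inE (negPf jS).
  by apply/setP => l; rewrite !inE; case: eqP => [->|] //=; rewrite ji.
rewrite add0n; apply: eq_card => l; rewrite !inE.
by case: eqP => [->|] //=; rewrite ltnNge ji !andbF.
Qed.

Lemma below_setD1 S i j : j \in S -> below S i = ((j < i) + below (S :\ j) i)%N.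
Proof. by move=> jS; rewrite -{1}(setD1K jS) below_setU1 // !inE eqxx. Qed.

End CountBelow.

(** * Central elements *)

Section Central.

Variables (K : fieldType) (R : unitAlgType K).
Implicit Types (a c y : R).

Definition central c := forall y, GRing.comm c y.

Lemma central_sign n : central ((-1) ^+ n).
Proof. by move=> y; apply/commr_sym/commr_sign. Qed.

Lemma central_nat n : central n%:R.
Proof. by move=> y; apply/commr_sym/commr_nat. Qed.

Lemma centralN c : central c -> central (- c).
Proof. by move=> cc y; apply/commr_sym/commrN/commr_sym/cc. Qed.

Lemma centralM a c : central a -> central c -> central (a * c).
Proof. by move=> ca cc y; apply/commr_sym/commrM; apply/commr_sym. Qed.

Lemma central_alg (k : K) : central k%:A.
Proof. by move=> y; rewrite /GRing.comm mulr_algl mulr_algr. Qed.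

Lemma centralCA a c y : central c -> a * (c * y) = c * (a * y).
Proof. by move=> cc; rewrite mulrA -(cc a) mulrA. Qed.

Lemma central1 : central 1.
Proof. by move=> y; apply/commr_sym/commr1. Qed.

Lemma central0 : central 0.
Proof. by move=> y; apply/commr_sym/commr0. Qed.

End Central.

Arguments central_sign {K R} n.
Arguments central_nat {K R} n.
Arguments central1 {K R}.
Arguments central0 {K R}.
Arguments centralCA {K R} a {c} y.

(** * Operators on formal functions *)

(** The space of formal functions of dt enters the argument only through the
coefficients of its elements and the action of the operators on them, so it is
kept abstract. Here fextend extends a function of the monomials to a left-linear
map, and formal_ind says that the monomials span. *)
Record formal_space (K : fieldType) (R : superalgebra K) (r s : nat) :=
  FormalSpace {
  fsp_car :> lmodType R;
  coef : fsp_car -> dtmonomial r s -> R;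
  fmul_coef : bool -> R -> fsp_car -> fsp_car;
  fmul_dt : 'I_(r + s) -> fsp_car -> fsp_car;
  fdiff_even : 'I_r -> fsp_car -> fsp_car;
  fdiff_odd : 'I_s -> fsp_car -> fsp_car;
  fmon : dtmonomial r s -> fsp_car;
  fextend : (dtmonomial r s -> fsp_car) -> fsp_car -> fsp_car;
  coef_linear : forall c f g u, coef (c *: f + g) u = c * coef f u + coef g u;
  coef_inj : forall f g, (forall u, coef f u = coef g u) -> f = g;
  coef_mul_coef : forall p a f u,
    coef (fmul_coef p a f) u = (-1) ^+ (p && dtparity u) * (a * coef f u);
  coef_mul_dt_even : forall i f S k,
    coef (fmul_dt (lshift s i) f) (S, k) =
    if i \in S then (-1) ^+ below (S :\ i) i * coef f (S :\ i, k) else 0;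
  coef_mul_dt_odd : forall kappa f S k,
    coef (fmul_dt (rshift r kappa) f) (S, k) =
    - ((k kappa).+1%:R * coef f (S, incr k kappa));
  coef_fdiff_even : forall i f S k,
    coef (fdiff_even i f) (S, k) =
    if i \in S then 0 else (-1) ^+ below S i * coef f (i |: S, k);
  coef_fdiff_odd : forall kappa f S k,
    coef (fdiff_odd kappa f) (S, k) =
    if (0 < k kappa)%N then coef f (S, decr k kappa) else 0;
  coef_mon : forall u v, coef (fmon u) v = (u == v)%:R;
  fextend_linear : forall h c f g,
    fextend h (c *: f + g) = c *: fextend h f + fextend h g;
  fextend_mon : forall h u, fextend h (fmon u) = h u;
  formal_ind : forall P : fsp_car -> Prop,
    P 0 -> (forall c u f, P f -> P (c *: fmon u + f)) -> forall f, P f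
}.

(** The left derivative with respect to dt^G. *)
Definition fdiff (K : fieldType) (R : superalgebra K) (r s : nat)
    (M : formal_space R r s) (G : 'I_(r + s)) : M -> M :=
  match split G with
  | inl i => @fdiff_even _ _ _ _ M i
  | inr kappa => @fdiff_odd _ _ _ _ M kappa
  end.

Section Parity.

Variables r s : nat.

Lemma parity_lshift (i : 'I_r) : parity (lshift s i) = false.
Proof. by rewrite /parity /= leqNgt ltn_ord. Qed.

Lemma parity_rshift (kappa : 'I_s) : parity (rshift r kappa) = true.
Proof. by rewrite /parity /= leq_addr. Qed.

Lemma dtparity_setD1 (S : {set 'I_r}) (k : {ffun 'I_s -> nat}) i : i \in S ->
  dtparity (S :\ i, k) = ~~ dtparity (S, k).
Proof. by move=> iS; rewrite /dtparity /= (cardsD1 i S) iS addSn /= negbK. Qed.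

End Parity.

Section Operators.

Variables (K : fieldType) (R : superalgebra K) (r s : nat).
Variable M : formal_space R r s.
Implicit Types (f g : M) (u v : dtmonomial r s) (a b c : R).
Implicit Types (p q : bool) (F G : 'I_(r + s)).

Local Notation e_ := (@fmul_dt _ _ _ _ M).
Local Notation d_ := (@fdiff _ _ _ _ M).
Local Notation c_ := (@fmul_coef _ _ _ _ M).

Lemma fcoefD f g u : coef (f + g) u = coef f u + coef g u.
Proof. by rewrite -{1}(scale1r f) coef_linear mul1r. Qed.

Lemma fcoef0 u : coef (0 : M) u = 0.
Proof. by apply: (addrI (coef (0 : M) u)); rewrite -fcoefD !addr0. Qed.

Lemma fcoefZ c f u : coef (c *: f) u = c * coef f u.
Proof. by rewrite -(addr0 (c *: f)) coef_linear fcoef0 addr0. Qed.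

Lemma fcoefN f u : coef (- f) u = - coef f u.
Proof. by rewrite -scaleN1r fcoefZ mulN1r. Qed.

Lemma fcoef_sum (I : Type) (l : seq I) (P : pred I) (F : I -> M) u :
  coef (\sum_(i <- l | P i) F i) u = \sum_(i <- l | P i) coef (F i) u.
Proof. by elim/big_rec2: _ => [|i y f _ <-]; rewrite ?fcoef0 ?fcoefD. Qed.

Lemma coef_diff_even i f S k :
  coef (d_ (lshift s i) f) (S, k) =
  if i \in S then 0 else (-1) ^+ below S i * coef f (i |: S, k).
Proof. by rewrite /fdiff (unsplitK (inl i)) coef_fdiff_even. Qed.

Lemma fdiff_oddE kappa f : d_ (rshift r kappa) f = fdiff_odd kappa f.
Proof. by rewrite /fdiff (unsplitK (inr kappa)). Qed.

Lemma coef_diff_odd kappa f S k :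
  coef (d_ (rshift r kappa) f) (S, k) =
  if (0 < k kappa)%N then coef f (S, decr k kappa) else 0.
Proof. by rewrite fdiff_oddE coef_fdiff_odd. Qed.

(** Left multiplication by a coefficient is not linear over R, since R need not be
commutative, but all the operators commute with the scalars in the center of R;
these include the even elements and the signs. *)
Definition central_linear (P : M -> M) :=
  forall c f g, central c -> P (c *: f + g) = c *: P f + P g.

Lemma mul_coef_linear p a : central_linear (c_ p a).
Proof.
move=> c f g cc; apply: coef_inj => u.
rewrite fcoefD fcoefZ !coef_mul_coef fcoefD fcoefZ.
by rewrite mulrDr (centralCA a _ cc) mulrDr (centralCA _ _ cc).
Qed.

Lemma mul_dt_linear F : central_linear (e_ F).
Proof.
move=> c f g cc; apply: coef_inj => -[S k]; rewrite fcoefD fcoefZ.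
have [i ->|kappa ->] := split_ordP F.
  rewrite !coef_mul_dt_even; case: ifP => _; last by rewrite mulr0 addr0.
  by rewrite fcoefD fcoefZ mulrDr (centralCA _ _ cc).
by rewrite !coef_mul_dt_odd fcoefD fcoefZ mulrDr opprD mulrN (centralCA _ _ cc).
Qed.

Lemma diff_linear G : central_linear (d_ G).
Proof.
move=> c f g cc; apply: coef_inj => -[S k]; rewrite fcoefD fcoefZ.
have [i ->|kappa ->] := split_ordP G.
  rewrite  !coef_diff_even.
  case: ifP => _; first by rewrite mulr0 addr0.
  by rewrite fcoefD fcoefZ mulrDr (centralCA _ _ cc).
rewrite  !coef_diff_odd; case: ifP => _; last by rewrite mulr0 addr0.
by rewrite fcoefD fcoefZ.
Qed.

Section CentralLinear.

Variables (P : M -> M) (lP : central_linear P).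

Lemma clD f g : P (f + g) = P f + P g.
Proof. by have := lP f g central1; rewrite !scale1r. Qed.

Lemma cl0 : P 0 = 0.
Proof. by apply: (addrI (P 0)); rewrite -clD !addr0. Qed.

Lemma clZ c f : central c -> P (c *: f) = c *: P f.
Proof. by move=> cc; have := lP f 0 cc; rewrite !addr0 cl0 addr0. Qed.

Lemma clN f : P (- f) = - P f.
Proof.
by rewrite -scaleN1r clZ ?scaleN1r //; apply: centralN; apply: central1.
Qed.

Lemma clB f g : P (f - g) = P f - P g.
Proof. by rewrite clD clN. Qed.

Lemma cl_sum (I : Type) (l : seq I) (Q : pred I) (F : I -> M) :
  P (\sum_(i <- l | Q i) F i) = \sum_(i <- l | Q i) P (F i).
Proof. by elim/big_rec2: _ => [|i g h _ <-]; rewrite ?cl0 ?clD. Qed.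

End CentralLinear.

Lemma central_linear_comp P Q :
  central_linear P -> central_linear Q -> central_linear (fun f => P (Q f)).
Proof. by move=> lP lQ c f g cc; rewrite lQ // lP. Qed.

Lemma central_linear_iter n P : central_linear P -> central_linear (iter n P).
Proof. by move=> lP; elim: n => [//|n IHn] c f g cc /=; rewrite IHn // lP. Qed.

Lemma central_linear_sum (I : Type) (l : seq I) (P : I -> M -> M) :
  (forall i, central_linear (P i)) ->
  central_linear (fun f => \sum_(i <- l) P i f).
Proof.
move=> lP c f g cc; rewrite scaler_sumr -big_split /=.
by apply: eq_bigr => i _; rewrite lP.
Qed.

Lemma central_linear_scale c P : central c -> central_linear P ->
  central_linear (fun f => c *: P f).
Proof.
move=> cc lP a f g ca; rewrite lP // scalerDr !scalerA; congr (_ *: _ + _).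
exact: cc.
Qed.

(** P, of parity p, and Q, of parity q, supercommute. *)
Definition scomm (p q : bool) (P Q : M -> M) :=
  forall f, P (Q f) = (-1) ^+ (p && q) *: Q (P f).

Lemma scomm_sym p q P Q : scomm p q P Q -> scomm q p Q P.
Proof. by move=> PQ f; rewrite PQ scalerA andbC -signr_addb addbb scale1r. Qed.

Lemma scomm_compr p q q' P Q Q' : central_linear Q ->
  scomm p q P Q -> scomm p q' P Q' ->
  scomm p (q (+) q') P (fun f => Q (Q' f)).
Proof.
move=> lQ PQ PQ' f; rewrite PQ PQ' (clZ lQ); last exact: central_sign.
by rewrite scalerA -signr_addb -andb_addr.
Qed.

Lemma scomm_sumr p q P (I : Type) (l : seq I) (Q : I -> M -> M) : central_linear P ->
  (forall i, scomm p q P (Q i)) -> scomm p q P (fun f => \sum_(i <- l) Q i f).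
Proof.
move=> lP PQ f; rewrite (cl_sum lP) scaler_sumr.
by apply: eq_bigr => i _; rewrite PQ.
Qed.

Lemma scomm_compl p p' q P P' Q : central_linear P ->
  scomm p q P Q -> scomm p' q P' Q ->
  scomm (p (+) p') q (fun f => P (P' f)) Q.
Proof.
by move=> lP PQ PQ'; apply: scomm_sym; apply: scomm_compr => //; apply: scomm_sym.
Qed.

Lemma scomm_suml p q (I : Type) (l : seq I) (P : I -> M -> M) Q : central_linear Q ->
  (forall i, scomm p q (P i) Q) -> scomm p q (fun f => \sum_(i <- l) P i f) Q.
Proof. by move=> lQ PQ; apply: scomm_sym; apply: scomm_sumr => // i; apply: scomm_sym. Qed.

Lemma scomm_mul_dt F G : scomm (~~ parity F) (~~ parity G) (e_ F) (e_ G).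
Proof.
move=> f; apply: coef_inj => -[S k]; rewrite fcoefZ.
have [i ->|kappa ->] := split_ordP F; have [j ->|lambda ->] := split_ordP G;
  rewrite ?parity_lshift ?parity_rshift /= ?mul1r.
- rewrite expr1 mulN1r !coef_mul_dt_even.
  have [<-|ij] := eqVneq i j.
    by rewrite !inE eqxx /= mulr0; case: ifP => _; rewrite ?oppr0.
  rewrite !inE (eq_sym j i) ij /=.
  case iS: (i \in S); case jS: (j \in S); rewrite ?mulr0 ?oppr0 //.
  have -> : S :\ j :\ i = S :\ i :\ j by rewrite !setDDl setUC.
  rewrite (@below_setD1 _ (S :\ i) i j) ?inE ?jS 1?eq_sym ?ij //.
  rewrite (@below_setD1 _ (S :\ j) j i) ?inE ?iS ?ij //.
  have -> : S :\ j :\ i = S :\ i :\ j by rewrite !setDDl setUC.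
  rewrite !mulrA -!exprD -mulNr -[- (_ ^+ _)]mulN1r -exprS; congr (_ * _).
  rewrite -signr_odd -[RHS]signr_odd; congr (_ ^+ _); rewrite /= !oddD.
  case: (ltngtP i j) ij => [_|_|/val_inj ->]; rewrite ?eqxx //= ?addbN ?addNb;
    by rewrite ?negbK addbC.
- rewrite !(coef_mul_dt_even, coef_mul_dt_odd).
  by case: ifP; rewrite ?mulr0 ?oppr0 // mulrN (centralCA _ _ (central_nat _)).
- rewrite !(coef_mul_dt_even, coef_mul_dt_odd).
  by case: ifP; rewrite ?mulr0 ?oppr0 // mulrN (centralCA _ _ (central_nat _)).
- rewrite !coef_mul_dt_odd !mulrN !opprK incrC !mulrA; congr (_ * _).
  rewrite !incrE (eq_sym lambda); case: eqVneq => [->|_]; rewrite ?addn0 //.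
  exact: central_nat.
Qed.

Lemma scomm_mul_dt_coef F p a : scomm (~~ parity F) p (e_ F) (c_ p a).
Proof.
move=> f; apply: coef_inj => -[S k]; rewrite fcoefZ coef_mul_coef.
have [i ->|kappa ->] := split_ordP F; rewrite ?parity_lshift ?parity_rshift /=.
  rewrite !coef_mul_dt_even; case: ifP => iS; last by rewrite !mulr0.
  rewrite coef_mul_coef dtparity_setD1 // (centralCA a _ (central_sign _)).
  rewrite [RHS]mulrA (centralCA _ (a * _) (central_sign (below _ i))).
  congr (_ * _); rewrite -signr_addb; congr (_ ^+ _ * _).
  by case: p; case: dtparity.
rewrite expr0 mul1r !coef_mul_dt_odd coef_mul_coef !mulrN.
by rewrite (centralCA a _ (central_nat _)) (centralCA _ (a * _) (central_nat _)).
Qed.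

Lemma mul_coefM p q a b f :
  c_ p a (c_ q b f) = c_ (p (+) q) (a * b) f.
Proof.
apply: coef_inj => u; rewrite !coef_mul_coef andb_addl signr_addb.
by rewrite (centralCA a _ (central_sign _)) !mulrA.
Qed.

Lemma mul_coefDl p a b f : c_ p (a + b) f = c_ p a f + c_ p b f.
Proof. by apply: coef_inj => u; rewrite fcoefD !coef_mul_coef mulrDl mulrDr. Qed.

Lemma mul_coef0 p f : c_ p 0 f = 0.
Proof. by apply: coef_inj => u; rewrite fcoef0 coef_mul_coef mul0r mulr0. Qed.

Lemma mul_coef_sum p (I : Type) (l : seq I) (F : I -> R) f :
  c_ p (\sum_(i <- l) F i) f = \sum_(i <- l) c_ p (F i) f.
Proof. by elim/big_rec2: _ => [|i g h _ <-]; rewrite ?mul_coef0 ?mul_coefDl. Qed.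

Lemma mul_coefZ p c a f : central c -> c_ p (c * a) f = c *: c_ p a f.
Proof.
move=> cc; apply: coef_inj => u; rewrite fcoefZ !coef_mul_coef.
by rewrite -mulrA (centralCA _ _ cc).
Qed.

Lemma mul_coef_evenE a f : c_ false a f = a *: f.
Proof. by apply: coef_inj => u; rewrite coef_mul_coef mul1r fcoefZ. Qed.

Lemma scomm_mul_coef p q a b : homog p a -> homog q b ->
  scomm p q (c_ p a) (c_ q b).
Proof.
move=> ha hb f; rewrite !mul_coefM (supercommutative ha hb).
by rewrite (mul_coefZ _ _ _ (central_sign _)) [q (+) p]addbC.
Qed.

(** The canonical commutation relations. In the even case they encode
t delta^(k)(t) = - k delta^(k-1)(t). *)
Lemma diff_mul_dt F G f :
  d_ G (e_ F f) = (-1) ^+ (~~ parity G && ~~ parity F) *: e_ F (d_ G f) +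
                  (if F == G then f else 0).
Proof.
apply: coef_inj => -[S k]; rewrite fcoefD fcoefZ.
have [i ->|kappa ->] := split_ordP G; have [j ->|lambda ->] := split_ordP F;
  rewrite ?parity_lshift ?parity_rshift /= ?mul1r ?eq_shift ?fcoef0 ?addr0.
- rewrite expr1 mulN1r coef_diff_even !coef_mul_dt_even coef_diff_even.
  have [<-|ij] := eqVneq j i.
    rewrite !inE eqxx /=; case: ifP => jS.
      by rewrite setD1K // mulrA -expr2 sqrr_sign mul1r addNr.
    by rewrite setU1K ?jS // mulrA -expr2 sqrr_sign mul1r oppr0 add0r.
  rewrite fcoef0 addr0 !inE (eq_sym i) (negPf ij) /=.
  case iS: (i \in S); case jS: (j \in S); rewrite ?mulr0 ?oppr0 //.
  have SE : (i |: S) :\ j = i |: (S :\ j).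
    apply/setP => l; rewrite !inE; case: (eqVneq l i) => [->|] //=.
    by rewrite eq_sym ij.
  rewrite SE below_setU1 ?inE ?iS ?andbF // (below_setD1 i jS) !exprD.
  rewrite -!exprD !mulrA -!exprD -mulNr -[- (_ ^+ _)]mulN1r -exprS; congr (_ * _).
  rewrite -signr_odd -[RHS]signr_odd; congr (_ ^+ _); rewrite /= !oddD.
  case: (ltngtP i j) ij => [_|_|/val_inj ->]; rewrite ?eqxx //= ?addbN ?addNb;
    by rewrite ?negbK addbC.
- rewrite coef_diff_even !coef_mul_dt_odd coef_diff_even.
  by case: ifP; rewrite ?mulr0 ?oppr0 // mulrN (centralCA _ _ (central_nat _)).
- rewrite coef_diff_odd !coef_mul_dt_even coef_diff_odd.
  by case: ifP; case: ifP; rewrite ?mulr0.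
- rewrite coef_diff_odd !coef_mul_dt_odd coef_diff_odd incrE.
  have [<-|ij] := eqVneq lambda kappa.
    rewrite addn1 /= incrK; case: (posnP (k lambda)) => k0.
      by rewrite k0 mul1r addNr.
    rewrite decrE eqxx subn1 prednK // decrK //.
    by rewrite -natr1 mulrDl mul1r opprD subrK.
  rewrite fcoef0 addr0 addn0; case: ifP => k0; last by rewrite mulr0 oppr0.
  by rewrite decrE (negPf ij) subn0 decr_incr.
Qed.

Lemma scomm_diff_coef G p a : scomm (~~ parity G) p (d_ G) (c_ p a).
Proof.
move=> f; apply: coef_inj => -[S k]; rewrite fcoefZ coef_mul_coef.
have [i ->|kappa ->] := split_ordP G; rewrite ?parity_lshift ?parity_rshift /=.
  rewrite !coef_diff_even; case: ifP => iS; first by rewrite !mulr0.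
  rewrite coef_mul_coef -(setU1K (negbT iS)) (dtparity_setD1 _ (setU11 i S)).
  rewrite setU1K ?iS // (centralCA a _ (central_sign _)).
  rewrite [RHS]mulrA (centralCA _ (a * _) (central_sign (below _ i))).
  congr (_ * _); rewrite -signr_addb; congr (_ ^+ _ * _).
  by case: p; case: dtparity.
rewrite expr0 mul1r !coef_diff_odd coef_mul_coef.
by case: ifP; rewrite ?mulr0.
Qed.

End Operators.

(** * Superalgebras and matrices with even entries *)

(** Row i is the only one that changes, so its cofactors do not. *)
Lemma det_add_delta (A : comNzRingType) p (X : 'M[A]_p) i j (a : A) :
  \det (X + a *: delta_mx i j) = \det X + a * (\adj X) j i.
Proof.
rewrite (expand_det_row _ i) (expand_det_row X i) mxE.
have cof k : cofactor (X + a *: delta_mx i j) i k = cofactor X i k.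
  congr (_ * \det _); apply/matrixP => h l; rewrite !mxE.
  by rewrite eq_sym (negPf (neq_lift _ _)) mulr0 addr0.
under eq_bigr => k _ do rewrite cof !mxE eqxx mulrDl.
rewrite big_split /=; congr (_ + _).
rewrite (bigD1 j) //= eqxx mulr1 big1 ?addr0 // => k /negPf ->.
by rewrite mulr0 mul0r.
Qed.

Section Superalgebra.

Variables (K : fieldType) (R : superalgebra K).
Implicit Types (x y c : R) (b : bool).

Lemma homogD b x y : homog b x -> homog b y -> homog b (x + y).
Proof. by move=> hx hy; rewrite -(scale1r x); apply: homog_linear. Qed.

Lemma homogZ b (c : K) x : homog b x -> homog b (c *: x).
Proof. by move=> hx; rewrite -(addr0 (c *: x)); apply: homog_linear (homog0 _ _). Qed.

Lemma homogN b x : homog b x -> homog b (- x).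
Proof. by move=> hx; rewrite -scaleN1r; apply: homogZ. Qed.

Lemma homogB b x y : homog b x -> homog b y -> homog b (x - y).
Proof. by move=> hx hy; apply/homogD/homogN. Qed.

Lemma homog_sum b (I : Type) (l : seq I) (P : pred I) (F : I -> R) :
  (forall i, homog b (F i)) -> homog b (\sum_(i <- l | P i) F i).
Proof.
by move=> hF; elim/big_ind: _ => // [|x y]; [apply: homog0 | apply: homogD].
Qed.

Lemma homogM_even b x y : homog b x -> homog b y -> homog false (x * y).
Proof. by move=> hx hy; have := homogM hx hy; rewrite addbb. Qed.

Lemma even_central c : homog false c -> central c.
Proof.
move=> hc y; have [y0 [y1 [h0 h1 ->]]] := homog_decomp y.
rewrite /GRing.comm mulrDl mulrDr.
by rewrite (supercommutative hc h0) (supercommutative hc h1) !mul1r.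
Qed.

(** The odd part y of the inverse of c has c y both odd and even. *)
Lemma homogV c : homog false c -> c \is a GRing.unit -> homog false c^-1.
Proof.
move=> hc uc; have [y0 [y1 [h0 h1 cE]]] := homog_decomp c^-1.
suff y10 : y1 = 0 by rewrite cE y10 addr0.
apply: (mulrI uc); rewrite mulr0; apply: homog_disj; last first.
  by have := homogM hc h1; rewrite addFb.
rewrite (_ : c * y1 = 1 - c * y0); last first.
  by rewrite -(mulrV uc) cE mulrDr addrAC subrr add0r.
exact: homogB (homog1 R) (homogM_even hc h0).
Qed.

Lemma odd_sqr (charK0 : [pchar K] =i pred0) x : homog true x -> x * x = 0.
Proof.
move=> hx; have /eqP := supercommutative hx hx; rewrite expr1 mulN1r.
rewrite -subr_eq0 opprK -mulr2n -scaler_nat scaler_eq0.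
have /negPf -> : 2%:R != 0 :> K by move: (charK0 2); rewrite !inE /= => /negbT.
by move/eqP.
Qed.

Definition even_pred : {pred R} := fun x => boolp.asbool (homog false x).

Lemma even_predP x : reflect (homog false x) (x \in even_pred).
Proof. exact: boolp.asboolP. Qed.

Lemma even_divring_closed : divring_closed even_pred.
Proof.
split=> [|x y /even_predP hx /even_predP hy|x y /even_predP hx /even_predP hy].
- by apply/even_predP/homog1.
- by apply/even_predP/homogB.
have [uy|/invr_out ->] := boolP (y \is a GRing.unit); apply/even_predP.
  exact: homogM_even hx (homogV hy uy).
exact: homogM_even hx hy.
Qed.

HB.instance Definition _ := GRing.isDivringClosed.Build R even_pred even_divring_closed.

(** The even elements form a commutative ring. Determinants of matrices with even
entries are studied there and carried over along the inclusion. *)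
Record even_part := EvenPart { even_val :> R; even_valP : even_val \in even_pred }.
HB.instance Definition _ := [isSub for even_val].
HB.instance Definition _ := [Choice of even_part by <:].
HB.instance Definition _ := [SubChoice_isSubUnitRing of even_part by <:].
Lemma even_part_mulC : @commutative even_part even_part *%R.
Proof. 
move=> x y; apply: val_inj; rewrite !rmorphM /=.
by apply: even_central; apply/even_predP/even_valP.
Qed.
HB.instance Definition _ := GRing.PzRing_hasCommutativeMul.Build even_part even_part_mulC.

Section EvenMatrices.

Variable p : nat.
Implicit Types X Y Q : 'M[R]_p.

Definition even_mx X := forall i j, homog false (X i j).

Local Notation lift := (map_mx (val : even_part -> R)).

Lemma even_mxP X : even_mx X -> exists X0 : 'M[even_part]_p, X = lift X0.
Proof.
move=> hX; exists (\matrix_(i, j) EvenPart (introT (even_predP _) (hX i j))).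
by apply/matrixP => i j; rewrite !mxE.
Qed.

Lemma even_mx_lift (X0 : 'M[even_part]_p) : even_mx (lift X0).
Proof. by move=> i j; rewrite mxE; apply/even_predP/even_valP. Qed.

Lemma inv_evenmx_lift (X0 : 'M[even_part]_p) :
  inv_evenmx (lift X0) = lift ((\det X0)^-1 *: \adj X0).
Proof.
rewrite /inv_evenmx det_map_mx -map_mx_adj map_mxZ /=; congr (_ *: _).
Qed.

Lemma even_det X : even_mx X -> homog false (\det X).
Proof.
case/even_mxP => X0 ->; rewrite det_map_mx; apply/even_predP; exact: even_valP.
Qed.

Lemma even_detM X Y : even_mx X -> even_mx Y -> \det (X *m Y) = \det X * \det Y.
Proof.
case/even_mxP => X0 -> /even_mxP[Y0 ->].
by rewrite -map_mxM !det_map_mx det_mulmx rmorphM.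
Qed.

Lemma even_inv X : even_mx X -> even_mx (inv_evenmx X).
Proof. case/even_mxP => X0 ->; rewrite inv_evenmx_lift; exact: even_mx_lift. Qed.

Lemma unit_lift (y : even_part) : (val y \is a GRing.unit) = (y \is a GRing.unit).
Proof. by []. Qed.

Lemma even_mulVmx X : even_mx X -> \det X \is a GRing.unit ->
  inv_evenmx X *m X = 1%:M.
Proof.
case/even_mxP => X0 ->; rewrite det_map_mx unit_lift => u.
by rewrite inv_evenmx_lift -map_mxM -scalemxAl mul_adj_mx scale_scalar_mx mulVr ?map_mx1.
Qed.

Lemma even_mulmxV X : even_mx X -> \det X \is a GRing.unit ->
  X *m inv_evenmx X = 1%:M.
Proof.
case/even_mxP => X0 ->; rewrite det_map_mx unit_lift => u.
by rewrite inv_evenmx_lift -map_mxM -scalemxAr mul_mx_adj scale_scalar_mx mulVr ?map_mx1.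
Qed.

Lemma even_unitmx X Y : even_mx X -> even_mx Y -> X *m Y = 1%:M ->
  \det X \is a GRing.unit.
Proof.
case/even_mxP => X0 -> /even_mxP[Y0 ->]; rewrite -map_mxM => XY.
rewrite det_map_mx unit_lift -unitmxE.
have /mulmx1_unit[] // : X0 *m Y0 = 1%:M.
apply/matrixP => i j; apply: val_inj.
have := congr1 (fun Z : 'M[R]_p => Z i j) XY; rewrite mxE => ->.
by rewrite !mxE; case: (i == j).
Qed.

Lemma even_mxM X Y : even_mx X -> even_mx Y -> even_mx (X *m Y).
Proof.
by move=> hX hY i j; rewrite mxE; apply: homog_sum => k; apply: homogM_even.
Qed.

Lemma even_mxD X Y : even_mx X -> even_mx Y -> even_mx (X + Y).
Proof. by move=> hX hY i j; rewrite mxE; apply: homogD. Qed.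

Lemma even_mx1 : even_mx 1%:M.
Proof. by move=> i j; rewrite mxE; case: eqP => _; [apply: homog1 | apply: homog0]. Qed.

(** X + Q = X (1 + N) with N = X^-1 Q of square zero, and 1 - N inverts 1 + N. *)
Lemma unit_add_sqr0 X Q : even_mx X -> even_mx Q ->
  (forall i j k l, Q i j * Q k l = 0) ->
  \det X \is a GRing.unit -> \det (X + Q) \is a GRing.unit.
Proof.
move=> hX hQ QQ uX; have hV := even_inv hX.
pose N := inv_evenmx X *m Q.
have hN : even_mx N by apply: even_mxM.
have NN : N *m N = 0.
  apply/matrixP => i j; rewrite !mxE big1 // => k _; rewrite !mxE mulr_suml.
  rewrite big1 // => l _; rewrite mulr_sumr big1 // => l' _.
  rewrite (even_central (hV k l') _) -mulrA (mulrA (Q l k)) QQ mul0r mulr0 //.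
have -> : X + Q = X *m (1%:M + N).
  by rewrite mulmxDr mulmx1 mulmxA even_mulmxV // mul1mx.
have h1N : even_mx (1%:M + N) by apply: even_mxD => //; apply: even_mx1.
rewrite even_detM // unitrMl //.
apply: (@even_unitmx _ (1%:M - N)) => //.
  by move=> i j; rewrite mxE [(- N) i j]mxE; apply/homogD/homogN/hN/even_mx1.
by rewrite mulmxBr mulmx1 mulmxDl mul1mx NN addr0 addrK.
Qed.

(** The first-order variation of a determinant, exact because a single entry
changes. *)
Lemma even_det_add_delta X i j (a : R) : even_mx X -> homog false a ->
  \det X \is a GRing.unit ->
  \det (X + a *: delta_mx i j) = \det X * (1 + a * inv_evenmx X j i).
Proof.
case/even_mxP => X0 -> /even_predP ha; rewrite det_map_mx unit_lift => u.
pose a0 := EvenPart ha.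
have -> : lift X0 + a *: delta_mx i j = lift (X0 + a0 *: delta_mx i j).
  by rewrite map_mxD map_mxZ map_delta_mx.
rewrite det_map_mx det_add_delta inv_evenmx_lift.
have -> : \det X0 + a0 * (\adj X0) j i =
    \det X0 * (1 + a0 * ((\det X0)^-1 * (\adj X0) j i)).
  by rewrite mulrDr mulr1 mulrCA (mulrA (\det X0)) mulrV // mul1r.
by rewrite rmorphM rmorphD rmorph1 rmorphM [in RHS]mxE [in RHS]mxE.
Qed.

End EvenMatrices.

End Superalgebra.

(** * Substituted delta-functions *)

Section Columns.

Variables (n m s : nat) (hs : (s <= m)%N).

Lemma parity_poly_col mu : @parity n m (@poly_col n m s mu) = true.
Proof. exact: parity_rshift. Qed.

Lemma parity_delta_col nu : @parity n m (delta_col n hs nu) = true.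
Proof. exact: parity_rshift. Qed.

Lemma sum_columns (V : nmodType) (F : 'I_(n + m) -> V) :
  \sum_A F A = \sum_a F (lshift m a) +
    (\sum_mu F (@poly_col n m s mu) + \sum_nu F (delta_col n hs nu)).
Proof.
rewrite big_split_ord; congr (_ + _).
rewrite (reindex (cast_ord (subnK hs))) /=; last first.
  by exists (cast_ord (esym (subnK hs))) => i _; rewrite ?cast_ordK ?cast_ordKV.
rewrite big_split_ord; congr (_ + _); apply: eq_bigr => mu _; congr F.
exact: val_inj.
Qed.

Lemma col_cases A :
  [\/ exists a, A = lshift m a, exists mu, A = @poly_col n m s mu
    | exists nu, A = delta_col n hs nu].
Proof.
have [a ->|b ->] := split_ordP A; first by constructor 1; exists a.
have [mu Eb|nu Eb] := split_ordP (cast_ord (esym (subnK hs)) b).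
  constructor 2; exists mu; congr rshift; apply: val_inj.
  by rewrite /= -[val mu]/(val (lshift s mu)) -Eb.
by constructor 3; exists nu; rewrite /delta_col -Eb cast_ordKV.
Qed.

End Columns.

Section Substitution.

Variables (K : fieldType) (charK0 : [pchar K] =i pred0).
Variables (R : superalgebra K) (r s : nat).
Variable M : formal_space R r s.
Implicit Types (f g h : M) (a b c : R).

Local Notation e_ := (@fmul_dt _ _ _ _ M).
Local Notation d_ := (@fdiff _ _ _ _ M).
Local Notation c_ := (@fmul_coef _ _ _ _ M).

Local Notation zexp := ([ffun=> 0%N] : {ffun 'I_s -> nat}).

Variables (n m : nat).
Implicit Types (x : 'M[R]_(r + s, n + m)).

(** Multiplication by dx^A = dt^F x_F^A. *)
Definition fmul_dx x (A : 'I_(n + m)) f : M :=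
  \sum_(F < r + s) e_ F (c_ (parity F (+) parity A) (x F A) f).

Lemma fmul_dx_linear x A : central_linear (fmul_dx x A).
Proof.
apply: central_linear_sum => F.
exact: central_linear_comp (@mul_dt_linear _ _ _ _ M F) (@mul_coef_linear _ _ _ _ M _ _).
Qed.

Lemma scomm_dt_dx x F A : scomm (~~ parity F) (~~ parity A) (e_ F) (fmul_dx x A).
Proof.
apply: scomm_sumr => [|G]; first exact: mul_dt_linear.
have -> : ~~ parity A = ~~ parity G (+) (parity G (+) parity A).
  by rewrite addbA addNb addbb.
by apply: scomm_compr; [exact: mul_dt_linear | exact: scomm_mul_dt | exact: scomm_mul_dt_coef].
Qed.

Lemma scomm_coef_dx x p a A : even_smx x -> homog p a ->
  scomm p (~~ parity A) (c_ p a) (fmul_dx x A).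
Proof.
move=> hx ha; apply: scomm_sumr => [|G]; first exact: mul_coef_linear.
have -> : ~~ parity A = ~~ parity G (+) (parity G (+) parity A).
  by rewrite addbA addNb addbb.
apply: scomm_compr; first exact: mul_dt_linear.
  exact/scomm_sym/scomm_mul_dt_coef.
exact: scomm_mul_coef.
Qed.

Lemma scomm_dt_coef_dx x F p a A : even_smx x -> homog p a ->
  scomm (~~ parity F (+) p) (~~ parity A) (fun f => e_ F (c_ p a f)) (fmul_dx x A).
Proof.
move=> hx ha; apply: scomm_compl; first exact: mul_dt_linear.
  exact: scomm_dt_dx.
exact: scomm_coef_dx.
Qed.

Lemma scomm_dx x A B : even_smx x ->
  scomm (~~ parity A) (~~ parity B) (fmul_dx x A) (fmul_dx x B).
Proof.
move=> hx; apply: scomm_suml => [|F]; first exact: fmul_dx_linear.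
have -> : ~~ parity A = ~~ parity F (+) (parity F (+) parity A).
  by rewrite addbA addNb addbb.
exact: scomm_dt_coef_dx.
Qed.

Lemma diff_dx x G A f :
  d_ G (fmul_dx x A f) =
  (-1) ^+ (~~ parity G && ~~ parity A) *: fmul_dx x A (d_ G f) +
  c_ (parity G (+) parity A) (x G A) f.
Proof.
rewrite (cl_sum (@diff_linear _ _ _ _ M G)) scaler_sumr (eq_bigr _ (fun F _ => diff_mul_dt F G _)).
rewrite big_split /=; congr (_ + _); last first.
  rewrite (bigD1 G) //= eqxx big1 ?addr0 // => F /negPf ->; by [].
apply: eq_bigr => F _; rewrite scomm_diff_coef (clZ (@mul_dt_linear _ _ _ _ M F)).
  rewrite scalerA -signr_addb -andb_addr; congr (_ ^+ (_ && _) *: _).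
  by rewrite addbA addNb addbb.
exact: central_sign.
Qed.

Variable hs : (s <= m)%N.
Local Notation D_ := (delta_col n hs).
Local Notation B_ x := (odd_block hs x).
Local Notation vanish0 f := (forall S, coef f (S, zexp) = 0).

(** The part of dxi^(m-s+nu) that comes from the odd dt^F. *)
Definition fmul_nilp x (nu : 'I_s) f : M :=
  \sum_(i < r) e_ (lshift s i) (c_ true (x (lshift s i) (D_ nu)) f).

Lemma fmul_dx_delta x nu f :
  fmul_dx x (D_ nu) f =
  fmul_nilp x nu f + \sum_kappa (B_ x kappa nu) *: e_ (rshift r kappa) f.
Proof.
rewrite /fmul_dx big_split_ord /=; congr (_ + _); apply: eq_bigr => i _.
  by rewrite parity_lshift parity_delta_col.
rewrite parity_rshift parity_delta_col mul_coef_evenE -mul_coef_evenE.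
by rewrite scomm_mul_dt_coef andbF scale1r mxE mul_coef_evenE.
Qed.

Lemma odd_block_even x : even_smx x -> even_mx (B_ x).
Proof.
by move=> hx kappa nu; rewrite mxE; have := hx (rshift r kappa) (D_ nu);
  rewrite parity_rshift parity_delta_col.
Qed.

Lemma coef_nilp x nu f S k : (forall S, coef f (S, k) = 0) ->
  coef (fmul_nilp x nu f) (S, k) = 0.
Proof.
move=> f0; rewrite fcoef_sum big1 // => i _.
by rewrite coef_mul_dt_even coef_mul_coef f0 !mulr0 if_same.
Qed.

Lemma natrS_reg q (y : R) : q.+1%:R * y = 0 -> y = 0.
Proof.
move/eqP; rewrite mulr_natl -scaler_nat scaler_eq0.
by rewrite (proj1 (pcharf0P K) charK0) => /eqP.
Qed.

(** Invertibility of the odd block isolates the single t_kappa from the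
combinations t_kappa x_kappa^nu. *)
Lemma odd_block_solve x (y z : 'I_s -> M) : even_smx x ->
  \det (B_ x) \is a GRing.unit ->
  (forall nu, \sum_kappa (B_ x kappa nu) *: y kappa = z nu) ->
  forall kappa, y kappa = \sum_nu inv_evenmx (B_ x) nu kappa *: z nu.
Proof.
move=> hx ux yz kappa; have hB := odd_block_even hx.
under eq_bigr => nu _ do rewrite -yz scaler_sumr.
rewrite exchange_big /= (bigD1 kappa) //=.
have E l : \sum_nu inv_evenmx (B_ x) nu kappa *: (B_ x l nu *: y l) =
    (l == kappa)%:R *: y l.
  under eq_bigr => nu _ do
    rewrite scalerA (even_central (even_inv hB nu kappa) (B_ x l nu)).
  rewrite -scaler_suml; congr (_ *: _).
  have := congr1 (fun Z : 'M[R]_s => Z l kappa) (even_mulmxV hB ux).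
  by rewrite mxE => ->; rewrite mxE.
rewrite E eqxx scale1r big1 ?addr0 // => l /negPf l_neq.
by rewrite E l_neq scale0r.
Qed.

(** From t delta^(k)(t) = - k delta^(k-1)(t), multiplication by t_kappa reads off
the coefficients one derivative higher. Here t_kappa f is a combination of the
N_nu f, and the N_nu preserve the order of the derivatives, so that vanishing
spreads from each order to the next one. *)
Lemma dx_delta_inj x f : even_smx x -> \det (B_ x) \is a GRing.unit ->
  (forall nu, fmul_dx x (D_ nu) f = 0) -> vanish0 f -> f = 0.
Proof.
move=> hx ux Xf f0; apply: coef_inj => -[S k]; rewrite fcoef0.
have ef kappa : e_ (rshift r kappa) f =
    \sum_nu inv_evenmx (B_ x) nu kappa *: (- fmul_nilp x nu f).
  apply: (odd_block_solve hx ux (y := fun kappa => e_ (rshift r kappa) f)) => nu.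
  by apply/eqP; rewrite -addr_eq0 addrC -fmul_dx_delta Xf.
elim/exponent_ind: k S => k IHk S.
have [/existsP[kappa k_gt0]|k0] := boolP [exists kappa, (0 < k kappa)%N]; last first.
  rewrite (_ : k = zexp) ?f0 //; apply/ffunP => l; rewrite ffunE.
  by apply/eqP; rewrite -leqn0 leqNgt; apply: contra k0 => ?; apply/existsP; exists l.
rewrite -(decrK k_gt0); apply: (@natrS_reg (decr k kappa kappa)).
apply: oppr_inj; rewrite -coef_mul_dt_odd ef fcoef_sum oppr0 big1 // => nu _.
rewrite fcoefZ fcoefN coef_nilp ?oppr0 ?mulr0 // => S'.
exact: IHk.
Qed.

(** The substituted delta^(j)(dxi^(m-s+1), ..., dxi^m) are used only through these
two properties, which determine them. The first one is
t delta^(k)(t) = - k delta^(k-1)(t) for each dxi^(m-s+nu); the second one fixes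
the coefficients at the monomials without derivatives of delta-functions, where
the determinant comes from delta(y_1) ... delta(y_s). *)
Definition delta_family x (v : {ffun 'I_s -> nat} -> M) :=
  (forall j mu, fmul_dx x (D_ mu) (v j) = - ((j mu)%:R *: v (decr j mu))) /\
  (forall j S, coef (v j) (S, zexp) =
     if (S == set0) && (j == zexp) then (\det (B_ x))^-1 else 0).

Lemma delta_family_unique x v w : even_smx x -> \det (B_ x) \is a GRing.unit ->
  delta_family x v -> delta_family x w -> v =1 w.
Proof.
move=> hx ux [Xv v0] [Xw w0]; elim/exponent_ind => j IHj.
apply/eqP; rewrite -subr_eq0; apply/eqP; apply: (dx_delta_inj hx ux) => [mu|S].
  rewrite (clB (@fmul_dx_linear x _)) Xv Xw.
  case: (posnP (j mu)) => [->|/IHj ->]; first by rewrite !scale0r subrr.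
  by rewrite subrr.
by rewrite fcoefD fcoefN v0 w0 subrr.
Qed.

(** The first property for j + e_nu, read off where no derivatives occur. *)
Lemma delta_family_incr x v j nu kappa S : even_smx x ->
  \det (B_ x) \is a GRing.unit -> delta_family x v ->
  coef (v (incr j nu)) (S, incr zexp kappa) =
  inv_evenmx (B_ x) nu kappa * coef (v j) (S, zexp).
Proof.
move=> hx ux [Xv v0]; set f := v (incr j nu).
have f0 T : coef f (T, zexp) = 0 by rewrite v0 (negPf (incr_neq0 _ _)) andbF.
have /(odd_block_solve hx ux) e_f : forall mu,
    \sum_lambda B_ x lambda mu *: e_ (rshift r lambda) f =
    fmul_dx x (D_ mu) f - fmul_nilp x mu f.
  by move=> mu; rewrite fmul_dx_delta addrC addKr.
have := congr1 (fun g => coef g (S, zexp)) (e_f kappa).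
rewrite coef_mul_dt_odd ffunE mul1r fcoef_sum => /(canRL opprK) ->.
rewrite (bigD1 nu) //= big1 => [|mu mu_nu]; rewrite fcoefZ fcoefD fcoefN coef_nilp // Xv subr0.
  rewrite addr0 fcoefN fcoefZ incrE eqxx addn1 incrK mulrN opprK; congr (_ * _).
  rewrite v0; have [->|_] := eqVneq j zexp; first by rewrite ffunE mul1r.
  by rewrite andbF mulr0.
rewrite fcoefN fcoefZ v0 decr_incr_neq // (negPf (incr_neq0 _ _)) andbF.
by rewrite mulr0 oppr0 mulr0.
Qed.

End Substitution.

(** * The Taylor expansion of the delta-functions *)

Section Taylor.

Variables (K : fieldType) (charK0 : [pchar K] =i pred0).
Variables (R : superalgebra K) (r s : nat).
Variable M : formal_space R r s.
Implicit Types (f g h : M) (a b c : R).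

Local Notation e_ := (@fmul_dt _ _ _ _ M).
Local Notation d_ := (@fdiff _ _ _ _ M).
Local Notation c_ := (@fmul_coef _ _ _ _ M).
Local Notation zexp := ([ffun=> 0%N] : {ffun 'I_s -> nat}).

Variables (n m : nat) (hs : (s <= m)%N) (x : 'M[R]_(r + s, n + m)).

Local Notation D_ := (delta_col n hs).
Local Notation B_ := (odd_block hs x).
Local Notation X_ nu := (fmul_dx (M := M) x (D_ nu)).
Local Notation N_ nu := (fmul_nilp (M := M) hs x nu).

Definition fdiff_y (nu : 'I_s) f : M :=
  \sum_(kappa < s) inv_evenmx B_ nu kappa *: fdiff_odd kappa f.

Definition ftaylor (nu : 'I_s) f : M :=
  \sum_(l < r.+1)
    ((l`!)%:R^-1 : K)%:A *: iter l (N_ nu) (iter l (fdiff_y nu) f).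

Definition fdelta_y : M := (\det B_)^-1 *: fmon M (set0, zexp).

Definition fsubst_delta (j : {ffun 'I_s -> nat}) : M :=
  foldr (fun nu f => ftaylor nu (iter (j nu) (fdiff_y nu) f))
    fdelta_y (enum 'I_s).

Hypotheses (hx : even_smx x) (ux : \det B_ \is a GRing.unit).

Let hB : even_mx B_ := odd_block_even hs hx.

Definition fmul_y (nu : 'I_s) f : M :=
  \sum_kappa B_ kappa nu *: e_ (rshift r kappa) f.

Lemma fmul_dx_deltaE nu f : X_ nu f = N_ nu f + fmul_y nu f.
Proof. exact: fmul_dx_delta. Qed.

Lemma fmul_y_linear nu : central_linear (fmul_y nu).
Proof.
apply: central_linear_sum => kappa; apply: central_linear_scale.
  exact: even_central.
exact: mul_dt_linear.
Qed.

Lemma fmul_nilp_linear nu : central_linear (N_ nu).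
Proof.
apply: central_linear_sum => i.
exact: central_linear_comp (@mul_dt_linear _ _ _ _ M _) (@mul_coef_linear _ _ _ _ M _ _).
Qed.

Lemma fdiff_y_linear nu : central_linear (fdiff_y nu).
Proof.
apply: central_linear_sum => kappa; apply: central_linear_scale.
  exact/even_central/even_inv.
by move=> c f g cc; rewrite -!fdiff_oddE; apply: diff_linear.
Qed.

Lemma scomm_even_scale (p : bool) P (y : R) Q : central y -> central_linear P ->
  scomm p false P Q -> scomm p false P (fun f : M => y *: Q f).
Proof.
move=> cy lP PQ f; rewrite (clZ lP) // PQ !scalerA; congr (_ *: _).
exact/esym/central_sign.
Qed.

Lemma nilp_comm nu mu f : N_ nu (N_ mu f) = N_ mu (N_ nu f).
Proof.
suff: scomm false false (N_ nu) (N_ mu) by move/(_ f); rewrite scale1r.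
have odd_entry i A : parity A = true -> homog true (x (lshift s i) A).
  by move=> pA; have := hx (lshift s i) A; rewrite parity_lshift pA.
apply: scomm_suml => [|i]; first exact: fmul_nilp_linear.
apply: scomm_sumr => [|j].
  exact: central_linear_comp (@mul_dt_linear _ _ _ _ M _) (@mul_coef_linear _ _ _ _ M _ _).
have := parity_lshift s i; have := parity_lshift s j => pj pi.
rewrite -[X in scomm X](addbb true); apply: scomm_compl.
- exact: mul_dt_linear.
- rewrite -[X in scomm _ X](addbb true); apply: scomm_compr; first exact: mul_dt_linear.
    by have := @scomm_mul_dt _ _ _ _ M (lshift s i) (lshift s j); rewrite pi pj.
  by have := @scomm_mul_dt_coef _ _ _ _ M (lshift s i) true (x (lshift s j) (D_ mu)); rewrite pi.
- rewrite -[X in scomm _ X](addbb true); apply: scomm_compr; first exact: mul_dt_linear.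
    apply: scomm_sym.
    by have := @scomm_mul_dt_coef _ _ _ _ M (lshift s j) true (x (lshift s i) (D_ nu)); rewrite pj.
  by apply: scomm_mul_coef; apply: odd_entry; apply: parity_delta_col.
Qed.

Lemma nilp_mul_y nu mu f : N_ nu (fmul_y mu f) = fmul_y mu (N_ nu f).
Proof.
suff: scomm false false (N_ nu) (fmul_y mu) by move/(_ f); rewrite scale1r.
apply: scomm_suml => [|i]; first exact: fmul_y_linear.
have linP := central_linear_comp (@mul_dt_linear _ _ _ _ M (lshift s i))
  (@mul_coef_linear _ _ _ _ M true (x (lshift s i) (D_ nu))).
apply: scomm_sumr => [//|kappa].
apply: scomm_even_scale => //; first exact: even_central.
have pi := parity_lshift s i; have pk := parity_rshift r kappa.
rewrite -[X in scomm X](addbb true); apply: scomm_compl.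
- exact: mul_dt_linear.
- by have := @scomm_mul_dt _ _ _ _ M (lshift s i) (rshift r kappa); rewrite pi pk.
- apply: scomm_sym.
  by have := @scomm_mul_dt_coef _ _ _ _ M (rshift r kappa) true (x (lshift s i) (D_ nu)); rewrite pk.
Qed.

Lemma nilp_diff_y nu mu f : N_ nu (fdiff_y mu f) = fdiff_y mu (N_ nu f).
Proof.
rewrite /fdiff_y (cl_sum (fmul_nilp_linear nu)); apply: eq_bigr => kappa _.
rewrite (clZ (fmul_nilp_linear nu)); last exact/even_central/even_inv.
congr (_ *: _); rewrite -!fdiff_oddE.
rewrite (cl_sum (@diff_linear _ _ _ _ M _)); apply: eq_bigr => i _.
rewrite diff_mul_dt eq_shift addr0 scomm_diff_coef parity_rshift /= !scale1r.
by [].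
Qed.

Lemma diff_mul_y nu mu f :
  fdiff_y nu (fmul_y mu f) = fmul_y mu (fdiff_y nu f) + (nu == mu)%:R *: f.
Proof.
rewrite /fdiff_y {1}/fmul_y.
have Ek kappa : fdiff_odd kappa (\sum_l B_ l mu *: e_ (rshift r l) f) =
    fmul_y mu (fdiff_odd kappa f) + B_ kappa mu *: f.
  rewrite -!fdiff_oddE (cl_sum (@diff_linear _ _ _ _ M _)).
  rewrite (eq_bigr (fun l => B_ l mu *: e_ (rshift r l) (d_ (rshift r kappa) f) +
      B_ l mu *: (if l == kappa then f else 0))); last first.
    move=> l _; rewrite (clZ (@diff_linear _ _ _ _ M _)); last exact: even_central.
    by rewrite diff_mul_dt !parity_rshift scale1r eq_shift scalerDr.
  rewrite big_split /=; congr (_ + _).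
  rewrite (bigD1 kappa) //= eqxx big1 ?addr0 // => l /negPf ->.
  by rewrite scaler0.
rewrite (eq_bigr (fun kappa => inv_evenmx B_ nu kappa *: fmul_y mu (fdiff_odd kappa f) +
   (inv_evenmx B_ nu kappa * B_ kappa mu) *: f)); last first.
  by move=> kappa _; rewrite Ek scalerDr scalerA.
rewrite big_split /=; congr (_ + _).
  rewrite (cl_sum (fmul_y_linear mu)); apply: eq_bigr => kappa _.
  by rewrite (clZ (fmul_y_linear mu)) //; apply/even_central/even_inv.
rewrite -scaler_suml; congr (_ *: _).
have := congr1 (fun Z : 'M[R]_s => Z nu mu) (even_mulVmx hB ux).
by rewrite mxE => ->; rewrite mxE.
Qed.

Lemma ftaylor_linear nu : central_linear (ftaylor nu).
Proof.
apply: central_linear_sum => l; apply: central_linear_scale; first exact: central_alg.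
apply: central_linear_comp; apply: central_linear_iter; [exact: fmul_nilp_linear|].
exact: fdiff_y_linear.
Qed.

Lemma iter_commute (P Q : M -> M) l : (forall f, P (Q f) = Q (P f)) ->
  forall f, P (iter l Q f) = iter l Q (P f).
Proof. by move=> PQ; elim: l => //= l IHl f; rewrite PQ IHl. Qed.

Lemma ftaylor_commute (P : M -> M) nu : central_linear P ->
  (forall f, P (N_ nu f) = N_ nu (P f)) ->
  (forall f, P (fdiff_y nu f) = fdiff_y nu (P f)) ->
  forall f, P (ftaylor nu f) = ftaylor nu (P f).
Proof.
move=> lP PN PD f; rewrite /ftaylor (cl_sum lP); apply: eq_bigr => l _.
rewrite (clZ lP); last exact: central_alg.
by rewrite (iter_commute _ PN) (iter_commute _ PD).
Qed.

(** The commutation relation of y_nu with the derivative along y_nu, iterated. *)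
Lemma mul_y_iter_diff nu l f :
  fmul_y nu (iter l (fdiff_y nu) f) =
  iter l (fdiff_y nu) (fmul_y nu f) - l%:R *: iter l.-1 (fdiff_y nu) f.
Proof.
elim: l => [|l IHl] /=; first by rewrite scale0r subr0.
have -> : fmul_y nu (fdiff_y nu (iter l (fdiff_y nu) f)) =
    fdiff_y nu (fmul_y nu (iter l (fdiff_y nu) f)) - iter l (fdiff_y nu) f.
  by rewrite diff_mul_y eqxx scale1r addrK.
rewrite IHl (clB (fdiff_y_linear nu)) -addrA -opprD; congr (_ - _).
have -> : fdiff_y nu (l%:R *: iter l.-1 (fdiff_y nu) f) =
    l%:R *: iter l (fdiff_y nu) f.
  rewrite (clZ (fdiff_y_linear nu)); last exact: central_nat.
  by case: l {IHl} => [|l]; rewrite ?scale0r.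
by rewrite -[X in _ + X]scale1r -scalerDl natr1.
Qed.

(** Each N_nu raises the number of odd dt^F, of which there are r. *)
Lemma nilp_vanish nu f : iter r.+1 (N_ nu) f = 0.
Proof.
apply: coef_inj => -[S k]; rewrite fcoef0.
suff low l : forall (T : {set 'I_r}) k', (#|T| < l)%N -> coef (iter l (N_ nu) f) (T, k') = 0.
  by apply: low; rewrite ltnS -[X in (_ <= X)%N](card_ord r) max_card.
elim: l => // l IHl T k'; rewrite ltnS => le_T.
rewrite fcoef_sum big1 // => i _; rewrite coef_mul_dt_even; case: ifP => // iT.
rewrite coef_mul_coef IHl ?mulr0 //.
by rewrite (cardsD1 i T) iT in le_T.
Qed.

(** The Taylor operator is exp(N D) with D the derivative along y, so it conjugates
y into y + N = dxi. In the truncated series the two correction sums cancel term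
by term, and the one term that is left over contains N^(r+1) = 0. *)
Lemma mul_dx_taylor nu f : X_ nu (ftaylor nu f) = ftaylor nu (fmul_y nu f).
Proof.
pose a l : R := ((l`!)%:R^-1 : K)%:A.
pose N := N_ nu; pose D := fdiff_y nu.
have ca l : central (a l) by apply: central_alg.
have aS l : l.+1%:R * a l.+1 = a l.
  rewrite /a mulr_natl -scaler_nat scalerA; congr (_ *: _).
  rewrite factS natrM invfM mulrA mulfV ?mul1r //.
  by rewrite (proj1 (pcharf0P K) charK0).
have Xl l : X_ nu (a l *: iter l N (iter l D f)) =
    a l *: iter l N (iter l D (fmul_y nu f)) +
    (a l *: iter l.+1 N (iter l D f) - (l%:R * a l) *: iter l N (iter l.-1 D f)).
  rewrite fmul_dx_deltaE (clZ (fmul_nilp_linear nu)) // (clZ (fmul_y_linear nu)) //.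
  rewrite addrC (iter_commute l (fun g => esym (nilp_mul_y nu nu g))).
  rewrite mul_y_iter_diff (clB (central_linear_iter _ (fmul_nilp_linear nu))).
  rewrite (clZ (central_linear_iter _ (fmul_nilp_linear nu))); last exact: central_nat.
  by rewrite scalerBr scalerA (ca l l%:R) -addrA [- _ + _]addrC addrA.
rewrite {1}/ftaylor (cl_sum (@fmul_dx_linear _ _ _ _ M _ _ x _)).
rewrite (eq_bigr _ (fun (l : 'I_r.+1) _ => Xl l)) big_split /= -[RHS]addr0; congr (_ + _).
rewrite sumrB big_ord_recr /= -/N -[N (iter _ _ _)]/(iter r.+1 N (iter r D f)) nilp_vanish.
rewrite scaler0 addr0 big_ord_recl /= mul0r scale0r add0r.
apply/eqP; rewrite subr_eq0; apply/eqP; apply: eq_bigr => l _.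
by rewrite /bump /= add1n aS.
Qed.

Lemma mul_y_delta_y nu : fmul_y nu fdelta_y = 0.
Proof.
rewrite /fmul_y big1 // => kappa _.
have cdet : central (\det B_)^-1 by apply/even_central/homogV => //; apply: even_det.
rewrite (clZ (@mul_dt_linear _ _ _ _ M _)) // (_ : e_ _ _ = 0) ?scaler0 //.
apply: coef_inj => -[S k]; rewrite coef_mul_dt_odd coef_mon fcoef0 xpair_eqE.
by rewrite (eq_sym zexp) (negPf (incr_neq0 _ _)) andbF mulr0 oppr0.
Qed.

Lemma mul_dx_diff_y nu mu f : nu != mu -> X_ mu (fdiff_y nu f) = fdiff_y nu (X_ mu f).
Proof.
move=> /negPf nu_mu; rewrite !fmul_dx_deltaE (clD (fdiff_y_linear nu)) nilp_diff_y.
by rewrite diff_mul_y nu_mu scale0r addr0.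
Qed.

Lemma mul_dx_nilp nu mu f : X_ mu (N_ nu f) = N_ nu (X_ mu f).
Proof.
by rewrite !fmul_dx_deltaE (clD (fmul_nilp_linear nu)) nilp_comm nilp_mul_y.
Qed.

Local Notation fold j := (foldr (fun nu f => ftaylor nu (iter (j nu) (fdiff_y nu) f))
    fdelta_y).

Lemma mul_y_fold mu (j : {ffun 'I_s -> nat}) l : mu \notin l -> fmul_y mu (fold j l) = 0.
Proof.
elim: l => [_|nu l IHl] /=; first exact: mul_y_delta_y.
rewrite inE negb_or eq_sym => /andP[nu_mu mu_l].
have yD f : fmul_y mu (fdiff_y nu f) = fdiff_y nu (fmul_y mu f).
  by rewrite diff_mul_y (negPf nu_mu) scale0r addr0.
rewrite (ftaylor_commute (fmul_y_linear mu)) //; last first.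
  by move=> f; rewrite nilp_mul_y.
rewrite (iter_commute _ yD) IHl // (cl0 (central_linear_iter _ (fdiff_y_linear nu))).
exact: cl0 (ftaylor_linear nu).
Qed.

Lemma fold_eq (j j' : {ffun 'I_s -> nat}) (l : seq 'I_s) :
  {in l, j =1 j'} -> fold j l = fold j' l.
Proof.
elim: l => //= nu l IHl jj'; rewrite IHl => [|mu mu_l].
  by rewrite jj' ?mem_head.
by rewrite jj' // inE mu_l orbT.
Qed.

(** Only the factor of index mu fails to commute with dxi^mu; there dxi^mu becomes
y_mu, which produces the factor - j_mu and then kills the remaining factors. *)
Lemma mul_dx_fold mu (j : {ffun 'I_s -> nat}) l : uniq l -> mu \in l ->
  X_ mu (fold j l) = - ((j mu)%:R *: fold (decr j mu) l).
Proof.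
elim: l => //= nu l IHl /andP[nu_l uniq_l]; rewrite inE eq_sym.
have [nuE _|nu_mu /= mu_l] := eqVneq nu mu.
  rewrite {}nuE in nu_l *.
  rewrite mul_dx_taylor mul_y_iter_diff mul_y_fold //.
  rewrite (cl0 (central_linear_iter _ (fdiff_y_linear mu))) sub0r.
  rewrite (clN (ftaylor_linear mu)) (clZ (ftaylor_linear mu)); last exact: central_nat.
  rewrite decrE eqxx subn1; congr (- (_ *: ftaylor mu (iter _ _ _))).
  apply: fold_eq => lambda lambda_l; rewrite decrE.
  by case: eqVneq nu_l => [<-|]; rewrite ?lambda_l // subn0.
rewrite (ftaylor_commute (@fmul_dx_linear _ _ _ _ M _ _ x _)); last 2 first.
- exact: mul_dx_nilp.
- by move=> f; apply: mul_dx_diff_y.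
rewrite (iter_commute _ (fun f => mul_dx_diff_y f nu_mu)) IHl // decrE (negPf nu_mu) subn0.
rewrite (clN (central_linear_iter _ (fdiff_y_linear nu))).
rewrite (clZ (central_linear_iter _ (fdiff_y_linear nu))); last exact: central_nat.
by rewrite (clN (ftaylor_linear nu)) (clZ (ftaylor_linear nu)) //; apply: central_nat.
Qed.

Lemma coef_diff_y nu f S : coef (fdiff_y nu f) (S, zexp) = 0.
Proof.
rewrite fcoef_sum big1 // => kappa _.
by rewrite fcoefZ coef_fdiff_odd ffunE mulr0.
Qed.

Lemma coef_iter_nilp nu l f k : (forall S, coef f (S, k) = 0) ->
  forall S, coef (iter l (N_ nu) f) (S, k) = 0.
Proof. by move=> f0; elim: l => //= l IHl S; apply: coef_nilp. Qed.

Lemma coef_taylor nu f S : coef (ftaylor nu f) (S, zexp) = coef f (S, zexp).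
Proof.
rewrite fcoef_sum big_ord_recl [X in _ + X]big1 => [|l _]; rewrite fcoefZ.
  by rewrite /= fact0 invr1 scale1r mul1r addr0.
rewrite coef_iter_nilp ?mulr0 // => T; rewrite lift0; exact: coef_diff_y.
Qed.

Lemma coef_fold (j : {ffun 'I_s -> nat}) l S :
  coef (fold j l) (S, zexp) =
  if all (fun nu => j nu == 0%N) l then coef fdelta_y (S, zexp) else 0.
Proof.
elim: l => //= nu l IHl; rewrite coef_taylor.
by case: (j nu) => [|k] //=; rewrite coef_diff_y.
Qed.

Lemma delta_family_subst : delta_family hs x fsubst_delta.
Proof.
split=> [j mu|j S]; first by rewrite mul_dx_fold ?enum_uniq ?mem_enum.
rewrite coef_fold fcoefZ coef_mon xpair_eqE eqxx andbT (eq_sym set0).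
have -> : all (fun nu => j nu == 0%N) (enum 'I_s) = (j == zexp).
  apply/allP/eqP => [j0|-> nu _]; last by rewrite ffunE.
  by apply/ffunP => nu; rewrite ffunE; apply/eqP/j0; rewrite mem_enum.
by case: eqP; case: eqP; rewrite ?mulr1 ?mulr0.
Qed.

End Taylor.

(** * Formal functions as finitely supported combinations *)

Section Malg.

Variables (I : choiceType) (A : nzRingType).
Implicit Types (f : {malg A[I]}) (u v : I).

Lemma mcoeff_scale_sum (h : I -> {malg A[I]}) f v u :
  (forall w, w != u -> (h w)@_v = 0) ->
  (\sum_(w <- msupp f) f@_w *: h w)@_v = f@_u * (h u)@_v.
Proof.
move=> h0; rewrite (raddf_sum (mcoeff v)).
have [uf|uf] := boolP (u \in msupp f).
  rewrite (bigD1_seq u uf (fset_uniq _)) /= mcoeffZ big1 ?addr0 // => w wu.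
  by rewrite mcoeffZ h0 // mulr0.
rewrite (mcoeff_outdom uf) mul0r big_seq big1 // => w wf.
rewrite /= mcoeffZ h0 ?mulr0 //; apply: contraNneq uf => <-; exact: wf.
Qed.

Lemma mcoeff_scale_sum0 (h : I -> {malg A[I]}) f v :
  (forall w, (h w)@_v = 0) -> (\sum_(w <- msupp f) f@_w *: h w)@_v = 0.
Proof.
move=> h0; rewrite (raddf_sum (mcoeff v)) big1 //= => w _.
by rewrite mcoeffZ h0 mulr0.
Qed.

Lemma mcoeff_monomial_sum (c : I -> A -> A) f u : (forall w, c w 0 = 0) ->
  (\sum_(w <- msupp f) << c w f@_w *g w >>)@_u = c u f@_u.
Proof.
move=> c0; rewrite (raddf_sum (mcoeff u)).
have [uf|uf] := boolP (u \in msupp f).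
  rewrite (bigD1_seq u uf (fset_uniq _)) /= mcoeffUU big1 ?addr0 // => w /negPf wu.
  by rewrite mcoeffU wu.
rewrite (mcoeff_outdom uf) c0 big_seq big1 // => w wf.
rewrite /= mcoeffU; case: eqP => // wu; case/negP: uf; rewrite -wu; exact: wf.
Qed.

Lemma malg_ind (P : {malg A[I]} -> Prop) : P 0 ->
  (forall c u f, P f -> P (c *: << u >> + f)) -> forall f, P f.
Proof.
move=> P0 PS f; rewrite (monalgE f).
elim: (enum_fset (msupp f)) => [|u l IHl]; first by rewrite big_nil.
rewrite big_cons; suff -> : << f@_u *g u >> = f@_u *: << u >> by apply: PS.
by apply/malgP => v; rewrite mcoeffZ !mcoeffU mulr_natr.
Qed.

Lemma scale_sum_linear (h : I -> {malg A[I]}) c f g :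
  \sum_(w <- msupp (c *: f + g)) (c *: f + g)@_w *: h w =
  c *: (\sum_(w <- msupp f) f@_w *: h w) + \sum_(w <- msupp g) g@_w *: h w.
Proof.
have E (d : {fset I}) k : (msupp k `<=` d)%fset ->
    \sum_(w <- msupp k) k@_w *: h w = \sum_(w <- d) k@_w *: h w.
  move=> kd; apply: big_fset_incl => // w _ wk.
  by rewrite mcoeff_outdom // scale0r.
pose d := (msupp (c *: f + g) `|` msupp f `|` msupp g)%fset.
rewrite (E d) ?(E d f) ?(E d g); last 3 first.
- exact: fsubsetUr.
- by rewrite /d -fsetUA fsetUCA fsubsetUl.
- by rewrite /d -fsetUA fsubsetUl.
rewrite scaler_sumr -big_split /=; apply: eq_bigr => w _.
by rewrite mcoeffD mcoeffZ scalerDl scalerA.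
Qed.

Lemma scale_sumZ (h : I -> {malg A[I]}) c f :
  \sum_(w <- msupp (c *: f)) (c *: f)@_w *: h w =
  c *: (\sum_(w <- msupp f) f@_w *: h w).
Proof.
have := scale_sum_linear h c f 0.
by rewrite addr0 msupp0 big_seq_fset0 addr0.
Qed.

Lemma scale_sum_mon (h : I -> {malg A[I]}) u :
  \sum_(w <- msupp (<< u >> : {malg A[I]})) (<< u >> : {malg A[I]})@_w *: h w = h u.
Proof. by rewrite msuppU oner_eq0 big_seq_fset1 mcoeffUU scale1r. Qed.

End Malg.


Section MalgSpace.

Variables (K : fieldType) (R : superalgebra K) (r s : nat).
Local Notation M := (formal_function R r s).
Implicit Types (f g : M) (u v : dtmonomial r s) (a b c : R).

Lemma mcoeff0E u : (0 : M)@_u = 0.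
Proof. exact: (@mcoeff0 _ R). Qed.

Lemma mcoeffDE f g u : (f + g)@_u = f@_u + g@_u.
Proof. exact: (@mcoeffD _ R). Qed.

Lemma mcoeffZE c f u : (c *: f)@_u = c * f@_u.
Proof. exact: (@mcoeffZ _ R). Qed.

Lemma mcoeffUE v u : (<< v >> : M)@_u = (v == u)%:R.
Proof. exact: (@mcoeffU _ R). Qed.

Lemma mcoeff_extend h f v u :
  (forall w, w != u -> (h w)@_v = 0) -> (extend h f)@_v = f@_u * (h u)@_v.
Proof. exact: (@mcoeff_scale_sum _ R). Qed.

Lemma mcoeff_extend0 h f v : (forall w, (h w)@_v = 0) -> (extend h f)@_v = 0.
Proof. exact: (@mcoeff_scale_sum0 _ R). Qed.

Lemma mcoeff_mul_coef p a f u :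
  (mul_coef p a f)@_u = (-1) ^+ (p && dtparity u) * (a * f@_u).
Proof.
apply: (@mcoeff_monomial_sum _ R (fun u y => (-1) ^+ (p && dtparity u) * (a * y))).
by move=> w; rewrite !mulr0.
Qed.


Lemma mul_dt_evenE i : mul_dt (lshift s i) = extend (fun u : dtmonomial r s =>
  if i \in u.1 then 0 else (-1) ^+ below u.1 i *: << (i |: u.1, u.2) >> : M).
Proof. by rewrite /mul_dt (unsplitK (inl i)). Qed.

Lemma mul_dt_oddE kappa : mul_dt (rshift r kappa) = extend (fun u : dtmonomial r s =>
  - (u.2 kappa)%:R *: << (u.1, decr u.2 kappa) >> : M).
Proof. by rewrite /mul_dt (unsplitK (inr kappa)). Qed.

Lemma mcoeff_mul_dt_even i f S k :
  (mul_dt (lshift s i) f)@_(S, k) =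
  if i \in S then (-1) ^+ below (S :\ i) i * f@_(S :\ i, k) else 0.
Proof.
rewrite mul_dt_evenE; case: (boolP (i \in S)) => iS.
  rewrite (@mcoeff_extend _ _ _ (S :\ i, k)) => [|[S' k'] /=].
    rewrite /= !inE eqxx /= mcoeffZE setD1K // mcoeffUE eqxx mulr1.
    by apply/commr_sym/central_sign.
  move=> neq; case: ifP => [|/negbT iS']; first by rewrite mcoeff0E.
  rewrite mcoeffZE mcoeffUE; case: eqP => [[SE kE]|]; last by rewrite mulr0.
  by case/eqP: neq; rewrite -SE -kE setU1K.
apply: mcoeff_extend0 => -[S' k'] /=; case: ifP => [|_]; first by rewrite mcoeff0E.
rewrite mcoeffZE mcoeffUE; case: eqP => [[SE _]|]; last by rewrite mulr0.
by case/negP: iS; rewrite -SE !inE eqxx.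
Qed.

Lemma mcoeff_mul_dt_odd kappa f S k :
  (mul_dt (rshift r kappa) f)@_(S, k) =
  - ((k kappa).+1%:R * f@_(S, incr k kappa)).
Proof.
rewrite mul_dt_oddE (@mcoeff_extend _ _ _ (S, incr k kappa)) => [|[S' k'] neq] /=.
  rewrite incrE eqxx addn1 mcoeffZE incrK mcoeffUE eqxx mulr1 mulrN; congr (- _).
  by apply/commr_sym/central_nat.
rewrite mcoeffZE mcoeffUE; case: eqP => [[SE kE]|]; last by rewrite mulr0.
case: (posnP (k' kappa)) => [->|k'_gt0]; first by rewrite oppr0 mul0r.
by case/eqP: neq; rewrite -SE -kE decrK.
Qed.

Lemma mcoeff_diff_t kappa f S k :
  (diff_t kappa f)@_(S, k) = if (0 < k kappa)%N then f@_(S, decr k kappa) else 0.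
Proof.
rewrite /diff_t; case: ifP => k0.
  rewrite (@mcoeff_extend _ _ _ (S, decr k kappa)) => [|[S' k'] neq] /=.
    by rewrite -/(incr _ _) decrK // mcoeffUE eqxx mulr1.
  rewrite mcoeffUE xpair_eqE -/(incr _ _) eq_incr_decr k0 /=.
  by rewrite -xpair_eqE (negPf neq).
apply: mcoeff_extend0 => -[S' k'] /=.
by rewrite mcoeffUE xpair_eqE -/(incr _ _) eq_incr_decr k0 /= andbF.
Qed.

Definition diff_odd i : M -> M := extend (fun u : dtmonomial r s =>
  if i \in u.1 then (-1) ^+ below (u.1 :\ i) i *: << (u.1 :\ i, u.2) >> else 0).

Lemma mcoeff_diff_odd i f S k :
  (diff_odd i f)@_(S, k) =
  if i \in S then 0 else (-1) ^+ below S i * f@_(i |: S, k).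
Proof.
rewrite /diff_odd; case: (boolP (i \in S)) => iS.
  apply: mcoeff_extend0 => -[S' k'] /=; case: ifP => [_|]; last by rewrite mcoeff0E.
  rewrite mcoeffZE mcoeffUE; case: eqP => [[SE _]|]; last by rewrite mulr0.
  by move: iS; rewrite -SE !inE eqxx.
rewrite (@mcoeff_extend _ _ _ (i |: S, k)) => [|[S' k'] neq] /=.
  rewrite !inE eqxx /= mcoeffZE setU1K // mcoeffUE eqxx mulr1.
  by apply/commr_sym/central_sign.
case: ifP => [iS'|_]; last by rewrite mcoeff0E.
rewrite mcoeffZE mcoeffUE; case: eqP => [[SE kE]|]; last by rewrite mulr0.
by case/eqP: neq; rewrite -SE -kE setD1K.
Qed.




Lemma extend_linear (h : dtmonomial r s -> M) c f g :
  extend h (c *: f + g) = c *: extend h f + extend h g.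
Proof. exact: (@scale_sum_linear _ R). Qed.

Lemma extend_mon (h : dtmonomial r s -> M) u : extend h << u >> = h u.
Proof. exact: (@scale_sum_mon _ R). Qed.

Lemma mcoeff_linear c f g u : (c *: f + g)@_u = c * f@_u + g@_u.
Proof. by rewrite mcoeffDE mcoeffZE. Qed.

Lemma mcoeff_inj f g : (forall u, f@_u = g@_u) -> f = g.
Proof. by move/malgP. Qed.

Lemma formal_malg_ind (P : M -> Prop) : P 0 ->
  (forall c u f, P f -> P (c *: << u >> + f)) -> forall f, P f.
Proof. exact: (@malg_ind _ R). Qed.

Definition malg_space : formal_space R r s :=
  @FormalSpace K R r s M (fun f u => f@_u) (@mul_coef K R r s) (@mul_dt K R r s)
    diff_odd (@diff_t K R r s) (fun u => << u >>) (@extend K R r s)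
    mcoeff_linear mcoeff_inj mcoeff_mul_coef mcoeff_mul_dt_even mcoeff_mul_dt_odd
    mcoeff_diff_odd mcoeff_diff_t mcoeffUE extend_linear extend_mon formal_malg_ind.

End MalgSpace.

(** * Derivatives of pseudoforms and the product rule *)

Lemma malg_sum_widen (I : choiceType) (A : zmodType) (V : nmodType) (F : I -> A -> V)
    (f : {malg A[I]}) (d : {fset I}) : (forall w, F w 0 = 0) ->
  (msupp f `<=` d)%fset ->
  \sum_(w <- msupp f) F w f@_w = \sum_(w <- d) F w f@_w.
Proof.
move=> F0 fd; apply: big_fset_incl => // w _ wf.
by rewrite mcoeff_outdom // F0.
Qed.

Lemma sign_alg (K : fieldType) (R : unitAlgType K) q :
  ((-1) ^+ q : K)%:A = (-1) ^+ q :> R.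
Proof. exact: (rmorph_sign (in_alg R)). Qed.

Lemma nat_alg (K : fieldType) (R : unitAlgType K) q : (q%:R : K)%:A = q%:R :> R.
Proof. exact: scaler_nat. Qed.

Lemma below_count n (k : {set 'I_n}) (a : 'I_n) l1 l2 :
  enum 'I_n = l1 ++ a :: l2 -> below k a = count (mem k) l1.
Proof.
move=> enumE.
have : sorted ltn (map val (enum 'I_n)) by rewrite val_enum_ord iota_ltn_sorted.
rewrite (sorted_pairwise ltn_trans) enumE map_cat pairwise_cat /=.
case/and3P => l1a _ /andP[al2 _].
rewrite /below cardE /enum_mem size_filter -enumT enumE count_cat /= !inE ltnn andbF add0n.
rewrite [X in (_ + X)%N](_ : _ = 0%N) ?addn0.
  apply: eq_in_count => b bl1; rewrite !inE.
  have -> : (b < a)%N by apply: (allrelP l1a); rewrite ?map_f ?mem_head.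
  by rewrite andbT.
apply/eqP; rewrite -leqn0 leqNgt -has_count; apply/hasPn => b bl2.
rewrite !inE ltnNge ltnW ?andbF //.
by apply: (allP al2); rewrite map_f.
Qed.

Section Words.

Variables (n m s : nat) (hs : (s <= m)%N).
Implicit Types (k : {set 'I_n}) (i : {ffun 'I_(m - s) -> nat}).

Definition odd_word k (l : seq 'I_n) : seq 'I_(n + m) :=
  [seq lshift m a | a <- l & a \in k].

Definition poly_word i (l : seq 'I_(m - s)) : seq 'I_(n + m) :=
  flatten [seq nseq (i mu) (poly_col n mu) | mu <- l].

(** The substituted monomial is the product of the dx^A along this word, applied to
the product of the delta-functions. *)
Definition word k i : seq 'I_(n + m) :=
  odd_word k (enum 'I_n) ++ poly_word i (enum 'I_(m - s)).

Lemma lshift_notin_poly_word a i l : lshift m a \notin poly_word i l.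
Proof.
apply/flatten_mapP => -[mu _ /nseqP[/eqP]].
by rewrite eq_shift.
Qed.

Lemma poly_col_inj : injective (@poly_col n m s).
Proof. by move=> mu mu' /rshift_inj /(congr1 val) /= /val_inj. Qed.

Lemma poly_col_notin_word mu i l : mu \notin l -> poly_col n mu \notin poly_word i l.
Proof.
move=> mul; apply/flatten_mapP => -[nu nul /nseqP[/poly_col_inj mu_nu]].
by rewrite mu_nu nul in mul.
Qed.

Lemma poly_col_notin_odd mu k l : @poly_col n m s mu \notin odd_word k l.
Proof. by apply/mapP => -[a _ /eqP]; rewrite eq_shift. Qed.

Lemma delta_col_notin nu k i : delta_col n hs nu \notin word k i.
Proof.
rewrite mem_cat negb_or; apply/andP; split.
  by apply/mapP => -[a _ /eqP]; rewrite eq_shift.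
apply/flatten_mapP => -[mu _ /nseqP[/rshift_inj /(congr1 val) /= E _]].
by have := ltn_ord mu; rewrite -E ltnNge leq_addr.
Qed.

Lemma lshift_notin_odd a k l : a \notin l -> lshift m a \notin odd_word k l.
Proof.
move=> al; apply/mapP => -[b]; rewrite mem_filter => /andP[_ bl] /lshift_inj ab.
by rewrite ab bl in al.
Qed.

Lemma lshift_notin_odd_word a k l : a \notin k -> lshift m a \notin odd_word k l.
Proof.
move=> ak; apply/mapP => -[b]; rewrite mem_filter => /andP[bk _] /lshift_inj ab.
by rewrite ab bk in ak.
Qed.

Lemma odd_word_cat k l1 l2 : odd_word k (l1 ++ l2) = odd_word k l1 ++ odd_word k l2.
Proof. by rewrite /odd_word filter_cat map_cat. Qed.

Lemma poly_word_cat i l1 l2 : poly_word i (l1 ++ l2) = poly_word i l1 ++ poly_word i l2.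
Proof. by rewrite /poly_word map_cat flatten_cat. Qed.

Lemma odd_wordD1 k a l : a \notin l -> odd_word (k :\ a) l = odd_word k l.
Proof.
move=> al; congr map; apply: eq_in_filter => b bl; rewrite !inE.
by case: eqVneq bl al => [->->|].
Qed.

Lemma poly_word_decr i mu l : mu \notin l -> poly_word (decr i mu) l = poly_word i l.
Proof.
move=> mul; congr flatten; apply/eq_in_map => nu nul; rewrite decrE.
by case: eqVneq nul mul => [->->|_ _ _] //; rewrite subn0.
Qed.

Lemma enum_split (p : nat) (a : 'I_p) : exists l1 l2,
  [/\ enum 'I_p = l1 ++ a :: l2, a \notin l1 & a \notin l2].
Proof.
have : a \in enum 'I_p by rewrite mem_enum.
case/splitPr E: _ / => [l1 l2]; exists l1, l2.
have := enum_uniq 'I_p; rewrite {}E cat_uniq /= negb_or -andbA.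
by case/and5P => _ -> _ -> _.
Qed.

End Words.

Arguments odd_word {n m} k l.
Arguments poly_word {n m s} i l.
Arguments word {n m s} k i.

Section Derivation.

Variables (K : fieldType) (R : superalgebra K) (r s : nat).
Variable M : formal_space R r s.
Variables (n m : nat).
Implicit Types (f g h : M) (A B : 'I_(n + m)) (w : seq 'I_(n + m)).

Variable X : 'I_(n + m) -> M -> M.
Hypothesis lX : forall A, central_linear (X A).

Fixpoint mul_word w f : M := if w is A :: w' then X A (mul_word w' f) else f.

Lemma mul_word_linear w : central_linear (mul_word w).
Proof. by elim: w => //= A w IHw c f g cc; rewrite IHw // lX. Qed.

Lemma mul_word_cat w1 w2 f : mul_word (w1 ++ w2) f = mul_word w1 (mul_word w2 f).
Proof. by elim: w1 => //= A w1 ->. Qed.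

(** A pair (f, f') stands for a function f with its partial derivatives f' B along
all the dx^B. This is the product rule for dx^A f. *)
Definition dstep A (z : M * ('I_(n + m) -> M)) : M * ('I_(n + m) -> M) :=
  (X A z.1, fun B => (-1) ^+ (~~ parity A && ~~ parity B) *: X A (z.2 B) +
                     (if B == A then z.1 else 0)).

Fixpoint dword z w := if w is A :: w' then dstep A (dword z w') else z.

Lemma dword_cat z w1 w2 : dword z (w1 ++ w2) = dword (dword z w2) w1.
Proof. by elim: w1 => //= A w1 ->. Qed.

Lemma dword1 z w : (dword z w).1 = mul_word w z.1.
Proof. by elim: w => //= A w ->. Qed.

Lemma dword_notin z w B : B \notin w ->
  (dword z w).2 B =
  (-1) ^+ (count (fun A => ~~ parity A && ~~ parity B) w) *: mul_word w (z.2 B).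
Proof.
elim: w => [_|A w IHw] /=; first by rewrite scale1r.
rewrite inE negb_or => /andP[/negPf -> /IHw ->]; rewrite addr0.
by rewrite (clZ (lX A)) ?scalerA -?exprD //; apply: central_sign.
Qed.

Lemma dword_even_notin z w B : parity B -> B \notin w ->
  (dword z w).2 B = mul_word w (z.2 B).
Proof.
move=> pB Bw; rewrite dword_notin // (eq_count (a2 := pred0)).
  by rewrite count_pred0 scale1r.
by move=> A /=; rewrite pB andbF.
Qed.

Lemma dword_notin0 z w B : z.2 B = 0 -> B \notin w -> (dword z w).2 B = 0.
Proof. by move=> zB Bw; rewrite dword_notin // zB (cl0 (mul_word_linear w)) scaler0. Qed.

Lemma dword_nseq z B c : parity B ->
  (dword z (nseq c B)).2 B =
  mul_word (nseq c B) (z.2 B) + c%:R *: mul_word (nseq c.-1 B) z.1.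
Proof.
move=> pB; elim: c => [|c IHc] /=; first by rewrite scale0r addr0.
rewrite IHc pB andbF scale1r eqxx dword1 (clD (lX B)) -addrA; congr (_ + _).
rewrite (clZ (lX B)); last exact: central_nat.
rewrite -natr1 scalerDl scale1r; congr (_ + _).
by case: c {IHc} => [|c]; rewrite ?scale0r.
Qed.

Variables (q : bool) (P : 'I_(n + m) -> M -> M) (X' : 'I_(n + m) -> M -> M).
Variable Rl : M -> M -> M -> Prop.
Hypothesis lP : forall A, central_linear (P A).
Hypothesis scommPX : forall A B, scomm (q (+) ~~ parity A) (~~ parity B) (P A) (X B).
Hypothesis RlX : forall A g f f', Rl g f f' ->
  Rl (X' A g) (X A f) ((-1) ^+ (q && ~~ parity A) *: X A f' + P A f).

Lemma dstep_total A z :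
  \sum_B P B ((dstep A z).2 B) =
  (-1) ^+ (q && ~~ parity A) *: X A (\sum_B P B (z.2 B)) + P A z.1.
Proof.
under eq_bigr => B _ do rewrite /= (clD (lP B)).
rewrite big_split /=; congr (_ + _).
  rewrite (cl_sum (lX A)) scaler_sumr; apply: eq_bigr => B _.
  rewrite (clZ (lP B)); last exact: central_sign.
  rewrite scommPX scalerA -signr_addb; congr (_ ^+ _ *: _).
  by case: q; case: (parity A); case: (parity B).
rewrite (bigD1 A) //= eqxx big1 ?addr0 // => B /negPf ->.
exact: cl0.
Qed.

(** A first-order variation that changes each dx^A by P A acts on products by the
product rule, and is therefore the sum of the P B applied to the derivatives
along dx^B. In Rl g f f', the function f varies by f', and g is at hand for what
f turns into. Both the effect of an increment of x and that of a derivative in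
dt are of this form. *)
Lemma dword_total g z w : Rl g z.1 (\sum_B P B (z.2 B)) ->
  Rl (foldr (fun A => X' A) g w) (mul_word w z.1) (\sum_B P B ((dword z w).2 B)).
Proof.
move=> R0; elim: w => //= A w IHw.
by rewrite dstep_total dword1; apply: RlX.
Qed.

End Derivation.

Section Form.

Variable K : fieldType.
Variables (R : superalgebra K) (r s : nat).
Variable M : formal_space R r s.
Variables (n m : nat) (hs : (s <= m)%N).
Implicit Types (f g h : M) (A B : 'I_(n + m)) (x : 'M[R]_(r + s, n + m)).
Implicit Types (u : dxmonomial n m s) (omega : pseudoform K n m s).

Local Notation e_ := (@fmul_dt _ _ _ _ M).
Local Notation d_ := (@fdiff _ _ _ _ M).
Local Notation c_ := (@fmul_coef _ _ _ _ M).
Local Notation zexp := ([ffun=> 0%N] : {ffun 'I_s -> nat}).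
Local Notation v_ x := (fsubst_delta M hs x).
Local Notation X_ x := (fmul_dx (M := M) x).

Definition fsubst_monomial x u : M :=
  let: (k, i, j) := u in
  foldr (fun a f => if a \in k then X_ x (lshift m a) f else f)
    (foldr (fun mu f => iter (i mu) (X_ x (poly_col n mu)) f)
      (v_ x j) (enum 'I_(m - s)))
    (enum 'I_n).

Definition fsubst_form x omega : M :=
  \sum_(u <- msupp omega) (omega@_u)%:A *: fsubst_monomial x u.

Lemma fsubst_monomialE x k i j :
  fsubst_monomial x (k, i, j) = mul_word (X_ x) (word k i) (v_ x j).
Proof.
rewrite mul_word_cat /=.
have -> : foldr (fun mu f => iter (i mu) (X_ x (poly_col n mu)) f)
      (v_ x j) (enum 'I_(m - s)) =
    mul_word (X_ x) (poly_word i (enum 'I_(m - s))) (v_ x j).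
  elim: (enum 'I_(m - s)) => //= mu l ->; rewrite /poly_word /= mul_word_cat.
  by elim: (i mu) => //= c ->.
elim: (enum 'I_n) => //= a l ->; rewrite /odd_word /=.
by case: ifP.
Qed.

Lemma fsubst_form_linear x (c : K) omega omega' :
  fsubst_form x (c *: omega + omega') =
  c%:A *: fsubst_form x omega + fsubst_form x omega'.
Proof.
pose d := (msupp (c *: omega + omega') `|` msupp omega `|` msupp omega')%fset.
have W k : (msupp k `<=` d)%fset ->
    fsubst_form x k = \sum_(w <- d) (k@_w)%:A *: fsubst_monomial x w.
  apply: (malg_sum_widen (F := fun w (b : K) => (b%:A : R) *: fsubst_monomial x w)).
  by move=> w; rewrite !scale0r.
rewrite !W; try by apply/fsubsetP => w; rewrite !in_fsetU => ->; rewrite ?orbT.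
rewrite scaler_sumr -big_split /=; apply: eq_bigr => w _.
by rewrite mcoeffD mcoeffZ scalerDl scalerA mulr_algl scalerA scalerDl.
Qed.

Lemma fsubst_form0 x : fsubst_form x 0 = 0.
Proof. by rewrite /fsubst_form msupp0 big_seq_fset0. Qed.

Lemma fsubst_formZ x c omega : fsubst_form x (c *: omega) = c%:A *: fsubst_form x omega.
Proof. by rewrite -[c *: _]addr0 fsubst_form_linear fsubst_form0 addr0. Qed.

Lemma fsubst_form_sum x (I : Type) (l : seq I) (F : I -> pseudoform K n m s) :
  fsubst_form x (\sum_(i <- l) F i) = \sum_(i <- l) fsubst_form x (F i).
Proof.
elim/big_rec2: _ => [|i y w _ <-]; first exact: fsubst_form0.
by rewrite -[F i]scale1r fsubst_form_linear !scale1r.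
Qed.

Lemma fsubst_form_mon x u : fsubst_form x << u >> = fsubst_monomial x u.
Proof.
by rewrite /fsubst_form msuppU oner_eq0 big_seq_fset1 mcoeffUU !scale1r.
Qed.

(** The left derivative along dx^A; it turns delta^(j) into delta^(j+1). *)
Definition pdiff_mon A u : pseudoform K n m s :=
  let: (k, i, j) := u in
  match split A with
  | inl a => if a \in k then (-1) ^+ below k a *: << (k :\ a, i, j) >> else 0
  | inr b => match split (cast_ord (esym (subnK hs)) b) with
             | inl mu => (i mu)%:R *: << (k, decr i mu, j) >>
             | inr nu => << (k, i, incr j nu) >>
             end
  end.

Definition pdiff A omega : pseudoform K n m s :=
  \sum_(u <- msupp omega) omega@_u *: pdiff_mon A u.

Lemma fsubst_pdiff x A omega : fsubst_form x (pdiff A omega) =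
  \sum_(u <- msupp omega) (omega@_u)%:A *: fsubst_form x (pdiff_mon A u).
Proof.
by rewrite fsubst_form_sum; apply: eq_bigr => u _; rewrite fsubst_formZ.
Qed.

Lemma split_lshift (a : 'I_n) : split (lshift m a) = inl a.
Proof. exact: (unsplitK (inl a)). Qed.

Lemma split_rshift (b : 'I_m) : split (rshift n b) = inr b.
Proof. exact: (unsplitK (inr b)). Qed.

Lemma split_poly (mu : 'I_(m - s)) :
  split (cast_ord (esym (subnK hs)) (widen_ord (leq_subr s m) mu)) = inl mu.
Proof.
rewrite -(unsplitK (inl mu)); congr split; exact: val_inj.
Qed.

Lemma split_delta (nu : 'I_s) :
  split (cast_ord (esym (subnK hs)) (cast_ord (subnK hs) (rshift (m - s) nu))) = inr nu.
Proof. by rewrite cast_ordK -(unsplitK (inr nu)). Qed.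

(** The derivatives along all the dx^A of the product of delta-functions. *)
Definition delta_part x j A : M :=
  match split A with
  | inl _ => 0
  | inr b => match split (cast_ord (esym (subnK hs)) b) with
             | inl _ => 0
             | inr nu => v_ x (incr j nu)
             end
  end.

Lemma delta_part_odd x j a : delta_part x j (lshift m a) = 0.
Proof. by rewrite /delta_part split_lshift. Qed.

Lemma delta_part_poly x j (mu : 'I_(m - s)) : delta_part x j (poly_col n mu) = 0.
Proof. by rewrite /delta_part split_rshift split_poly. Qed.

Lemma delta_part_delta x j nu : delta_part x j (delta_col n hs nu) = v_ x (incr j nu).
Proof. by rewrite /delta_part split_rshift split_delta. Qed.

Lemma dword_pdiff x k i j B :
  (dword (X_ x) (v_ x j, delta_part x j) (word k i)).2 B =
  fsubst_form x (pdiff_mon B (k, i, j)).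
Proof.
have lX := @fmul_dx_linear _ _ _ _ M _ _ x.
have [[a ->]|[mu ->]|[nu ->]] := col_cases hs B;
  rewrite /= ?split_lshift ?split_rshift ?split_poly ?split_delta.
- case: ifPn => [ak|ak]; last first.
    rewrite fsubst_form0 dword_notin0 //= ?delta_part_odd //.
    by rewrite mem_cat negb_or lshift_notin_odd_word ?lshift_notin_poly_word.
  have [l1 [l2 [enumE al1 al2]]] := enum_split a.
  have wE k' : word k' i = odd_word k' l1 ++ odd_word k' [:: a] ++
      odd_word k' l2 ++ poly_word i (enum 'I_(m - s)).
    by rewrite /word enumE -[a :: l2]cat1s !odd_word_cat -!catA.
  have wa : odd_word k [:: a] = [:: lshift m a] by rewrite /odd_word /= ak.
  have wDa : odd_word (m := m) (k :\ a) [:: a] = [::].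
    by rewrite /odd_word /= !inE eqxx.
  rewrite fsubst_formZ fsubst_form_mon fsubst_monomialE (below_count _ enumE).
  rewrite !wE wa wDa !odd_wordD1 // dword_cat.
  rewrite (dword_notin lX) ?lshift_notin_odd //= eqxx.
  rewrite (dword_notin0 lX) /= ?delta_part_odd //; last first.
    by rewrite mem_cat negb_or lshift_notin_odd // lshift_notin_poly_word.
  rewrite (cl0 (lX _)) scaler0 add0r dword1 -mul_word_cat sign_alg.
  congr (_ ^+ _ *: _).
  rewrite parity_lshift count_map count_filter; apply: eq_count => b /=.
  by rewrite parity_lshift.
- have [l1 [l2 [enumE mul1 mul2]]] := enum_split mu.
  have wE i' : word k i' = odd_word k (enum 'I_n) ++ poly_word i' l1 ++
      nseq (i' mu) (poly_col n mu) ++ poly_word i' l2.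
    rewrite /word enumE -[mu :: l2]cat1s !poly_word_cat; congr (_ ++ (_ ++ (_ ++ _))).
    by rewrite /poly_word /= cats0.
  rewrite fsubst_formZ fsubst_form_mon fsubst_monomialE.
  rewrite !wE !poly_word_decr // !dword_cat !mul_word_cat.
  have pmu := parity_poly_col n mu.
  rewrite (dword_even_notin lX _ pmu); last exact: poly_col_notin_odd.
  rewrite (dword_even_notin lX _ pmu); last exact: poly_col_notin_word.
  rewrite (dword_nseq lX _ _ pmu) (dword_even_notin lX _ pmu); last exact: poly_col_notin_word.
  rewrite /= delta_part_poly dword1 /= !(cl0 (mul_word_linear lX _)) add0r.
  rewrite !(clZ (mul_word_linear lX _)); try exact: central_nat.
  by rewrite decrE eqxx subn1 nat_alg.
- rewrite fsubst_form_mon fsubst_monomialE dword_even_notin //.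
  + by rewrite /= delta_part_delta.
  + exact: parity_delta_col.
  + exact: delta_col_notin.
Qed.

End Form.

Arguments pdiff_mon {K s n m} hs A u.
Arguments pdiff {K s n m} hs A omega.

(** * The chain rule and increments of x *)

Section Variation.

Variables (K : fieldType) (charK0 : [pchar K] =i pred0).
Variables (R : superalgebra K) (r s : nat).
Variable M : formal_space R r s.
Variables (n m : nat) (hs : (s <= m)%N).
Implicit Types (f g h : M) (A B : 'I_(n + m)).
Implicit Types (u : dxmonomial n m s) (omega : pseudoform K n m s).

Local Notation e_ := (@fmul_dt _ _ _ _ M).
Local Notation d_ := (@fdiff _ _ _ _ M).
Local Notation c_ := (@fmul_coef _ _ _ _ M).
Local Notation zexp := ([ffun=> 0%N] : {ffun 'I_s -> nat}).
Local Notation v_ x := (fsubst_delta M hs x).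
Local Notation X_ x := (fmul_dx (M := M) x).
Local Notation D_ := (delta_col n hs).
Local Notation S_ := (fsubst_form M hs).

Variables (x : 'M[R]_(r + s, n + m)).
Hypotheses (hx : even_smx x) (ux : \det (odd_block hs x) \is a GRing.unit).

Let lX := @fmul_dx_linear _ _ _ _ M _ _ x.
Let hv : delta_family hs x (v_ x) := delta_family_subst charK0 M hx ux.

Lemma scomm_delta p (P : M -> M) mu : scomm p (~~ parity (D_ mu)) P (X_ x (D_ mu)) ->
  forall f, X_ x (D_ mu) (P f) = P (X_ x (D_ mu) f).
Proof. by move=> PX f; rewrite PX parity_delta_col andbF scale1r. Qed.

Section Total.

Variable P : 'I_(n + m) -> M -> M.
Hypothesis lP : forall A, central_linear (P A).
Hypothesis PX : forall A mu f, X_ x (D_ mu) (P A f) = P A (X_ x (D_ mu) f).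

Lemma sum_delta_part j :
  \sum_B P B (delta_part M hs x j B) = \sum_nu P (D_ nu) (v_ x (incr j nu)).
Proof.
rewrite (sum_columns hs) [X in X + _]big1 => [|a _].
  rewrite [X in _ + (X + _)]big1 => [|mu _].
    by rewrite !add0r; apply: eq_bigr => nu _; rewrite delta_part_delta.
  by rewrite delta_part_poly (cl0 (lP _)).
by rewrite delta_part_odd (cl0 (lP _)).
Qed.

(** The first property of a delta family, for a total variation of its members. The
chain rule and the effect of an increment of x both rest on it. *)
Lemma mul_dx_delta_part j mu :
  X_ x (D_ mu) (\sum_B P B (delta_part M hs x j B)) =
  - P (D_ mu) (v_ x j) -
  (j mu)%:R *: \sum_B P B (delta_part M hs x (decr j mu) B).
Proof.
have [Xv _] := hv.
rewrite !sum_delta_part (cl_sum (lX _)).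
have E nu : X_ x (D_ mu) (P (D_ nu) (v_ x (incr j nu))) =
    - (if nu == mu then P (D_ nu) (v_ x j) else 0) -
    (j mu)%:R *: P (D_ nu) (v_ x (incr (decr j mu) nu)).
  rewrite PX Xv (clN (lP _)) (clZ (lP _)); last exact: central_nat.
  rewrite -opprD incrE; congr (- _).
  have [->|nu_mu] := eqVneq nu mu; last first.
    by rewrite add0r addn0 decr_incr_neq // eq_sym.
  rewrite incrK natrD scalerDl scale1r addrC.
  by case: (posnP (j mu)) => [->|k_gt0]; rewrite ?scale0r ?decrK.
rewrite (eq_bigr _ (fun nu _ => E nu)) big_split /= !sumrN -scaler_sumr.
by rewrite (bigD1 mu) //= eqxx big1 ?addr0 => // nu /negPf ->.
Qed.

End Total.

(** The two sides are compared by means of the injectivity of multiplication by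
dx: neither has terms free of derivatives of delta-functions. *)
Lemma diff_subst_delta G j :
  d_ G (v_ x j) =
  \sum_B c_ (parity G (+) parity B) (x G B) (delta_part M hs x j B).
Proof.
have [Xv v0] := hv.
pose P B : M -> M := c_ (parity G (+) parity B) (x G B).
have lP B : central_linear (P B) by apply: mul_coef_linear.
have PX B mu f : X_ x (D_ mu) (P B f) = P B (X_ x (D_ mu) f).
  exact: (scomm_delta (scomm_coef_dx (D_ mu) hx (hx G B))).
elim/exponent_ind: j => j IHj; apply/eqP; rewrite -subr_eq0; apply/eqP.
apply: (dx_delta_inj charK0 hx ux) => [mu|S].
  rewrite (clB (lX _)) (mul_dx_delta_part lP PX).
  have -> : X_ x (D_ mu) (d_ G (v_ x j)) = d_ G (X_ x (D_ mu) (v_ x j)) - P (D_ mu) (v_ x j).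
    rewrite diff_dx -[c_ _ _ _]/(P (D_ mu) (v_ x j)).
    by rewrite parity_delta_col andbF scale1r addrK.
  rewrite Xv (clN (@diff_linear _ _ _ _ M G)) (clZ (@diff_linear _ _ _ _ M G));
    last exact: central_nat.
  case: (posnP (j mu)) => [->|/IHj ->]; last by rewrite opprB opprK -opprD addNr.
  by rewrite !scale0r oppr0 addr0 add0r subrr.
rewrite fcoefD fcoefN (sum_delta_part lP) fcoef_sum big1 => [|nu _]; last first.
  by rewrite coef_mul_coef v0 (negPf (incr_neq0 _ _)) andbF !mulr0.
rewrite subr0; have [i ->|kappa ->] := split_ordP G; last by rewrite coef_diff_odd ffunE.
rewrite coef_diff_even; case: ifP => // iS; rewrite v0.
(* Only the empty product of odd dt's has a nonzero coefficient. *)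
have /set0Pn/negPf -> : exists l, l \in i |: S by exists i; rewrite setU11.
by rewrite mulr0.
Qed.

(** The chain rule for dx = dt x. *)
Lemma diff_subst_form G omega :
  d_ G (S_ x omega) =
  \sum_A c_ (parity G (+) parity A) (x G A) (S_ x (pdiff hs A omega)).
Proof.
have mon u : d_ G (fsubst_monomial M hs x u) =
    \sum_A c_ (parity G (+) parity A) (x G A) (S_ x (pdiff_mon hs A u)).
  case: u => [[k i] j]; rewrite fsubst_monomialE.
  rewrite -[RHS](eq_bigr _ (fun A _ => congr1 _ (dword_pdiff M hs x k i j A))).
  pose Rl (g f f' : M) := d_ G f = f'.
  pose z := (v_ x j, delta_part M hs x j).
  suff : Rl (foldr (fun A => X_ x A) 0 (word k i)) (mul_word (X_ x) (word k i) z.1)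
      (\sum_A c_ (parity G (+) parity A) (x G A) ((dword (X_ x) z (word k i)).2 A)) by [].
  apply: (dword_total lX (q := ~~ parity G)
    (P := fun A => c_ (parity G (+) parity A) (x G A))) => [A|A B|A g f f' <-|].
  - exact: mul_coef_linear.
  - by rewrite addNb addbN negbK; apply: scomm_coef_dx.
  - exact: diff_dx.
  - exact: diff_subst_delta.
rewrite (cl_sum (@diff_linear _ _ _ _ M G)).
under [RHS]eq_bigr => A _ do rewrite fsubst_pdiff (cl_sum (@mul_coef_linear _ _ _ _ M _ _)).
rewrite exchange_big /=; apply: eq_bigr => u _.
rewrite (clZ (@diff_linear _ _ _ _ M G)); last exact: central_alg.
rewrite mon scaler_sumr; apply: eq_bigr => A _.
by rewrite (clZ (@mul_coef_linear _ _ _ _ M _ _)) //; apply: central_alg.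
Qed.

Section Increment.

Variables (F : 'I_(r + s)) (A0 : 'I_(n + m)) (eps : R).
Hypothesis heps : homog (parity F (+) parity A0) eps.
Hypothesis eps2 : eps * eps = 0.

Let x' := x + eps *: delta_mx F A0.

Lemma increment_entry G B :
  x' G B = x G B + (if (G == F) && (B == A0) then eps else 0).
Proof. by rewrite !mxE; case: ifP; rewrite ?mulr1 ?mulr0. Qed.

Lemma increment_even : even_smx x'.
Proof.
move=> G B; rewrite increment_entry; apply: homogD; first exact: hx.
by case: ifP => [/andP[/eqP -> /eqP ->]|_]; [exact: heps | exact: homog0].
Qed.

Lemma increment_unit : \det (odd_block hs x') \is a GRing.unit.
Proof.
pose Q := \matrix_(kappa, nu)
  (if (rshift r kappa == F) && (D_ nu == A0) then eps else 0).
have -> : odd_block hs x' = odd_block hs x + Q.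
  by apply/matrixP => kappa nu; rewrite mxE increment_entry !mxE.
apply: unit_add_sqr0 => //; first exact: odd_block_even.
  move=> kappa nu; rewrite mxE; case: ifP => [/andP[/eqP Fk /eqP Anu]|_]; last exact: homog0.
  by move: heps; rewrite -Fk -Anu parity_rshift parity_delta_col.
move=> i j k l; rewrite !mxE; case: ifP => _; case: ifP => _; rewrite ?mulr0 ?mul0r //.
Qed.

Let eta f : M := e_ F (c_ (parity F (+) parity A0) eps f).
Let P B f : M := if B == A0 then eta f else 0.

Lemma eta_linear : central_linear eta.
Proof.
exact: central_linear_comp (@mul_dt_linear _ _ _ _ M _) (@mul_coef_linear _ _ _ _ M _ _).
Qed.

Let lP B : central_linear (P B).
Proof.
rewrite /P => c f g cc; case: eqP => _; first exact: eta_linear.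
by rewrite scaler0 addr0.
Qed.

Let PX A B : scomm (false (+) ~~ parity A) (~~ parity B) (P A) (X_ x B).
Proof.
move=> f; rewrite /P /=; case: eqP => [->|_]; last by rewrite (cl0 (lX _)) scaler0.
have := scomm_dt_coef_dx (M := M) F B hx heps f.
by rewrite addbA addNb addbb.
Qed.

Lemma mul_dx_increment B f : X_ x' B f = X_ x B f + P B f.
Proof.
rewrite /fmul_dx.
have E G : e_ G (c_ (parity G (+) parity B) (x' G B) f) =
    e_ G (c_ (parity G (+) parity B) (x G B) f) + (if G == F then P B f else 0).
  rewrite increment_entry mul_coefDl (clD (@mul_dt_linear _ _ _ _ M _)).
  congr (_ + _); rewrite /P /eta.
  have [->|_] := eqVneq G F; rewrite /= ?mul_coef0 ?(cl0 (@mul_dt_linear _ _ _ _ M _)) //.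
  have [->|_] := eqVneq B A0; rewrite /= ?mul_coef0 ?(cl0 (@mul_dt_linear _ _ _ _ M _)) //.
rewrite (eq_bigr _ (fun G _ => E G)) big_split /=; congr (_ + _).
by rewrite (bigD1 F) //= eqxx big1 ?addr0 // => G /negPf ->.
Qed.

Lemma eta_eta f : eta (eta f) = 0.
Proof.
rewrite /eta [c_ _ _ (e_ _ _)](scomm_sym (scomm_mul_dt_coef (M := M) F _ _)).
rewrite mul_coefM eps2 mul_coef0 (cl0 (@mul_dt_linear _ _ _ _ M _)) scaler0.
exact: cl0 (@mul_dt_linear _ _ _ _ M _).
Qed.

Let PP A B f : P A (P B f) = 0.
Proof.
rewrite /P; case: eqP => _ //; case: eqP => _; last exact: cl0 eta_linear.
exact: eta_eta.
Qed.

Let PXd B mu f : X_ x (D_ mu) (P B f) = P B (X_ x (D_ mu) f).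
Proof. exact: scomm_delta (PX B (D_ mu)) f. Qed.

(** The odd block moves only if F is an odd row and A0 a delta column. In that case
the variation of the inverse determinant equals the coefficient that
multiplication by t_kappa takes from the first derivatives of the deltas. *)
Lemma coef_increment j S :
  coef (v_ x j + \sum_B P B (delta_part M hs x j B)) (S, zexp) =
  if (S == set0) && (j == zexp) then (\det (odd_block hs x'))^-1 else 0.
Proof.
have [Xv v0] := hv.
have hB := odd_block_even hs hx.
rewrite (sum_delta_part lP) fcoefD fcoef_sum.
have same : odd_block hs x' = odd_block hs x ->
    (forall nu, coef (P (D_ nu) (v_ x (incr j nu))) (S, zexp) = 0) ->
    coef (v_ x j) (S, zexp) +
      \sum_nu coef (P (D_ nu) (v_ x (incr j nu))) (S, zexp) =
    if (S == set0) && (j == zexp) then (\det (odd_block hs x'))^-1 else 0.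
  by move=> -> P0; rewrite big1 ?addr0 // v0.
have [/existsP[nu /eqP Anu]|noA] := boolP [exists nu, A0 == D_ nu]; last first.
  apply: same => [|nu].
    apply/matrixP => kappa nu; rewrite mxE increment_entry mxE.
    case: ifP => [/andP[_ /eqP Anu]|_]; last by rewrite addr0.
    by case/existsP: noA; exists nu; rewrite Anu.
  rewrite /P; case: eqP => [Anu|_]; last by rewrite fcoef0.
  by case/existsP: noA; exists nu; rewrite Anu.
have [i Fi|kappa Fk] := split_ordP F.
  apply: same => [|nu'].
    apply/matrixP => kappa nu'; rewrite mxE increment_entry mxE.
    by rewrite Fi eq_shift addr0.
  rewrite /P; case: eqP => _; last by rewrite fcoef0.
  rewrite /eta Fi coef_mul_dt_even coef_mul_coef v0 (negPf (incr_neq0 _ _)) andbF.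
  by rewrite !mulr0 if_same.
set b := eps * inv_evenmx (odd_block hs x) nu kappa.
have hp : parity F (+) parity A0 = false by rewrite Fk Anu parity_rshift parity_delta_col.
have heps0 : homog false eps by rewrite -hp.
have B'E : odd_block hs x' = odd_block hs x + eps *: delta_mx kappa nu.
  apply/matrixP => l l'; rewrite mxE increment_entry !mxE Fk Anu !eq_shift.
  rewrite (inj_eq (@cast_ord_inj _ _ _)) eq_shift.
  by case: ifP; rewrite ?mulr1 ?mulr0.
have -> : (\det (odd_block hs x'))^-1 =
    (\det (odd_block hs x))^-1 - b * (\det (odd_block hs x))^-1.
  apply: (mulIr increment_unit); rewrite mulVr ?increment_unit //.
  have bb : b * b = 0.
    by rewrite {1}/b -mulrA (centralCA _ _ (even_central heps0)) mulrA eps2 mul0r.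
  rewrite B'E even_det_add_delta // -/b -[X in X - _]mul1r -mulrBl -mulrA mulKr //.
  by rewrite mulrBl mul1r mulrDr mulr1 bb addr0 addrK.
rewrite (bigD1 nu) //= big1 ?addr0 => [|nu' nu'_nu]; last first.
  rewrite /P Anu ifF ?fcoef0 //; apply/negbTE; apply: contra nu'_nu => /eqP.
  by rewrite /delta_col => /rshift_inj/cast_ord_inj/rshift_inj ->.
rewrite /P Anu eqxx /eta hp Fk coef_mul_dt_odd coef_mul_coef ffunE mul1r mul1r.
rewrite (delta_family_incr _ _ _ _ hx ux hv) mulrA -/b v0.
by case: ifP; rewrite ?mulr0 ?subr0.
Qed.

(** The right-hand side has the two properties that characterize the left-hand
side. *)
Lemma increment_delta j :
  v_ x' j = v_ x j + \sum_B P B (delta_part M hs x j B).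
Proof.
pose w j := v_ x j + \sum_B P B (delta_part M hs x j B).
have hv' : delta_family hs x' (v_ x').
  by have h := delta_family_subst charK0 M increment_even increment_unit; apply: h.
suff hw : delta_family hs x' w.
  exact: (delta_family_unique charK0 increment_even increment_unit hv' hw j).
split=> [{}j mu|{}j S]; last exact: coef_increment.
rewrite /w; have [Xv _] := hv.
rewrite mul_dx_increment (clD (lX _)) (mul_dx_delta_part lP PXd) Xv (clD (lP _)).
rewrite (cl_sum (lP _)) [X in _ + (_ + X)]big1 => [|B _]; last exact: PP.
by rewrite addr0 scalerDr opprD -addrA [X in _ + X = _]addrAC addNr add0r.
Qed.

(** Taylor's formula in x_F^A, exact because eps has square zero. *)
Lemma subst_form_increment omega :
  S_ x' omega = S_ x omega + eta (S_ x (pdiff hs A0 omega)).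
Proof.
have mon u : fsubst_monomial M hs x' u = fsubst_monomial M hs x u +
    eta (S_ x (pdiff_mon hs A0 u)).
  case: u => [[k i] j]; rewrite !fsubst_monomialE.
  have -> : eta (S_ x (pdiff_mon hs A0 (k, i, j))) =
      \sum_B P B ((dword (X_ x) (v_ x j, delta_part M hs x j) (word k i)).2 B).
    rewrite (bigD1 A0) //= {1}/P eqxx dword_pdiff big1 ?addr0 // => B /negPf BA.
    by rewrite /P BA.
  pose Rl (g f f' : M) := g = f + f' /\ forall A, P A f' = 0.
  have [] // : Rl (mul_word (X_ x') (word k i) (v_ x' j))
      (mul_word (X_ x) (word k i) (v_ x j))
      (\sum_B P B ((dword (X_ x) (v_ x j, delta_part M hs x j) (word k i)).2 B)).
  have foldE w g : mul_word (X_ x') w g = foldr (fun A => X_ x' A) g w.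
    by elim: w => //= A w ->.
  pose z := (v_ x j, delta_part M hs x j).
  suff : Rl (foldr (fun A => X_ x' A) (v_ x' j) (word k i))
      (mul_word (X_ x) (word k i) z.1)
      (\sum_B P B ((dword (X_ x) z (word k i)).2 B)) by rewrite foldE.
  apply: (dword_total lX (q := false) (P := P)) => // [A g f f' [-> Pf']|].
    split=> [|B].
      rewrite mul_dx_increment (clD (lX _)) (clD (lP _)) Pf' addr0 scale1r.
      by rewrite -!addrA.
    rewrite (clD (lP _)) PP addr0 scale1r PX Pf' (cl0 (lX _)) scaler0.
    by [].
  split=> [|A]; first exact: increment_delta.
  by rewrite (cl_sum (lP _)) big1 // => B _; apply: PP.
rewrite fsubst_pdiff (cl_sum eta_linear) [S_ x' _]/fsubst_form.
rewrite [S_ x omega]/fsubst_form -big_split /=.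
apply: eq_bigr => u _; rewrite mon scalerDr (clZ eta_linear) //.
exact: central_alg.
Qed.

End Increment.

End Variation.

(** * Intertwining operators and base change *)

Section Intertwine.

Variables (K : fieldType) (charK0 : [pchar K] =i pred0).
Variables (R R' : superalgebra K) (r s : nat).
Variables (M : formal_space R r s) (M' : formal_space R' r s).
Variables (n m : nat) (hs : (s <= m)%N).
Variables (x : 'M[R]_(r + s, n + m)) (x' : 'M[R']_(r + s, n + m)).

Local Notation zexp := ([ffun=> 0%N] : {ffun 'I_s -> nat}).

Hypotheses (hx : even_smx x) (ux : \det (odd_block hs x) \is a GRing.unit).
Hypotheses (hx' : even_smx x') (ux' : \det (odd_block hs x') \is a GRing.unit).

Variable Theta : M -> M'.
Hypothesis ThetaL : forall (c : K) f g,
  Theta (c%:A *: f + g) = c%:A *: Theta f + Theta g.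
Hypothesis ThetaX : forall A f, Theta (fmul_dx x A f) = fmul_dx x' A (Theta f).
Hypothesis Theta0 : forall j S,
  coef (Theta (fsubst_delta M hs x j)) (S, zexp) =
  if (S == set0) && (j == zexp) then (\det (odd_block hs x'))^-1 else 0.

Lemma Theta_zero : Theta 0 = 0.
Proof.
apply: (addrI (Theta 0)).
by have := ThetaL 1 0 0; rewrite !scale1r => <-; rewrite !addr0.
Qed.

Lemma ThetaZ c f : Theta (c%:A *: f) = c%:A *: Theta f.
Proof. by have := ThetaL c f 0; rewrite !addr0 Theta_zero addr0. Qed.

Lemma intertwine_delta j : Theta (fsubst_delta M hs x j) = fsubst_delta M' hs x' j.
Proof.
have hv := delta_family_subst charK0 M hx ux.
have hv' := delta_family_subst charK0 M' hx' ux'.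
suff hw : delta_family hs x' (fun j => Theta (fsubst_delta M hs x j)).
  exact: (delta_family_unique charK0 hx' ux' hw hv' j).
split=> [{}j mu|//]; rewrite -ThetaX hv.1 -scaleNr.
have -> : - (j mu)%:R = (- (j mu)%:R : K)%:A :> R by rewrite scaleNr nat_alg.
by rewrite ThetaZ scaleNr nat_alg scaleNr.
Qed.

(** An operator that intertwines the multiplications by dx^A at x and at x' carries
omega(dt x) to omega(dt x'), provided that it is right on the functions without
derivatives of delta-functions. *)
Lemma intertwine_form omega :
  Theta (fsubst_form M hs x omega) = fsubst_form M' hs x' omega.
Proof.
have mon u : Theta (fsubst_monomial M hs x u) = fsubst_monomial M' hs x' u.
  case: u => [[k i] j]; rewrite !fsubst_monomialE -intertwine_delta.
  by elim: (word k i) => //= A w <-.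
rewrite /fsubst_form; elim: (enum_fset _) => [|u l IHl].
  by rewrite !big_nil Theta_zero.
by rewrite !big_cons ThetaL IHl mon.
Qed.

End Intertwine.

Section BaseChange.

Variables (K : fieldType) (charK0 : [pchar K] =i pred0).
Variables (R R' : superalgebra K) (r s : nat).
Variable phi : {lrmorphism R -> R'}.
Hypothesis hphi : even_morphism phi.
Variables (M : formal_space R r s) (M' : formal_space R' r s).
Variable Theta : M -> M'.
Hypothesis coef_Theta : forall f u, coef (Theta f) u = phi (coef f u).
Variables (n m : nat) (hs : (s <= m)%N) (x : 'M[R]_(r + s, n + m)).
Hypotheses (hx : even_smx x) (ux : \det (odd_block hs x) \is a GRing.unit).

Lemma map_even : even_smx (map_mx phi x).
Proof. by move=> F A; rewrite mxE; apply: hphi. Qed.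

Lemma map_odd_block : odd_block hs (map_mx phi x) = map_mx phi (odd_block hs x).
Proof. by apply/matrixP => kappa nu; rewrite !mxE. Qed.

Lemma map_unit : \det (odd_block hs (map_mx phi x)) \is a GRing.unit.
Proof. by rewrite map_odd_block det_map_mx rmorph_unit. Qed.

Lemma base_change_dt F f : Theta (fmul_dt F f) = fmul_dt F (Theta f).
Proof.
apply: coef_inj => -[S k]; rewrite coef_Theta.
have [i ->|kappa ->] := split_ordP F.
  rewrite !coef_mul_dt_even; case: ifP => _; last by rewrite rmorph0.
  by rewrite rmorphM rmorph_sign coef_Theta.
by rewrite !coef_mul_dt_odd rmorphN rmorphM rmorph_nat coef_Theta.
Qed.

Lemma base_change_form omega :
  Theta (fsubst_form M hs x omega) = fsubst_form M' hs (map_mx phi x) omega.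
Proof.
have ThetaD f g : Theta (f + g) = Theta f + Theta g.
  by apply: coef_inj => u; rewrite fcoefD !coef_Theta fcoefD rmorphD.
have Theta00 : Theta 0 = 0.
  by apply: coef_inj => u; rewrite coef_Theta !fcoef0 rmorph0.
apply: (intertwine_form charK0 hx ux map_even map_unit) => [c f g|A f|j S].
- apply: coef_inj => u; rewrite coef_linear !coef_Theta coef_linear.
  by rewrite !mulr_algl linearP.
- rewrite (big_morph Theta ThetaD Theta00); apply: eq_bigr => F _.
  rewrite base_change_dt; congr fmul_dt; apply: coef_inj => u.
  by rewrite coef_Theta !coef_mul_coef !rmorphM rmorph_sign mxE coef_Theta.
rewrite coef_Theta (delta_family_subst charK0 M hx ux).2.
case: ifP => _; last by rewrite rmorph0.
by rewrite map_odd_block det_map_mx rmorphV.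
Qed.

End BaseChange.

Section MapFormal.

Variables (K : fieldType) (R R' : superalgebra K) (r s : nat).
Variable phi : {lrmorphism R -> R'}.

Definition map_formal (f : malg_space R r s) : malg_space R' r s :=
  \sum_(u <- msupp (f : formal_function R r s))
    phi (coef f u) *: fmon (malg_space R' r s) u.

Lemma coef_map_formal f u : coef (map_formal f) u = phi (coef f u).
Proof.
rewrite /map_formal fcoef_sum.
have E v : coef (phi (coef f v) *: fmon (malg_space R' r s) v) u =
    if v == u then phi (coef f v) else 0.
  by rewrite fcoefZ coef_mon; case: eqP => _; rewrite ?mulr1 ?mulr0.
rewrite (eq_bigr _ (fun v _ => E v)).
have [uf|uf] := boolP (u \in msupp (f : formal_function R r s)).
  rewrite (bigD1_seq u uf (fset_uniq _)) /= eqxx big1 ?addr0 // => v /negPf ->.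
  by [].
have -> : coef f u = 0 by apply: (@mcoeff_outdom _ R).
rewrite rmorph0 big_seq big1 // => v vf; case: eqP => // vu.
by rewrite -vu vf in uf.
Qed.

End MapFormal.

(** * Weighted integrals and the differential equations *)

Section Integrals.

Variables (K : fieldType) (R : superalgebra K) (r s : nat).
Variable M : formal_space R r s.
Implicit Types (f : M) (w : seq 'I_(r + s)).

Definition top : dtmonomial r s := (setT, [ffun=> 0%N]).

Definition fmul_dts w f : M := foldr (fun F g => fmul_dt F g) f w.

(** The parity of dt^F1 ... dt^Fk; recall that dt^F and F have opposite
parities. *)
Definition word_parity w : bool := odd (count (fun F : 'I_(r + s) => ~~ parity F) w).

Lemma fmul_dts_linear w : central_linear (fmul_dts w).
Proof.
elim: w => [|F w IHw] c f g cc //=.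
by rewrite [fmul_dts w _]IHw // mul_dt_linear.
Qed.

Lemma scomm_dts_coef w p (a : R) :
  scomm (word_parity w) p (fmul_dts w) (@fmul_coef _ _ _ _ M p a).
Proof.
elim: w => [|F w IHw]; first by move=> f; rewrite scale1r.
rewrite /word_parity /= oddD oddb.
by apply: scomm_compl => //; [exact: mul_dt_linear | exact: scomm_mul_dt_coef].
Qed.

Lemma coef_top_mul_coef p (a : R) f :
  coef (fmul_coef p a f) top = (-1) ^+ (p && odd (r + s)) * (a * coef f top).
Proof. by rewrite coef_mul_coef /dtparity /= cardsT card_ord. Qed.

(** The sign is that of moving a to the left of all the dt^F and of the measure
D(dt). *)
Lemma coef_top_dts_coef w F p (a : R) f :
  coef (fmul_dts w (fmul_dt F (fmul_coef p a f))) top =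
  a * ((-1) ^+ (p && (word_parity (rcons w F) (+) odd (r + s))) *
       coef (fmul_dts (rcons w F) f) top).
Proof.
rewrite -[fmul_dts w _]/(fmul_dts w (fmul_dts [:: F] _)) /fmul_dts -foldr_cat.
rewrite cats1 -/(fmul_dts _ _) scomm_dts_coef fcoefZ coef_top_mul_coef.
rewrite (centralCA _ _ (central_sign _)) mulrA -signr_addb.
rewrite [RHS](centralCA a _ (central_sign _)); congr (_ ^+ _ * _).
by case: p; case: word_parity; case: odd.
Qed.

End Integrals.

Section Symmetry.

Variables (K : fieldType) (R : superalgebra K) (r s n m : nat).
Variable M : formal_space R r s.

Definition PDE_sign (F : 'I_(r + s)) (A : 'I_(n + m)) (G : 'I_(r + s)) (B : 'I_(n + m)) :=
  (parity F (+) parity A) && (word_parity [:: G; F] (+) odd (r + s)) (+)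
  (parity G (+) parity B) && (word_parity [:: G] (+) odd (r + s)).

(** Interchanging F and G only interchanges dt^F and dt^G; the signs of the two
derivatives account for the remaining factors. *)
Lemma dts_symmetric F A G B (f : M) :
  coef (fmul_dts [:: G; F] ((-1) ^+ (PDE_sign F A G B) *: f)) (top r s) +
  (-1) ^+ (parity F && parity G (+) parity B && (parity F (+) parity G)) *
  coef (fmul_dts [:: F; G] ((-1) ^+ (PDE_sign G A F B) *: f)) (top r s) = 0.
Proof.
rewrite !(clZ (@fmul_dts_linear _ _ _ _ M _)); try exact: central_sign.
have -> : fmul_dts [:: G; F] f = (-1) ^+ (~~ parity G && ~~ parity F) *: fmul_dts [:: F; G] f.
  exact: scomm_mul_dt.
rewrite !fcoefZ !mulrA -!signr_addb -mulrDl /PDE_sign /word_parity /= !oddD !oddb /=.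
case: (parity F); case: (parity G); case: (parity A); case: (parity B);
  case: (odd r); case: (odd s); rewrite /= ?addNr ?addrN ?mul0r //.
Qed.

End Symmetry.

Section Weighted.

Variables (K : fieldType) (charK0 : [pchar K] =i pred0).
Variables (n m r s : nat) (hs : (s <= m)%N).
Implicit Types (w : seq 'I_(r + s)) (omega : pseudoform K n m s).

Lemma pdiffZ A c omega : pdiff hs A (c *: omega) = c *: pdiff hs A omega.
Proof.
exact: (@scale_sumZ _ K).
Qed.

(** The integral of dt^F1 ... dt^Fk omega(dt x). These functions include the
transforms and are closed under partial derivatives. *)
Definition weighted_transform w omega : pfunction K r s n m :=
  PFunction
    (fun R x => \det (odd_block hs x) \is a GRing.unit)
    (fun R x => coef (fmul_dts w (fsubst_form (malg_space R r s) hs x omega)) (top r s)).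

Lemma weighted_transform_nil omega :
  weighted_transform [::] omega = @transform K r s n m hs omega.
Proof. reflexivity. Qed.

Lemma weighted_superfunction w omega : superfunction (weighted_transform w omega).
Proof.
move=> R R' phi hphi x hx ux; split; first exact: map_unit.
have cT := @coef_map_formal K R R' r s phi.
have dtsE w1 f : map_formal phi (fmul_dts w1 f) = fmul_dts w1 (map_formal phi f).
  by elim: w1 => //= F w1 <-; apply: base_change_dt cT _ _.
set S_ := fsubst_form (malg_space R r s) hs x omega.
suff : coef (fmul_dts w (fsubst_form (malg_space R' r s) hs (map_mx phi x) omega))
    (top r s) = phi (coef (fmul_dts w S_) (top r s)) by [].
by rewrite -(base_change_form charK0 hphi cT hx ux) -dtsE; apply: cT.
Qed.

Definition partial_sign w (F : 'I_(r + s)) (A : 'I_(n + m)) : K :=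
  (-1) ^+ ((parity F (+) parity A) &&
           (word_parity (rcons w F) (+) odd (r + s))).

Definition weighted_partial w omega F A :=
  weighted_transform (rcons w F) (partial_sign w F A *: pdiff hs A omega).

(** The increment of omega(dt x) begins with dt^F, which therefore goes to the right
end of the word. *)
Lemma weighted_partialP w omega F A :
  is_partial (weighted_transform w omega) F A (weighted_partial w omega F A).
Proof.
split=> [|R x hx ux]; first exact: weighted_superfunction.
have {}ux : \det (odd_block hs x) \is a GRing.unit by exact ux.
split; first by exact ux.
move=> eps heps eps2; have ux' := increment_unit hx ux heps eps2.
split; first by exact ux'.
set x' := x + _.
pose S_ y om := fsubst_form (malg_space R r s) hs (y : 'M[R]_(r + s, n + m)) om.
suff : coef (fmul_dts w (S_ x' omega)) (top r s) =
    coef (fmul_dts w (S_ x omega)) (top r s) +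
    eps * coef (fmul_dts (rcons w F)
      (S_ x (partial_sign w F A *: pdiff hs A omega))) (top r s) by [].
rewrite /S_ (subst_form_increment charK0 _ hx ux heps eps2) (clD (@fmul_dts_linear _ _ _ _ _ w)).
rewrite fcoefD coef_top_dts_coef fsubst_formZ sign_alg.
by rewrite (clZ (@fmul_dts_linear _ _ _ _ _ _) _ (central_sign _)) fcoefZ.
Qed.

Lemma transform_PDE omega : PDE (@transform K r s n m hs omega).
Proof.
pose c w F A := (partial_sign w F A).
exists (fun G B => weighted_partial [::] omega G B).
exists (fun F A G B => weighted_partial [:: G] (c [::] G B *: pdiff hs B omega) F A).
split=> [G B|F A G B|F G A B R x hx ux].
- rewrite -weighted_transform_nil; exact: weighted_partialP.
- exact: weighted_partialP.
pose S_ := fsubst_form (malg_space R r s) hs x.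
pose f := S_ (pdiff hs A (pdiff hs B omega)).
have SE F1 G1 : S_ (c [:: G1] F1 A *: pdiff hs A (c [::] G1 B *: pdiff hs B omega)) =
    (-1) ^+ (PDE_sign F1 A G1 B) *: f.
  by rewrite pdiffZ scalerA /S_ fsubst_formZ /c /partial_sign -signr_addb sign_alg.
have sym g1 g2 : g1 = (-1) ^+ (PDE_sign F A G B) *: f ->
    g2 = (-1) ^+ (PDE_sign G A F B) *: f ->
    coef (fmul_dts [:: G; F] g1) (top r s) +
    (-1) ^+ (parity F && parity G (+) parity B && (parity F (+) parity G)) *
    coef (fmul_dts [:: F; G] g2) (top r s) = 0.
  by move=> -> ->; apply: dts_symmetric.
exact (sym _ _ (SE F G) (SE G F)).
Qed.

End Weighted.

(** * Invariance under odd transvections *)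

Section OddTransvections.

Variables (K : fieldType) (charK0 : [pchar K] =i pred0).
Variables (R : superalgebra K) (r s : nat).
Variable M : formal_space R r s.
Variables (n m : nat) (hs : (s <= m)%N).
Implicit Types (f : M) (x : 'M[R]_(r + s, n + m)) (g : 'M[R]_(r + s)).
Implicit Types (omega : pseudoform K n m s).

Local Notation e_ := (@fmul_dt _ _ _ _ M).
Local Notation d_ := (@fdiff _ _ _ _ M).
Local Notation c_ := (@fmul_coef _ _ _ _ M).
Local Notation S_ := (fsubst_form M hs).
Local Notation unit_at x := (\det (odd_block hs x) \is a GRing.unit).

Lemma mulmx_even g x : even_smx g -> even_smx x -> even_smx (g *m x).
Proof.
move=> hg hx F A; rewrite mxE; apply: homog_sum => G.
by have := homogM (hg F G) (hx G A); rewrite addbA addbK.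
Qed.

Lemma delta_upper (i : 'I_r) (j : 'I_s) :
  delta_mx (lshift s i) (rshift r j) = block_mx 0 (delta_mx i j) 0 0 :> 'M[R]_(r + s).
Proof.
rewrite -[LHS]submxK; congr block_mx; apply/matrixP => k l;
  by rewrite !mxE !eq_shift ?andbF.
Qed.

Lemma delta_lower (i : 'I_s) (j : 'I_r) :
  delta_mx (rshift r i) (lshift s j) = block_mx 0 0 (delta_mx i j) 0 :> 'M[R]_(r + s).
Proof.
rewrite -[LHS]submxK; congr block_mx; apply/matrixP => k l;
  by rewrite !mxE !eq_shift ?andbF.
Qed.

Section Transvection.

Variables (eps : R) (F G : 'I_(r + s)) (x : 'M[R]_(r + s, n + m)).
Hypotheses (heps : homog true eps) (FG : parity F (+) parity G).
Hypotheses (hx : even_smx x) (ux : unit_at x).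

Let eta A f : M := e_ F (c_ (parity F (+) parity A) (eps * x G A) f).
Let x_ (l : seq 'I_(n + m)) := x + \sum_(A <- l) (eps * x G A) *: delta_mx F A.

(** An odd element has square zero, and eps occurs twice. *)
Lemma eps_mul2 A B : eps * x G A * (eps * x G B) = 0.
Proof.
rewrite -mulrA (mulrA (x G A)) (supercommutative (hx G A) heps) -!mulrA.
rewrite (centralCA eps _ (central_sign _)) (mulrA eps) odd_sqr //.
by rewrite mul0r mulr0.
Qed.

Lemma parityFG (A : 'I_(n + m)) : true (+) (parity G (+) parity A) = parity F (+) parity A.
Proof. by rewrite addbA; move: FG; case: (parity F); case: (parity G). Qed.

Lemma eps_entry_homog A : homog (parity F (+) parity A) (eps * x G A).
Proof. by have := homogM heps (hx G A); rewrite parityFG. Qed.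

Lemma row_term_row_term A B f : eta A (eta B f) = 0.
Proof.
rewrite /eta [c_ _ _ (e_ _ _)](scomm_sym (scomm_mul_dt_coef (M := M) F _ _)).
rewrite mul_coefM eps_mul2 mul_coef0 (cl0 (@mul_dt_linear _ _ _ _ M _)) scaler0.
exact: cl0 (@mul_dt_linear _ _ _ _ M _).
Qed.

Lemma row_term_linear A : central_linear (eta A).
Proof.
exact: central_linear_comp (@mul_dt_linear _ _ _ _ M _) (@mul_coef_linear _ _ _ _ M _ _).
Qed.

(** Adding eps times row G to row F amounts to one increment of square zero for each
column. These increments do not interact, since any two of them contain eps. *)
Lemma row_increment l :
  [/\ even_smx (x_ l), unit_at (x_ l) &
      forall omega, S_ (x_ l) omega =
        S_ x omega + \sum_(A <- l) eta A (S_ x (pdiff hs A omega))].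
Proof.
elim: l => [|A l [hl ul Sl]].
  by rewrite /x_ big_nil addr0; split=> // omega; rewrite big_nil addr0.
have -> : x_ (A :: l) = x_ l + (eps * x G A) *: delta_mx F A.
  by rewrite /x_ big_cons addrCA addrC.
have hA := eps_entry_homog A; have A2 := eps_mul2 A A.
split=> [||omega].
- exact: increment_even.
- exact: increment_unit.
rewrite (subst_form_increment charK0 M hl ul hA A2) Sl -/(eta A _).
rewrite Sl (clD (row_term_linear A)) (cl_sum (row_term_linear A)).
rewrite [X in _ + (_ + X)]big1 => [|B _]; last exact: row_term_row_term.
by rewrite addr0 big_cons -addrA [X in _ + X]addrC.
Qed.

Let gx := (1%:M + eps *: delta_mx F G) *m x.

Lemma transvection_row : gx = x_ (enum 'I_(n + m)).
Proof.
rewrite /gx /x_ mulmxDl mul1mx -scalemxAl; congr (_ + _).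
apply/matrixP => H A; rewrite big_enum /= summxE (bigD1 A) //= big1 => [|B BA].
  rewrite !mxE eqxx andbT addr0 (bigD1 G) //= big1 => [|G' G'G]; last first.
    by rewrite mxE (negPf G'G) andbF mul0r.
  by rewrite !mxE eqxx andbT addr0; case: (H == F); rewrite ?mul1r ?mul0r ?mulr1 ?mulr0.
by rewrite !mxE (eq_sym A) (negPf BA) andbF mulr0.
Qed.

(** By the chain rule, the increments of all the columns add up to a derivative
along dt^G. *)
Lemma transvection_form omega :
  S_ gx omega = S_ x omega + e_ F (c_ true eps (d_ G (S_ x omega))).
Proof.
rewrite transvection_row; have [_ _ ->] := row_increment (enum 'I_(n + m)).
rewrite (diff_subst_form charK0 M hx ux) (cl_sum (@mul_coef_linear _ _ _ _ M _ _)).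
rewrite (cl_sum (@mul_dt_linear _ _ _ _ M _)) big_enum /=; congr (_ + _).
by apply: eq_bigr => A _; rewrite mul_coefM parityFG.
Qed.

(** Integration by parts: F and G differ, so dt^F does not undo the derivative
along dt^G. *)
Lemma coef_top_total_derivative f : coef (e_ F (c_ true eps (d_ G f))) (top r s) = 0.
Proof.
have [i Fi|kappa Fk] := split_ordP F; have [j Gj|lambda Gl] := split_ordP G;
  move: FG; rewrite ?Fi ?Fk ?Gj ?Gl ?parity_lshift ?parity_rshift // => _.
  by rewrite coef_mul_dt_even coef_mul_coef coef_diff_odd ffunE !mulr0 if_same.
by rewrite coef_mul_dt_odd coef_mul_coef coef_diff_even inE !mulr0 oppr0.
Qed.

End Transvection.

Definition preserves_integral g := forall x, even_smx x -> unit_at x ->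
  [/\ even_smx (g *m x), unit_at (g *m x) &
      forall omega, coef (S_ (g *m x) omega) (top r s) = coef (S_ x omega) (top r s)].

Lemma preserves_integral1 : preserves_integral 1%:M.
Proof. by move=> x hx ux; rewrite mul1mx. Qed.

Lemma preserves_integralM g1 g2 :
  preserves_integral g1 -> preserves_integral g2 -> preserves_integral (g1 *m g2).
Proof.
move=> P1 P2 x hx ux; rewrite -mulmxA.
have [h2 u2 S2] := P2 x hx ux; have [h1 u1 S1] := P1 _ h2 u2.
split; [exact h1 | exact u1 | move=> omega].
by rewrite (S1 omega) (S2 omega).
Qed.

Lemma preserves_integral_transvection eps F G : homog true eps ->
  parity F (+) parity G -> preserves_integral (1%:M + eps *: delta_mx F G).
Proof.
move=> heps FG x hx ux; have [hl ul _] := row_increment heps FG hx ux (enum 'I_(n + m)).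
split=> [||omega].
- by rewrite transvection_row.
- by rewrite transvection_row.
by rewrite (transvection_form heps FG hx ux) fcoefD coef_top_total_derivative // addr0.
Qed.

(** Unitriangular matrices multiply by adding their off-diagonal blocks, so it
suffices to treat a block with a single entry. *)
Lemma preserves_integral_upper (u : 'M[R]_(r, s)) : (forall i j, homog true (u i j)) ->
  preserves_integral (block_mx 1%:M u 0 1%:M).
Proof.
move=> hu; rewrite [u]matrix_sum_delta.
have blockD (v w : 'M[R]_(r, s)) : block_mx 1%:M (v + w) 0 1%:M =
    block_mx 1%:M v 0 1%:M *m block_mx 1%:M w 0 1%:M.
  by rewrite mulmx_block !mulmx1 !mul1mx !mulmx0 !mul0mx !addr0 add0r addrC.
pose Q (v : 'M[R]_(r, s)) := preserves_integral (block_mx 1%:M v 0 1%:M).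
have Q0 : Q 0 by rewrite /Q -scalar_mx_block; exact preserves_integral1.
have QD v w : Q v -> Q w -> Q (v + w).
  by move=> Qv Qw; rewrite /Q blockD; exact (preserves_integralM Qv Qw).
apply: (big_ind Q Q0 QD) => i _; apply: (big_ind Q Q0 QD) => j _.
rewrite /Q (_ : block_mx _ _ _ _ = 1%:M + u i j *: delta_mx (lshift s i) (rshift r j)).
  apply: preserves_integral_transvection; first exact: hu.
  by rewrite parity_lshift parity_rshift.
by rewrite delta_upper scalar_mx_block scale_block_mx add_block_mx !scaler0 !addr0 add0r.
Qed.

Lemma preserves_integral_lower (u : 'M[R]_(s, r)) : (forall i j, homog true (u i j)) ->
  preserves_integral (block_mx 1%:M 0 u 1%:M).
Proof.
move=> hu; rewrite [u]matrix_sum_delta.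
have blockD (v w : 'M[R]_(s, r)) : block_mx 1%:M 0 (v + w) 1%:M =
    block_mx 1%:M 0 v 1%:M *m block_mx 1%:M 0 w 1%:M.
  by rewrite mulmx_block !mulmx1 !mul1mx !mulmx0 !mul0mx !addr0 add0r.
pose Q (v : 'M[R]_(s, r)) := preserves_integral (block_mx 1%:M 0 v 1%:M).
have Q0 : Q 0 by rewrite /Q -scalar_mx_block; exact preserves_integral1.
have QD v w : Q v -> Q w -> Q (v + w).
  by move=> Qv Qw; rewrite /Q blockD; exact (preserves_integralM Qv Qw).
apply: (big_ind Q Q0 QD) => i _; apply: (big_ind Q Q0 QD) => j _.
rewrite /Q (_ : block_mx _ _ _ _ = 1%:M + u i j *: delta_mx (rshift r i) (lshift s j)).
  apply: preserves_integral_transvection; first exact: hu.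
  by rewrite parity_lshift parity_rshift.
by rewrite delta_lower scalar_mx_block scale_block_mx add_block_mx !scaler0 !addr0 add0r.
Qed.

End OddTransvections.

(** * Determinants by contraction *)

Section Pairing.

Variables (K : fieldType) (R : superalgebra K) (r s : nat).
Variable M : formal_space R r s.
Implicit Types (f v : M).

Definition oprod p (Z : 'I_p -> M -> M) v : M :=
  foldr (fun j f => Z j f) v (enum 'I_p).

Lemma oprodS p (Z : 'I_p.+1 -> M -> M) v :
  oprod Z v = Z ord0 (oprod (fun j => Z (lift ord0 j)) v).
Proof. by rewrite /oprod enum_ordSl /= foldr_map. Qed.

Lemma eq_oprod p (Z Z' : 'I_p -> M -> M) v : (forall j, Z j = Z' j) ->
  oprod Z v = oprod Z' v.
Proof. by move=> ZZ'; rewrite /oprod; elim: (enum _) => //= j l ->; rewrite ZZ'. Qed.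

(** An odd derivation passes through a product with alternating signs. *)
Lemma contract_oprod p (Z : 'I_p.+1 -> M -> M) (d : M -> M) (b : 'I_p.+1 -> R) v :
  (forall j, central_linear (Z j)) -> (forall j, central (b j)) ->
  (forall j f, d (Z j f) = - Z j (d f) + b j *: f) -> d v = 0 ->
  d (oprod Z v) =
  \sum_(j < p.+1) ((-1) ^+ j * b j) *: oprod (fun i => Z (lift j i)) v.
Proof.
elim: p => [|p IHp] in Z b *; move=> lZ cb dZ dv.
  rewrite big_ord1 mul1r oprodS dZ /oprod [enum _]size0nil ?size_enum_ord //=.
  by rewrite dv (cl0 (lZ _)) oppr0 add0r.
rewrite oprodS dZ (IHp (fun j => Z (lift ord0 j)) (fun j => b (lift ord0 j))) //.
rewrite [RHS]big_ord_recl /= mul1r addrC; congr (_ + _).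
rewrite (cl_sum (lZ _)) -sumrN; apply: eq_bigr => j _.
rewrite (clZ (lZ _)); last exact/centralM/cb/central_sign.
rewrite exprS mulN1r mulNr scaleNr; congr (- (_ *: _)).
rewrite [RHS]oprodS; congr (Z _ _); first exact: val_inj.
by apply: eq_oprod => i; congr Z; apply: val_inj; rewrite /= /bump !add1n ltnS addnS.
Qed.

(** Contracting p anticommuting operators with p odd derivations is the Laplace
expansion of a determinant. *)
Lemma pairing_oprod p (Z dd : 'I_p -> M -> M) (B : 'M[even_part R]_p) v :
  (forall j, central_linear (Z j)) -> (forall j, central_linear (dd j)) ->
  (forall i j f, dd i (Z j f) = - Z j (dd i f) + val (B i j) *: f) ->
  (forall i, dd i v = 0) ->
  foldl (fun f i => dd i f) (oprod Z v) (enum 'I_p) = val (\det B) *: v.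
Proof.
have ev (y : even_part R) : central (val y).
  by apply: even_central; apply/even_predP/even_valP.
elim: p => [|p IHp] in Z dd B *; move=> lZ ld dZ dv.
  rewrite /oprod [enum _]size0nil ?size_enum_ord //=.
  by rewrite det_mx00 [even_val 1](rmorph1 (val : even_part R -> R)) scale1r.
rewrite enum_ordSl [LHS]/= (contract_oprod lZ (fun j => ev (B ord0 j)) (dZ ord0) (dv ord0)).
have foldl_sum (l : seq 'I_p) (I : finType) (c : I -> even_part R) (F : I -> M) :
    foldl (fun f i => dd i f) (\sum_j val (c j) *: F j) (map (lift ord0) l) =
    \sum_j val (c j) *: foldl (fun f i => dd (lift ord0 i) f) (F j) l.
  elim: l F => //= i l IHl F; rewrite -IHl; congr foldl.
  by rewrite (cl_sum (ld _)); apply: eq_bigr => j _; rewrite (clZ (ld _)) //; apply: ev.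
rewrite (eq_bigr (fun j : 'I_p.+1 => val ((-1) ^+ j * B ord0 j) *:
  oprod (fun i => Z (lift j i)) v)); last first.
  by move=> j _; rewrite rmorphM rmorph_sign.
rewrite foldl_sum (expand_det_row B ord0) (rmorph_sum (val : even_part R -> R)) scaler_suml.
apply: eq_bigr => j _.
rewrite (IHp _ _ (row' ord0 (col' j B))) => [|i|i|i k f|i] //.
  rewrite scalerA -rmorphM /cofactor add0n mulrA.
  by congr (val (_ * _) *: _); rewrite mulrC.
by rewrite dZ !mxE.
Qed.

Local Notation d_ := (@fdiff _ _ _ _ M).

(** Applied in this order, the derivatives remove the odd dt^i without signs. *)
Lemma coef_foldl_diff (l : seq 'I_r) (S : {set 'I_r}) k f :
  pairwise (fun a b : 'I_r => (a < b)%N) l ->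
  (forall a b, a \in l -> b \in S -> (a < b)%N) ->
  coef (foldl (fun f i => d_ (lshift s i) f) f l) (S, k) =
  coef f (S :|: [set a in l], k).
Proof.
elim/last_ind: l S => [|l i IHl] S.
  by move=> _ _; congr (coef _ (_, _)); apply/setP => a; rewrite !inE orbF.
rewrite pairwise_rcons => /andP[/allP li pl] lS; rewrite foldl_rcons coef_diff_even.
have il : i \in rcons l i by rewrite mem_rcons mem_head.
case: ifPn => [iS|iS]; first by have := lS i i il iS; rewrite ltnn.
rewrite (_ : below S i = 0%N) ?mul1r; last first.
  apply/eqP; rewrite cards_eq0; apply/eqP/setP => b; rewrite !inE.
  by apply/andP => -[bS]; rewrite ltnNge ltnW // lS.
rewrite IHl // => [|a b al].
  congr (coef _ (_, _)); apply/setP => a; rewrite !inE mem_rcons inE.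
  by case: (a == i); case: (a \in S); rewrite ?orbT.
rewrite !inE => /orP[/eqP -> |bS]; first exact: li.
by apply: lS => //; rewrite mem_rcons inE al orbT.
Qed.

Lemma coef_top_foldl_diff k f :
  coef f (setT, k) =
  coef (foldl (fun f i => d_ (lshift s i) f) f (enum 'I_r)) (set0, k).
Proof.
rewrite coef_foldl_diff.
- by congr (coef _ (_, _)); apply/setP => a; rewrite !inE mem_enum.
- have : sorted ltn (map val (enum 'I_r)) by rewrite val_enum_ord iota_ltn_sorted.
  by rewrite (sorted_pairwise ltn_trans) pairwise_map.
by move=> a b _; rewrite inE.
Qed.

End Pairing.

(** * Block-diagonal changes of variables *)

Section Blocks.

Variables (K : fieldType) (R : superalgebra K) (r s : nat).
Implicit Types (g : 'M[R]_(r + s)).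

Lemma even_drsubmx g : even_smx g -> even_mx (drsubmx g).
Proof.
by move=> hg a b; rewrite !mxE; have := hg (rshift r a) (rshift r b); rewrite !parity_rshift.
Qed.

Lemma even_ulsubmx g : even_smx g -> even_mx (ulsubmx g).
Proof.
by move=> hg a b; rewrite !mxE; have := hg (lshift s a) (lshift s b); rewrite !parity_lshift.
Qed.

Lemma odd_ursubmx g i j : even_smx g -> homog true (ursubmx g i j).
Proof.
by move=> hg; rewrite !mxE; have := hg (lshift s i) (rshift r j);
  rewrite parity_lshift parity_rshift.
Qed.

Lemma odd_dlsubmx g i j : even_smx g -> homog true (dlsubmx g i j).
Proof.
by move=> hg; rewrite !mxE; have := hg (rshift r i) (lshift s j);
  rewrite parity_lshift parity_rshift.
Qed.

End Blocks.

Section BlockDiagonal.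

Variables (K : fieldType) (charK0 : [pchar K] =i pred0).
Variables (R : superalgebra K) (r s : nat).
Variable M : formal_space R r s.
Implicit Types (f : M) (F G : 'I_(r + s)) (S : {set 'I_r}) (k : {ffun 'I_s -> nat}).

Local Notation e_ := (@fmul_dt _ _ _ _ M).
Local Notation d_ := (@fdiff _ _ _ _ M).
Local Notation c_ := (@fmul_coef _ _ _ _ M).
Local Notation zexp := ([ffun=> 0%N] : {ffun 'I_s -> nat}).

Variable g : 'M[R]_(r + s).
Hypotheses (hg : even_smx g) (g0 : forall F G, parity F != parity G -> g F G = 0).
Hypothesis ug : \det (drsubmx g) \is a GRing.unit.

(** Multiplication by the image of dt^G under dt -> dt g. *)
Definition tau G f : M := \sum_F g F G *: e_ F f.

Lemma block_central F G : central (g F G).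
Proof.
have [FG|/g0 ->] := boolP (parity F == parity G); last exact: central0.
by apply: even_central; have := hg F G; rewrite (eqP FG) addbb.
Qed.

Lemma tauE G f : fmul_dx g G f = tau G f.
Proof.
apply: eq_bigr => F _.
have [FG|FG] := boolP (parity F == parity G); last first.
  by rewrite g0 // mul_coef0 (cl0 (@mul_dt_linear _ _ _ _ M _)) scale0r.
rewrite (eqP FG) addbb mul_coef_evenE (clZ (@mul_dt_linear _ _ _ _ M _)) //.
exact: block_central.
Qed.

Lemma tau_linear G : central_linear (tau G).
Proof. by move=> c f h cc; rewrite -!tauE fmul_dx_linear. Qed.

Lemma delta_col_leqnn nu : delta_col r (leqnn s) nu = rshift r nu.
Proof. by apply: val_inj; rewrite /= subnn. Qed.

Lemma odd_block_leqnn : odd_block (leqnn s) g = drsubmx g.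
Proof. by apply/matrixP => kappa nu; rewrite !mxE delta_col_leqnn. Qed.

Let ug' : \det (odd_block (leqnn s) g) \is a GRing.unit.
Proof. by rewrite odd_block_leqnn. Qed.

Local Notation v_ := (fsubst_delta M (leqnn s) g).

Let hv : delta_family (leqnn s) g v_ := delta_family_subst charK0 M hg ug'.

Lemma tau_anticomm i j f :
  tau (lshift s i) (tau (lshift s j) f) = - tau (lshift s j) (tau (lshift s i) f).
Proof.
by rewrite -!tauE scomm_dx // !parity_lshift expr1 scaleN1r.
Qed.

Lemma tau_sqr i f : tau (lshift s i) (tau (lshift s i) f) = 0.
Proof.
(* The odd tau_i anticommutes with itself, and 2 is invertible. *)
apply: coef_inj => u; rewrite fcoef0; apply: (natrS_reg charK0 (q := 1)).
rewrite mulr_natl mulr2n; apply/eqP; rewrite addr_eq0; apply/eqP.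
by rewrite {1}tau_anticomm fcoefN.
Qed.

Fixpoint tau_prod S (l : seq 'I_r) f : M :=
  if l is i :: l' then
    if i \in S then tau (lshift s i) (tau_prod S l' f) else tau_prod S l' f
  else f.

Lemma tau_prod_cat S l1 l2 f : tau_prod S (l1 ++ l2) f = tau_prod S l1 (tau_prod S l2 f).
Proof. by elim: l1 => //= i l1 ->. Qed.

Lemma tau_prod_linear S l : central_linear (tau_prod S l).
Proof.
elim: l => //= i l IHl c f h cc; rewrite IHl //.
by case: ifP => // _; rewrite tau_linear.
Qed.

Lemma tau_prodU1 S i l f : i \notin l -> tau_prod (i |: S) l f = tau_prod S l f.
Proof.
elim: l => //= j l IHl; rewrite inE negb_or => /andP[ij /IHl ->].
by rewrite !inE eq_sym (negPf ij).
Qed.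

(** The sign counts the factors that are passed. *)
Lemma tau_tau_prod S i l f :
  tau (lshift s i) (tau_prod S l f) =
  (-1) ^+ count (mem S) l *: tau_prod S l (tau (lshift s i) f).
Proof.
elim: l => [|j l IHl] /=; first by rewrite scale1r.
case: ifP => jS /=; last by rewrite IHl add0n.
rewrite tau_anticomm IHl (clZ (tau_linear _)); last exact: central_sign.
by rewrite exprS mulN1r scaleNr.
Qed.

Lemma tau_odd_tau_prod kappa S l f :
  tau (rshift r kappa) (tau_prod S l f) = tau_prod S l (tau (rshift r kappa) f).
Proof.
elim: l => //= j l IHl; case: ifP => // _; rewrite -IHl.
by rewrite -!tauE scomm_dx // parity_rshift scale1r.
Qed.

(** The image of a monomial under dt -> dt g. The delta-functions of dt g are those
attached to the square supermatrix g, regarded as r even and s odd vectors of an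
r|s-dimensional superspace. *)
Definition Psi (u : dtmonomial r s) : M := tau_prod u.1 (enum 'I_r) (v_ u.2).

Definition change_dt : M -> M := fextend Psi.

Lemma tau_Psi_even i S k : tau (lshift s i) (Psi (S, k)) =
  if i \in S then 0 else (-1) ^+ below S i *: Psi (i |: S, k).
Proof.
rewrite /Psi /=; have [l1 [l2 [enumE il1 il2]]] := enum_split i.
rewrite (below_count _ enumE) enumE !tau_prod_cat tau_tau_prod /=.
case: ifP => iS.
  by rewrite tau_sqr (cl0 (@tau_prod_linear _ _)) scaler0.
by rewrite !inE eqxx /= !tau_prodU1.
Qed.

Lemma tau_Psi_odd kappa S k : tau (rshift r kappa) (Psi (S, k)) =
  - ((k kappa)%:R *: Psi (S, decr k kappa)).
Proof.
rewrite /Psi /= tau_odd_tau_prod -tauE -(delta_col_leqnn kappa) hv.1.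
rewrite (clN (@tau_prod_linear _ _)) (clZ (@tau_prod_linear _ _)) //.
exact: central_nat.
Qed.

Lemma mul_dt_scale F c f : e_ F (c *: f) = c *: e_ F f.
Proof.
apply: coef_inj => -[S k]; rewrite fcoefZ; have [i ->|kappa ->] := split_ordP F.
  rewrite !coef_mul_dt_even; case: ifP => _; last by rewrite mulr0.
  by rewrite fcoefZ (centralCA c _ (central_sign _)).
by rewrite !coef_mul_dt_odd fcoefZ mulrN (centralCA c _ (central_nat _)).
Qed.

Lemma tau_scale G c f : tau G (c *: f) = c *: tau G f.
Proof.
rewrite scaler_sumr; apply: eq_bigr => F _.
by rewrite mul_dt_scale !scalerA block_central.
Qed.

Lemma change_dtD c f h : change_dt (c *: f + h) = c *: change_dt f + change_dt h.
Proof. exact: fextend_linear. Qed.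

Lemma change_dt0 : change_dt 0 = 0.
Proof.
apply: (addrI (change_dt 0)).
by have := change_dtD 1 0 0; rewrite !scale1r => <-; rewrite !addr0.
Qed.

Lemma change_dtZ c f : change_dt (c *: f) = c *: change_dt f.
Proof. by rewrite -[c *: f]addr0 change_dtD change_dt0 addr0. Qed.

Lemma change_dt_mon u : change_dt (fmon M u) = Psi u.
Proof. exact: fextend_mon. Qed.

Lemma mul_dt_mon_even i S k : e_ (lshift s i) (fmon M (S, k)) =
  if i \in S then 0 else (-1) ^+ below S i *: fmon M (i |: S, k).
Proof.
apply: coef_inj => -[T k']; rewrite coef_mul_dt_even coef_mon.
case: ifPn => iT.
  case: ifPn => iS.
    rewrite fcoef0 xpair_eqE (_ : S == T :\ i = false) ?mulr0 //.
    by apply/eqP => ST; rewrite ST !inE eqxx in iS.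
  rewrite fcoefZ coef_mon !xpair_eqE.
  have -> : (S == T :\ i) = (i |: S == T).
    by apply/eqP/eqP => [->|<-]; rewrite ?setD1K ?setU1K.
  by case: eqVneq => [<-|_]; rewrite ?setU1K // !mulr0.
case: ifPn => iS; rewrite ?fcoef0 // fcoefZ coef_mon xpair_eqE.
rewrite (_ : i |: S == T = false) ?mulr0 //.
by apply/eqP => ST; rewrite -ST !inE eqxx in iT.
Qed.

Lemma mul_dt_mon_odd kappa S k : e_ (rshift r kappa) (fmon M (S, k)) =
  - ((k kappa)%:R *: fmon M (S, decr k kappa)).
Proof.
apply: coef_inj => -[T k']; rewrite coef_mul_dt_odd fcoefN fcoefZ !coef_mon !xpair_eqE.
congr (- _); rewrite [k == _]eq_sym eq_incr_decr.
case: (posnP (k kappa)) => [->|k_gt0] /=; first by rewrite andbF mulr0 mul0r.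
rewrite [k' == _]eq_sym; case: (S == T) => /=; last by rewrite !mulr0.
by case: eqVneq => [<-|_]; rewrite ?mulr0 // decrE eqxx subn1 prednK.
Qed.

Lemma change_mul_dt F f : change_dt (e_ F f) = tau F (change_dt f).
Proof.
elim/(@formal_ind _ _ _ _ M): f => [|c u f IHf].
  by rewrite (cl0 (@mul_dt_linear _ _ _ _ M F)) change_dt0 (cl0 (tau_linear F)).
rewrite (clD (@mul_dt_linear _ _ _ _ M F)) mul_dt_scale !change_dtD IHf.
rewrite (clD (tau_linear F)) tau_scale change_dt_mon; congr (_ *: _ + _).
case: u => S k; have [i ->|kappa ->] := split_ordP F.
  rewrite mul_dt_mon_even tau_Psi_even; case: ifP => _; first exact: change_dt0.
  by rewrite change_dtZ change_dt_mon.
by rewrite mul_dt_mon_odd tau_Psi_odd -!scaleNr change_dtZ change_dt_mon.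
Qed.

(** The image of a monomial must have its parity, for otherwise left multiplication
by coefficients would not be compatible with dt -> dt g. *)
Definition dt_pure (b : bool) f := forall u, dtparity u != b -> coef f u = 0.

Lemma dt_pure_tau_even i b f : dt_pure b f -> dt_pure (~~ b) (tau (lshift s i) f).
Proof.
move=> fb [S k] Sb; rewrite fcoef_sum big1 // => F _; rewrite fcoefZ.
have [j ->|kappa ->] := split_ordP F; last first.
  by rewrite g0 ?mul0r // parity_lshift parity_rshift.
rewrite coef_mul_dt_even; case: ifP => jS; last by rewrite mulr0.
rewrite fb ?mulr0 // dtparity_setD1 //.
by move: Sb; case: dtparity; case: b {fb}.
Qed.

(** Multiplying the coefficient at each monomial by the sign of its parity leaves
the defining properties of the family unchanged, up to the sign (-1)^s. *)
Lemma dt_pure_delta k : dt_pure (odd s) (v_ k).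
Proof.
have linc := @mul_coef_linear _ _ _ _ M true 1.
(* c_ true 1 multiplies the coefficient at u by the sign of dtparity u. *)
pose w k := (-1) ^+ odd s *: c_ true 1 (v_ k).
have hw : delta_family (leqnn s) g w.
  split=> [j mu|j S].
    have -> : fmul_dx g (delta_col r (leqnn s) mu) (w j) =
        (-1) ^+ odd s *: c_ true 1 (fmul_dx g (delta_col r (leqnn s) mu) (v_ j)).
      rewrite !tauE (clZ (tau_linear _)); last exact: central_sign.
      congr (_ *: _); rewrite (cl_sum linc); apply: eq_bigr => F _.
      rewrite (clZ linc); last exact: block_central.
      have [i ->|kappa ->] := split_ordP F.
        by rewrite g0 ?scale0r // parity_lshift parity_delta_col.
      by rewrite scomm_mul_dt_coef parity_rshift scale1r.
    rewrite hv.1 (clN linc) (clZ linc); last exact: central_nat.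
    by rewrite scalerN /w !scalerA (central_sign (odd s)).
  rewrite fcoefZ coef_mul_coef hv.2 mul1r mulrA -signr_addb /dtparity /=.
  case: eqP => [->|_] /=; last by rewrite mulr0.
  by rewrite cards0 add0n addbb mul1r.
move=> u up; have := congr1 (fun f => coef f u) (delta_family_unique charK0 hg ug' hv hw k).
rewrite fcoefZ coef_mul_coef mul1r mulrA -signr_addb /= addbC.
rewrite (_ : dtparity u (+) odd s = true); last by move: up; case: dtparity; case: odd.
rewrite expr1 mulN1r => uN; apply: (natrS_reg charK0 (q := 1)).
by rewrite mulr_natl mulr2n {1}uN addNr.
Qed.

Lemma card_enum_count S : count (mem S) (enum 'I_r) = #|S|.
Proof.
by rewrite -sum1_count big_enum_cond -sum1_card; apply: eq_bigl => i; rewrite inE.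
Qed.

Lemma dt_pure_Psi u : dt_pure (dtparity u) (Psi u).
Proof.
case: u => S k; rewrite /dtparity /Psi /= oddD.
have -> : #|S| = count (mem S) (enum 'I_r).
  exact/esym/card_enum_count.
elim: (enum 'I_r) => [|i l IHl] /=; first exact: dt_pure_delta.
case: ifP => _ //; rewrite oddD /= addNb.
exact: dt_pure_tau_even.
Qed.

Lemma change_mul_coef p a f : change_dt (c_ p a f) = c_ p a (change_dt f).
Proof.
have linc := @mul_coef_linear _ _ _ _ M p a.
elim/(@formal_ind _ _ _ _ M): f => [|c u f IHf].
  by rewrite (cl0 linc) change_dt0 (cl0 linc).
rewrite change_dtD change_dt_mon !(clD linc) -IHf.
have -> : c_ p a (c *: fmon M u) = ((-1) ^+ (p && dtparity u) * (a * c)) *: fmon M u.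
  apply: coef_inj => v; rewrite coef_mul_coef !fcoefZ coef_mon.
  by case: eqVneq => [->|_]; rewrite ?mulr1 ?mulr0 // !mulr0.
rewrite change_dtD change_dt_mon; congr (_ + _).
apply: coef_inj => v; rewrite coef_mul_coef !fcoefZ !mulrA.
have [->//|uv] := eqVneq (dtparity v) (dtparity u).
by rewrite (dt_pure_Psi uv) !mulr0.
Qed.

Lemma coef_tau_even i f S k : coef (tau (lshift s i) f) (S, k) =
  \sum_(j in S) g (lshift s j) (lshift s i) *
    ((-1) ^+ below (S :\ j) j * coef f (S :\ j, k)).
Proof.
rewrite fcoef_sum big_split_ord /= [X in _ + X]big1 ?addr0 => [|kappa _]; last first.
  by rewrite g0 ?scale0r ?fcoef0 // parity_lshift parity_rshift.
rewrite big_mkcond [RHS]big_mkcond /=; apply: eq_bigr => j _.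
by rewrite fcoefZ coef_mul_dt_even; case: ifP => // _; rewrite mulr0.
Qed.

Lemma coef_tau_prod_eq S l f f' k : (forall T, coef f (T, k) = coef f' (T, k)) ->
  forall T, coef (tau_prod S l f) (T, k) = coef (tau_prod S l f') (T, k).
Proof.
move=> ff'; elim: l => //= i l IHl T; case: ifP => // _.
by rewrite !coef_tau_even; apply: eq_bigr => j _; rewrite IHl.
Qed.

Lemma coef_tau_prod_card S l (y : R) (T : {set 'I_r}) :
  #|T| != count (mem S) l -> coef (tau_prod S l (y *: fmon M (set0, zexp))) (T, zexp) = 0.
Proof.
elim: l T => [|i l IHl] T /=.
  rewrite cards_eq0 fcoefZ coef_mon xpair_eqE (eq_sym set0) => /negPf ->.
  by rewrite mulr0.
case: ifP => iS; last exact: IHl.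
rewrite add1n coef_tau_even => TS; rewrite big1 // => j jT.
rewrite IHl ?mulr0 //; apply: contra TS => /eqP <-.
by rewrite (cardsD1 j T) jT.
Qed.

Lemma coef_Psi S k T : coef (Psi (S, k)) (T, zexp) =
  if k == zexp then
    coef (tau_prod S (enum 'I_r) ((\det (drsubmx g))^-1 *: fmon M (set0, zexp)))
      (T, zexp)
  else 0.
Proof.
have [->|k0] := eqVneq k zexp.
  apply: coef_tau_prod_eq => {}T.
  rewrite hv.2 eqxx andbT odd_block_leqnn fcoefZ coef_mon xpair_eqE eqxx andbT eq_sym.
  by case: eqP; rewrite ?mulr1 ?mulr0.
rewrite (@coef_tau_prod_eq _ _ _ 0) => [|{}T].
  by rewrite (cl0 (@tau_prod_linear _ _)) fcoef0.
by rewrite hv.2 (negPf k0) andbF fcoef0.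
Qed.

(** The images of monomials with derivatives of delta-functions consist of such
monomials. *)
Lemma coef_change_dt f (T : {set 'I_r}) : coef (change_dt f) (T, zexp) =
  \sum_S coef f (S, zexp) * coef (Psi (S, zexp)) (T, zexp).
Proof.
elim/(@formal_ind _ _ _ _ M): f => [|c u f IHf].
  by rewrite change_dt0 fcoef0 big1 // => S _; rewrite fcoef0 mul0r.
rewrite change_dtD coef_linear IHf change_dt_mon.
under [RHS]eq_bigr => S _ do rewrite coef_linear mulrDl.
rewrite big_split /=; congr (_ + _); case: u => S k.
rewrite (bigD1 S) //= big1 ?addr0 => [|S' S'S]; last first.
  by rewrite coef_mon xpair_eqE eq_sym (negPf S'S) mulr0 mul0r.
rewrite coef_mon xpair_eqE eqxx /=; have [->|k0] := eqVneq k zexp; first by rewrite mulr1.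
by rewrite coef_Psi (negPf k0) !mulr0 mul0r.
Qed.

(** The delta-functions contribute the inverse determinant of the odd block, and the
top product of the odd dt^i the determinant of the even block. *)
Lemma coef_change_dt_top f :
  coef (change_dt f) (top r s) =
  coef f (top r s) * (\det (ulsubmx g) * (\det (drsubmx g))^-1).
Proof.
rewrite coef_change_dt (bigD1 setT) //= big1 ?addr0 => [|S ST]; last first.
  rewrite coef_Psi eqxx coef_tau_prod_card ?mulr0 // card_enum_count cardsT.
  by apply: contra ST => /eqP rS; rewrite eqEcard subsetT cardsT -rS /=.
congr (_ * _); rewrite coef_Psi eqxx.
have [B gB] := even_mxP (even_ulsubmx hg).
pose Z (i : 'I_r) := tau (lshift s i).
pose y := (\det (drsubmx g))^-1 *: fmon M (set0, zexp).
have -> : tau_prod setT (enum 'I_r) y = oprod Z y.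
  by rewrite /oprod; elim: (enum 'I_r) => //= i l ->; rewrite inE.
have gBE i j : g (lshift s i) (lshift s j) = val (B i j).
  by have := congr1 (fun A : 'M[R]_r => A i j) gB; rewrite !mxE.
rewrite coef_top_foldl_diff.
rewrite (@pairing_oprod _ _ _ _ M r Z (fun i => d_ (lshift s i)) B) => [|j|i|i j f'|i].
- rewrite gB det_map_mx fcoefZ /y fcoefZ coef_mon eqxx mulr1.
  by [].
- exact: tau_linear.
- exact: diff_linear.
- rewrite /Z /tau (cl_sum (@diff_linear _ _ _ _ M _)).
  rewrite (eq_bigr (fun F => - (g F (lshift s j) *: e_ F (d_ (lshift s i) f')) +
    (if F == lshift s i then g F (lshift s j) *: f' else 0))); last first.
    move=> F _; rewrite (clZ (@diff_linear _ _ _ _ M _)); last exact: block_central.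
    rewrite diff_mul_dt; have [a ->|kappa ->] := split_ordP F; last first.
      by rewrite g0 ?scale0r ?oppr0 ?if_same ?addr0 // parity_lshift parity_rshift.
    rewrite !parity_lshift expr1 scaleN1r scalerDr scalerN; congr (_ + _).
    by case: eqP; rewrite ?scaler0.
  rewrite big_split /= sumrN; congr (_ + _).
  by rewrite (bigD1 (lshift s i)) //= eqxx gBE big1 ?addr0 // => F /negPf ->.
rewrite /y (clZ (@diff_linear _ _ _ _ M _)); last first.
  by apply/even_central/homogV => //; apply/even_det/even_drsubmx.
rewrite (_ : d_ _ _ = 0) ?scaler0 //; apply: coef_inj => -[S k].
rewrite fcoef0 coef_diff_even coef_mon xpair_eqE eq_sym.
have /set0Pn/negPf -> : exists l, l \in i |: S by exists i; rewrite setU11.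
by rewrite mulr0 if_same.
Qed.

Lemma coef_change_dt_delta f (y : R) (T : {set 'I_r}) :
  (forall S, coef f (S, zexp) = if S == set0 then y else 0) ->
  coef (change_dt f) (T, zexp) =
  if T == set0 then y * (\det (drsubmx g))^-1 else 0.
Proof.
move=> fy; rewrite coef_change_dt (bigD1 set0) //= big1 ?addr0 => [|S S0]; last first.
  by rewrite fy (negPf S0) mul0r.
rewrite fy eqxx coef_Psi eqxx.
case: eqVneq => [->|T0]; last first.
  by rewrite coef_tau_prod_card ?mulr0 // card_enum_count cards0 cards_eq0.
congr (_ * _); rewrite (_ : tau_prod _ _ _ = (\det (drsubmx g))^-1 *: fmon M (set0, zexp)).
  by rewrite fcoefZ coef_mon eqxx mulr1.
by elim: (enum 'I_r) => //= i l ->; rewrite inE.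
Qed.

Variables (n m : nat) (hs : (s <= m)%N) (x : 'M[R]_(r + s, n + m)).
Hypotheses (hx : even_smx x) (ux : \det (odd_block hs x) \is a GRing.unit).

Lemma odd_block_diag : odd_block hs (g *m x) = drsubmx g *m odd_block hs x.
Proof.
apply/matrixP => kappa nu; rewrite !mxE big_split_ord /= big1 ?add0r => [|i _].
  by apply: eq_bigr => l _; rewrite !mxE.
by rewrite g0 ?mul0r // parity_lshift parity_rshift.
Qed.

Lemma diag_unit : \det (odd_block hs (g *m x)) \is a GRing.unit.
Proof.
rewrite odd_block_diag even_detM ?unitrMl //; first exact: even_drsubmx.
exact: odd_block_even.
Qed.

(** The substitution dt -> dt g turns dt x into dt (g x), and it multiplies the
values without derivatives of delta-functions by the inverse determinant of the
odd block of g, just as the determinant of the odd block of g x requires. *)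
Lemma change_dt_form (hgx : even_smx (g *m x)) omega :
  fsubst_form M hs (g *m x) omega = change_dt (fsubst_form M hs x omega).
Proof.
apply/esym/(intertwine_form charK0 hx ux hgx diag_unit) => [c f h|A f|j S].
- exact: change_dtD.
- have cD (f1 f2 : M) : change_dt (f1 + f2) = change_dt f1 + change_dt f2.
    by have := change_dtD 1 f1 f2; rewrite !scale1r.
  rewrite (big_morph change_dt cD change_dt0).
  under eq_bigr => F _ do rewrite change_mul_dt change_mul_coef.
  rewrite exchange_big /=; apply: eq_bigr => G _.
  rewrite mxE mul_coef_sum (cl_sum (@mul_dt_linear _ _ _ _ M _)).
  apply: eq_bigr => F _; have [GF|GF] := boolP (parity G == parity F); last first.
    by rewrite g0 // mul0r mul_coef0 (cl0 (@mul_dt_linear _ _ _ _ M _)) scale0r.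
  rewrite (mul_coefZ _ _ _ (block_central _ _)) (eqP GF).
  by rewrite (clZ (@mul_dt_linear _ _ _ _ M _)) //; apply: block_central.
have hvx := delta_family_subst charK0 M hx ux.
pose y : R := if j == zexp then (\det (odd_block hs x))^-1 else 0.
rewrite (@coef_change_dt_delta _ y) => [|T]; last by rewrite hvx.2 /y; case: eqP.
rewrite odd_block_diag even_detM; last 2 first.
- exact: even_drsubmx.
- exact: odd_block_even.
rewrite invrM // /y; case: eqP => //= _; case: eqP => // _; by rewrite mul0r.
Qed.

Lemma diag_integral (hgx : even_smx (g *m x)) omega :
  coef (fsubst_form M hs (g *m x) omega) (top r s) =
  coef (fsubst_form M hs x omega) (top r s) *
    (\det (ulsubmx g) * (\det (drsubmx g))^-1).
Proof. by rewrite change_dt_form // coef_change_dt_top. Qed.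

End BlockDiagonal.

(** * The Berezinian *)

Section Berezinian.

Variables (K : fieldType) (charK0 : [pchar K] =i pred0).
Variables (R : superalgebra K) (r s : nat).
Implicit Types (g h : 'M[R]_(r + s)).

Lemma homogM_mx (a b : bool) p q t (X : 'M[R]_(p, q)) (Y : 'M[R]_(q, t)) :
  (forall i j, homog a (X i j)) -> (forall i j, homog b (Y i j)) ->
  forall i j, homog (a (+) b) ((X *m Y) i j).
Proof. by move=> hX hY i j; rewrite mxE; apply: homog_sum => k; apply: homogM. Qed.

(** Y Z is a sum of matrices that each contain a fixed entry of Y as a factor, and
these can be added one at a time as perturbations of square zero. *)
Lemma unit_add_odd_product (X : 'M[R]_s) (Y : 'M[R]_(s, r)) (Z : 'M[R]_(r, s)) :
  even_mx X -> (forall i j, homog true (Y i j)) -> (forall i j, homog true (Z i j)) ->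
  \det X \is a GRing.unit -> \det (X + Y *m Z) \is a GRing.unit.
Proof.
move=> hX hY hZ uX.
pose Q (W : 'M[R]_(s, r)) := forall X', even_mx X' -> \det X' \is a GRing.unit ->
  even_mx (X' + W *m Z) /\ \det (X' + W *m Z) \is a GRing.unit.
suff QY : Q Y by have [] := QY X hX uX.
have Q0 : Q 0 by move=> X' hX' uX'; rewrite mul0mx addr0.
have QD V W : Q V -> Q W -> Q (V + W).
  move=> QV QW X' hX' uX'; rewrite mulmxDl addrA.
  by have [hV uV] := QV X' hX' uX'; apply: QW.
rewrite [Y]matrix_sum_delta.
apply: (big_ind Q Q0 QD) => i _; apply: (big_ind Q Q0 QD) => j _ X' hX' uX'.
have entry a b : ((Y i j *: delta_mx i j) *m Z) a b = Y i j * ((a == i)%:R * Z j b).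
  rewrite -scalemxAl !mxE (bigD1 j) //= big1 ?addr0 => [|l lj].
    by rewrite mxE eqxx andbT.
  by rewrite mxE (negPf lj) andbF mul0r.
have hE : even_mx ((Y i j *: delta_mx i j) *m Z).
  move=> a b; rewrite entry; case: (a == i).
    by rewrite mul1r; apply: homogM_even (hY i j) (hZ j b).
  by rewrite mul0r mulr0; apply: homog0.
split; first exact: even_mxD.
apply: unit_add_sqr0 => // a b c d; rewrite !entry.
have := hZ j b; case: (a == i) => hb; last by rewrite !(mul0r, mulr0).
rewrite mul1r -mulrA (mulrA (Z j b)) (supercommutative hb (hY i j)) -!mulrA.
rewrite (centralCA (Y i j) _ (central_sign _)) (mulrA (Y i j)) odd_sqr //.
by rewrite mul0r mulr0.
Qed.

(** In the odd block, g h = 1 says that the product of the odd blocks of g and h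
differs from 1 by a product of odd matrices. *)
Lemma GLsuper_drsubmx_unit g : GLsuper g -> \det (drsubmx g) \is a GRing.unit.
Proof.
case=> hg [h [hh gh _]].
pose P := drsubmx g *m drsubmx h.
have hgd := even_drsubmx hg; have hhd := even_drsubmx hh.
have PE : P = 1%:M + (- dlsubmx g) *m ursubmx h.
  have := gh; rewrite -{1}(submxK g) -{1}(submxK h) mulmx_block scalar_mx_block.
  by case/eq_block_mx => _ _ _ E; rewrite mulNmx -E addrC addKr.
have uP : \det P \is a GRing.unit.
  rewrite PE; apply: unit_add_odd_product => [|i j|i j|].
  - exact: even_mx1.
  - by rewrite mxE; apply/homogN/odd_dlsubmx.
  - exact: odd_ursubmx.
  - by apply: (@even_unitmx _ _ _ _ 1%:M); rewrite ?mul1mx //; apply: even_mx1.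
have hP : even_mx P by apply: even_mxM.
apply: (@even_unitmx _ _ _ _ (drsubmx h *m inv_evenmx P)) => //.
  by apply: even_mxM => //; apply: even_inv.
by rewrite mulmxA even_mulmxV.
Qed.

(** The block decomposition that defines the Berezinian. *)
Lemma super_LDU g : even_smx g -> \det (drsubmx g) \is a GRing.unit ->
  g = block_mx 1%:M (ursubmx g *m inv_evenmx (drsubmx g)) 0 1%:M *m
      (block_mx (ulsubmx g - ursubmx g *m inv_evenmx (drsubmx g) *m dlsubmx g)
         0 0 (drsubmx g) *m
       block_mx 1%:M 0 (inv_evenmx (drsubmx g) *m dlsubmx g) 1%:M).
Proof.
move=> hg ug; have hd := even_drsubmx hg.
rewrite !mulmx_block !(mulmx1, mul1mx, mulmx0, mul0mx, addr0, add0r).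
rewrite !mulmxA -(mulmxA (ursubmx g) _ (drsubmx g)) even_mulVmx // mulmx1.
by rewrite even_mulmxV // mul1mx subrK submxK.
Qed.

End Berezinian.

Section Assembly.

Variables (K : fieldType) (charK0 : [pchar K] =i pred0).
Variables (n m r s : nat) (hs : (s <= m)%N) (omega : pseudoform K n m s).

Lemma GLsuper_change (R : superalgebra K) (M : formal_space R r s)
    (g : 'M[R]_(r + s)) (x : 'M[R]_(r + s, n + m)) :
  GLsuper g -> even_smx x -> \det (odd_block hs x) \is a GRing.unit ->
  \det (odd_block hs (g *m x)) \is a GRing.unit /\
  coef (fsubst_form M hs (g *m x) omega) (top r s) =
  coef (fsubst_form M hs x omega) (top r s) * Ber g.
Proof.
move=> Gg hx ux; have ud := GLsuper_drsubmx_unit charK0 Gg; have hg := Gg.1.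
have hd := even_drsubmx hg; have hV := even_inv hd.
pose a := ulsubmx g - ursubmx g *m inv_evenmx (drsubmx g) *m dlsubmx g.
pose D := block_mx a 0 0 (drsubmx g).
pose U := block_mx 1%:M (ursubmx g *m inv_evenmx (drsubmx g)) 0 1%:M : 'M[R]_(r + s).
pose L := block_mx 1%:M 0 (inv_evenmx (drsubmx g) *m dlsubmx g) 1%:M : 'M[R]_(r + s).
have hu i j : homog true ((ursubmx g *m inv_evenmx (drsubmx g)) i j).
  by rewrite -[true]/(true (+) false); apply: homogM_mx => // k l; apply: odd_ursubmx.
have hl i j : homog true ((inv_evenmx (drsubmx g) *m dlsubmx g) i j).
  by rewrite -[true]/(false (+) true); apply: homogM_mx => // k l; apply: odd_dlsubmx.
have ha i j : homog false (a i j).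
  rewrite mxE; apply: homogD; first exact: even_ulsubmx.
  rewrite mxE; apply: homogN; rewrite -[false]/(true (+) true).
  by apply: homogM_mx => // k l; apply: odd_dlsubmx.
have D0 F G : parity F != parity G -> D F G = 0.
  have [i ->|k ->] := split_ordP F; have [j ->|l ->] := split_ordP G;
    rewrite ?parity_lshift ?parity_rshift // => _.
    by rewrite block_mxEur mxE.
  by rewrite block_mxEdl mxE.
have hD : even_smx D.
  move=> F G; have [i ->|k ->] := split_ordP F; have [j ->|l ->] := split_ordP G;
    rewrite ?parity_lshift ?parity_rshift.
  - by rewrite block_mxEul.
  - by rewrite block_mxEur mxE; apply: homog0.
  - by rewrite block_mxEdl mxE; apply: homog0.
  - by rewrite block_mxEdr.
have uD : \det (drsubmx D) \is a GRing.unit by rewrite block_mxKdr.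
have gE : g = U *m (D *m L) by apply: super_LDU.
have [hLx uLx SL] := preserves_integral_lower charK0 M hl hx ux.
have hDLx := mulmx_even hD hLx.
have uDLx := diag_unit hD D0 uD hLx uLx.
have [hUx uUx SU] := preserves_integral_upper charK0 M hu hDLx uDLx.
have -> : g *m x = U *m (D *m (L *m x)) by rewrite {1}gE !mulmxA.
split; first by exact uUx.
rewrite (SU omega) (diag_integral charK0 M hD D0 uD hLx uLx hDLx omega) (SL omega).
by rewrite /D block_mxKul block_mxKdr.
Qed.

Lemma transform_BER : BER (@transform K r s n m hs omega).
Proof.
move=> R g x Gg hx; split; last first.
  move=> ux; have [_ E] := GLsuper_change (malg_space R r s) Gg hx ux; exact E.
split; last by move=> ux; have [u _] := GLsuper_change (malg_space R r s) Gg hx ux; exact u.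
have [hg [h [hh gh hg1]]] := Gg.
have Gh : GLsuper h by split=> //; exists g.
move=> ugx; have [u _] := GLsuper_change (malg_space R r s) Gh (mulmx_even hg hx) ugx.
by move: u; rewrite mulmxA hg1 mul1mx => u; exact u.
Qed.

End Assembly.

Theorem theorem9p1 (K : fieldType) (charK0 : [pchar K] =i pred0)
  (n m r s : nat) (hs : (s <= m)%N) (omega : pseudoform K n m s) :
  Voronov_Zorich_form (@transform K r s n m hs omega).
Proof.
split.
- exact (@weighted_superfunction K charK0 n m r s hs [::] omega).
- exact (transform_BER charK0 hs omega).
- exact (@transform_PDE K charK0 n m r s hs omega).
Qed.
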